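(* For each $n\ge1$ let $\mathbf d=\mathbf d_n=(d_1,\dots,d_n)$, $d_i=d_i^{(n)}$, be a graphic sequence of nonnegative integers. Assume that, as $n\to\infty$, $$\sum_{i=1}^n d_i=\Theta(n),\qquad \sum_{i=1}^n d_i^2=O(n),\qquad \max_{1\le i\le n}d_i=o(n^{1/2}).$$ Then, as $n\to\infty$, $$d_{\mathrm{TV}}\bigl(\widehat G(n,\mathbf d),G(n,\mathbf d)\bigr)\to0 .$$ In other words, there exists a coupling of $\widehat G(n,\mathbf d)$ and $G(n,\mathbf d)$ such that $\mathbb P\bigl(\widehat G(n,\mathbf d)\neq G(n,\mathbf d)\bigr)\to0$. Here $G(n,\mathbf d)$ is the uniformly random simple graph with degree sequence $\mathbf d$ and $\widehat G(n,\mathbf d)$ is the switched configuration model (with an arbitrary fixed rule for choosing which bad edge to switch).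
   Context: Graphic means that at least one simple graph on $[n]=\{1,\dots,n\}$ has degree sequence $\mathbf d$; in particular $N:=\sum_i d_i$ is even. $\Theta(n)$ means a quantity in $[cn,Cn]$ for some constants $c,C>0$ not depending on $n$. $G(n,\mathbf d)$ is a uniformly random element of the set of simple graphs with vertex set $[n]$ and degree sequence $\mathbf d$. Configuration model: assign $d_i$ half-edges $i_1,\dots,i_{d_i}$ to each vertex $i$, for a total of $N$ half-edges. A configuration is a perfect matching of the half-edges; it projects to a multigraph on $[n]$ by regarding each matched pair $\{i_\alpha,j_\beta\}$ as an edge between $i$ and $j$ (a loop if $i=j$). Let $\Gamma_0$ be a uniformly random configuration. Switched configuration model: an edge (matched pair) of a configuration is bad if it is a loop or is parallel to another edge. Starting from $\Gamma_0$, as long as the current configuration has a bad edge, choose a bad edge $i_\alpha j_\beta$ by some fixed rule (e.g. the first in lexicographic order, or a random one), choose another edge $k_\gamma\ell_\delta$ uniformly at random among all other edges of the current configuration, order its two half-edges $k_\gamma,\ell_\delta$ uniformly at random, and replace the two edges $i_\alpha j_\beta$, $k_\gamma\ell_\delta$ by $i_\alpha\ell_\delta$, $k_\gamma j_\beta$ (a switching). Stop when there are no bad edges; $\widehat G(n,\mathbf d)$ is the simple graph that the final configuration projects to. If the process does not terminate, restart with a new random configuration. $d_{\mathrm{TV}}(X,Y)=\sup_A|\mathbb P(X\in A)-\mathbb P(Y\in A)|$ is the total variation distance between the distributions of $X$ and $Y$. *)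

(* Defs.v *)
From HB Require Import structures.
From mathcomp Require Import all_boot all_order all_algebra.
From mathcomp Require Import all_classical all_reals all_analysis.

Set Implicit Arguments.
Unset Strict Implicit.
Unset Printing Implicit Defensive.

Import Order.TTheory GRing.Theory Num.Theory.
Import numFieldNormedType.Exports.

Local Open Scope ring_scope.

(** A law on a finite type [T] is given by its mass function [T -> R]. *)
Section FiniteLaws.
Variables (R : realType) (T : finType).
Implicit Types (mu nu : T -> R).

Definition mass mu (A : {set T}) : R := \sum_(x in A) mu x.

Definition uniform_law (A : {set T}) (x : T) : R :=
  if x \in A then #|A|%:R^-1 else 0.

Definition dTV mu nu : R :=
  sup (range (fun A : {set T} => `|mass mu A - mass nu A|)).

Definition coupling mu nu (pi : T * T -> R) : Prop :=
  [/\ forall p, 0 <= pi p,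
      forall x, \sum_y pi (x, y) = mu x
    & forall y, \sum_x pi (x, y) = nu y].

End FiniteLaws.

Section SimpleGraphs.
Variable n : nat.

(** A simple graph on ['I_n] is identified with its set of edges. *)
Definition simple_graph (G : {set {set 'I_n}}) : bool :=
  [forall e in G, (#|e| == 2)%N].

Definition degree (G : {set {set 'I_n}}) (i : 'I_n) : nat :=
  #|[set e in G | i \in e]|.

Definition graphs (d : 'I_n -> nat) : {set {set {set 'I_n}}} :=
  [set G | simple_graph G && [forall i, degree G i == d i]].

Definition graphic (d : 'I_n -> nat) : Prop := exists G, G \in graphs d.

End SimpleGraphs.

Section SwitchedConfigurationModel.
Variables (R : realType) (n : nat) (d : 'I_n -> nat).

Definition half_edge : finType := {i : 'I_n & 'I_(d i)}.

Implicit Types (M : {set {set half_edge}}) (e f : {set half_edge}).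

(** A perfect matching of the half-edges, as a set of pairs. *)
Definition configuration M : bool :=
  finset.partition M [set: half_edge] && [forall e in M, (#|e| == 2)%N].

Definition configurations : {set {set {set half_edge}}} :=
  [set M | configuration M].

(** The set of endpoints in ['I_n] of a matched pair: a singleton when the pair
    is a loop. *)
Definition ends e : {set 'I_n} := [set tag h | h in e].

Definition loop e : bool := (#|ends e| == 1)%N.

Definition bad M e : bool :=
  (e \in M) && (loop e || [exists f in M, (f != e) && (ends f == ends e)]).

Definition has_bad M : bool := [exists e, bad M e].

(** Taking the image set forgets multiplicities, so this is the projection of
    [M] only when [M] has no bad edge, which is the only case where it is used. *)
Definition project M : {set {set 'I_n}} := [set ends e | e in M].

(** The edges [a b] and [k l], with [p = (a, b)] and [q = (k, l)], are replaced
    by [a l] and [k b]. *)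
Definition switch M (p q : half_edge * half_edge) : {set {set half_edge}} :=
  (M :\: [set [set p.1; p.2]; [set q.1; q.2]])
    :|: [set [set p.1; q.2]; [set q.1; p.2]].

(** A possibly randomised rule: [rule M (a, b)] is the probability that the bad
    edge [{a, b}] of [M], written in the order [a b], is the one to be switched.
    Deterministic rules are those with values in [{0, 1}]. *)
Definition selection_rule
    (rule : {set {set half_edge}} -> half_edge * half_edge -> R) : Prop :=
  forall M, configuration M -> has_bad M ->
    [/\ forall p, 0 <= rule M p,
        \sum_p rule M p = 1
      & forall p, rule M p != 0 -> bad M [set p.1; p.2]].

Variable rule : {set {set half_edge}} -> half_edge * half_edge -> R.

(** Transition probabilities; configurations without bad edges are absorbing.
    The second edge is uniform among the [#|M|.-1] edges other than the first,
    and each of its two orders has probability 1/2. *)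
Definition transition M M' : R :=
  if has_bad M then
    \sum_p rule M p *
      \sum_(f in M :\ [set p.1; p.2]) (#|M|.-1)%:R^-1 *
        \sum_(q : half_edge * half_edge | [set q.1; q.2] == f)
          2^-1 * (M' == switch M p q)%:R
  else (M' == M)%:R.

(** The law of the configuration after (at most) [t] switchings, for one run of
    the process started from a uniformly random configuration. *)
Fixpoint run_law (t : nat) : {set {set half_edge}} -> R :=
  if t is t'.+1 then fun M => \sum_M0 run_law t' M0 * transition M0 M
  else uniform_law R configurations.

(** The probability that one run terminates and yields the graph [G]; the
    sequence is nondecreasing in [t] by absorption. *)
Definition terminal_law (G : {set {set 'I_n}}) : R :=
  limn (fun t => \sum_(M | ~~ has_bad M && (project M == G)) run_law t M).

Definition termination_probability : R := \sum_G terminal_law G.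

(** The law of the switched configuration model: [r] independent runs that do
    not terminate are followed by one that does and yields [G]. *)
Definition switched_law (G : {set {set 'I_n}}) : R :=
  limn (series (fun r : nat =>
    (1 - termination_probability) ^+ r * terminal_law G)).

End SwitchedConfigurationModel.

(* Main.v *)
Require Import Defs.
From mathcomp Require Import all_boot all_order all_algebra.
From mathcomp Require Import all_classical all_reals all_analysis.
From mathcomp Require Import ring lra zify perm fintype finset.

(** The switched law needs to be compared with the uniform law from one side only:
if every set [A] of graphs has switched mass at least its uniform mass minus
[eps], complements give the other inequality ([mass_diff_le]), and the maximal
coupling converts the bound on the total variation distance into a coupling.
Stopping a run after [t] switchings and forgetting about restarts only loses
mass, so it suffices to bound from below the probability that one run ends in
[A] within [t] switchings ([mass_switched_ge]).

The selection rule is eliminated by taking the worst case: [value A t M] is the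
least such probability, over all ways of choosing bad edges, for a run started
at [M]. The heart of the proof is that the choice hardly matters ([exchange]).
In a generic configuration the bad edges form items: isolated loops, and pairs
of twins (parallel edges with no third one). When there are boundedly many, all
but [O(D^2)] of the switchings of a bad edge, [D] being the maximal degree,
destroy its item and touch no other one ([conflict_good], [card_conflict]). Two
such switchings at different items commute, and the two members of a pair of
twins are exchanged by a relabelling of the half-edges at their ends, which no
projection sees. By induction on [t], the average value after switching a bad
edge is the same for all bad edges up to [O(t D^2 / N)], where [N], the number
of half-edges, has order [n].

One may therefore average over all bad edges at once.  Let level [k] consist of
the generic configurations with [k] items.  Switching is an involution on the
triples of a configuration and two ordered edges ([sum_switch]), so a sum over
level [k + 1] of the values reached by one switching is a sum of values over
level [k], each weighted by the number of reverse switchings that create an item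
([level_exchange]).  That number is close to [2 W + X M], where [W] and [X M]
are the sums of [d - 1] over the half-edges and of the products of [d - 1] over
the ordered edges ([cross_sum]); and [X] is concentrated about its mean, its
variance being [O(D^2 N) = o(N^2)] ([variance_product]).  With weights counted
so that every configuration of level [k + 1] has the same total weight
[4 (k + 1) (N - 2)], this gives, for one and the same rate [lambda],
- [P(level (k + 1)) <= lambda / (k + 1) * P(level k) + o(1)],
- [E(value (k + 1); level (k + 1)) >= lambda / (k + 1) * E(value k; level k) - o(1)].
At level 0 the configurations are simple and all graphs have equally many
preimages ([card_fibre]), so there the mean of the value is the uniform mass of
[A]; by induction it is at least this mass minus [o(1)] at each level
([level_compare]).  Finally, the non-generic configurations have probability
[O(D^2 / N)] ([few_nongeneric]), and those of level above [K] have probability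
[O(1 / K)] because the mean number of bad edges is bounded ([mean_badset]). *)

Set Implicit Arguments.
Unset Strict Implicit.
Unset Printing Implicit Defensive.
Import Order.TTheory GRing.Theory Num.Theory.
Import numFieldNormedType.Exports.
Local Open Scope ring_scope.

(** * Oriented edges and switchings *)

Definition edge (T : finType) (p : T * T) : {set T} := [set p.1; p.2].

Lemma in_edge (T : finType) (p : T * T) h : (h \in edge p) = (h == p.1) || (h == p.2).
Proof. by rewrite /edge !inE. Qed.

Definition flip (T : Type) (p : T * T) : T * T := (p.2, p.1).

Lemma edge_flip (T : finType) (p : T * T) : edge (flip p) = edge p.
Proof. by rewrite /edge /= finset.setUC. Qed.

Lemma flipK T : involutive (@flip T).
Proof. by case. Qed.

Lemma edge_eqP (T : finType) (p q : T * T) : reflect (p = q \/ p = flip q) (edge p == edge q).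
Proof.
apply: (iffP eqP) => [|[->//|->]]; last by rewrite edge_flip.
case: p q => [a b] [k l]; rewrite /edge /flip /= => E.
have a_in : a \in [set k; l] by rewrite -E !inE eqxx.
have b_in : b \in [set k; l] by rewrite -E !inE eqxx orbT.
have k_in : k \in [set a; b] by rewrite E !inE eqxx.
have l_in : l \in [set a; b] by rewrite E !inE eqxx orbT.
move: a_in b_in k_in l_in; rewrite !inE.
by do 4 (case/orP => /eqP ?); subst; auto.
Qed.

Section Configurations.
Variables (n : nat) (d : 'I_n -> nat).
Notation H := (half_edge d).
Implicit Types (M : {set {set H}}) (e f g : {set H}) (p q : H * H) (h : H).

(** Each edge is listed in its two orders, so that a switching, with the choice of
    the order in it, is a pair of members of [oriented M]. *)
Definition oriented M : {set H * H} := [set p | edge p \in M].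

Lemma mem_oriented M p : (p \in oriented M) = (edge p \in M).
Proof. by rewrite inE. Qed.

Lemma flip_oriented M p : (flip p \in oriented M) = (p \in oriented M).
Proof. by rewrite !inE edge_flip. Qed.

Lemma configurationP M :
  reflect [/\ forall e, e \in M -> #|e| = 2%N,
              forall h, exists2 e, e \in M & h \in e
            & forall e f h, e \in M -> f \in M -> h \in e -> h \in f -> e = f]
          (configuration M).
Proof.
apply: (iffP andP) => [[/and3P[/eqP cov /trivIsetP triv no0] /forall_inP c2]|].
  split.
  - by move=> e /c2/eqP.
  - move=> h; have : h \in cover M by rewrite cov inE.
    by case/bigcupP=> e eM he; exists e.
  - move=> e f h eM fM he hf; apply/eqP/negPn/negP => ef.
    have := triv e f eM fM ef; rewrite -setI_eq0 => /eqP/setP/(_ h).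
    by rewrite !inE he hf.
move=> [c2 cov triv]; split; last by apply/forall_inP => e /c2 ->.
apply/and3P; split.
- apply/eqP/setP => h; rewrite inE; apply/bigcupP.
  by have [e eM he] := cov h; exists e.
- apply/trivIsetP => e f eM fM ef; rewrite -setI_eq0; apply/eqP/setP => h.
  rewrite !inE; apply/negP => /andP[he hf]; case/eqP: ef; exact: triv he hf.
- by apply/negP => /c2; rewrite cards0.
Qed.

Lemma oriented_neq M p : configuration M -> p \in oriented M -> p.1 != p.2.
Proof.
move=> /configurationP[c2 _ _]; rewrite inE => /c2.
by rewrite cards2; case: (_ == _).
Qed.

Lemma oriented_disj M p q h : configuration M ->
  p \in oriented M -> q \in oriented M -> h \in edge p -> h \in edge q ->
  edge p = edge q.
Proof. by move=> /configurationP[_ _ tr]; rewrite !mem_oriented => pM qM; apply: tr. Qed.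

Lemma oriented_fst_inj M p q : configuration M ->
  p \in oriented M -> q \in oriented M -> p.1 = q.1 -> p = q.
Proof.
move=> cM pM qM pq.
have E : edge p = edge q.
  by apply: (oriented_disj cM pM qM (h := p.1)); rewrite in_edge ?pq eqxx.
case/eqP/edge_eqP: E => // E; move: pq; rewrite E /= => E2.
by have := oriented_neq cM qM; rewrite E2 eqxx.
Qed.

Lemma oriented_snd_inj M p q : configuration M ->
  p \in oriented M -> q \in oriented M -> p.2 = q.2 -> p = q.
Proof.
move=> cM; rewrite -(flip_oriented M p) -(flip_oriented M q) => pM qM pq.
by rewrite -[p]flipK -[q]flipK (oriented_fst_inj cM pM qM).
Qed.

Lemma edge_orient M e : configuration M -> e \in M ->
  exists2 p, p \in oriented M & e = edge p.
Proof.
move=> /configurationP[c2 _ _] eM; have /eqP/cards2P[a [b [_ E]]] := c2 _ eM.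
by exists (a, b); rewrite ?mem_oriented /edge -?E.
Qed.

Lemma orient_at M h : configuration M -> exists2 p, p \in oriented M & p.1 = h.
Proof.
move=> cM; have [_ cov _] := configurationP _ cM.
have [e eM he] := cov h; have [[a b] pM E] := edge_orient cM eM.
move: he; rewrite E !in_edge /= => /orP[]/eqP ->; first by exists (a, b).
by exists (b, a); rewrite // -[(b, a)]/(flip (a, b)) flip_oriented.
Qed.

Lemma ends_edge p : ends (edge p) = [set tag p.1; tag p.2].
Proof. by rewrite /ends /edge imsetU !imset_set1. Qed.

Lemma ends_tag p : ends (edge p) = edge (tag p.1, tag p.2).
Proof. by rewrite ends_edge. Qed.

Lemma loop_edge p : loop (edge p) = (tag p.1 == tag p.2).
Proof. by rewrite /loop ends_edge cards2; case: (tag p.1 == tag p.2). Qed.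

Lemma loop_ends e f : ends e = ends f -> loop e = loop f.
Proof. by rewrite /loop => ->. Qed.

(** The two edges that the switching of [p] and [q] creates, ordered so that
    switching them restores [p] and [q]. *)
Definition swap p q : (H * H) * (H * H) := ((p.1, q.2), (q.1, p.2)).

Lemma swapK p q : swap (swap p q).1 (swap p q).2 = (p, q).
Proof. by case: p q => [? ?] []. Qed.

Lemma mem_switch M p q e : (e \in switch M p q) =
  (e \in M) && (e != edge p) && (e != edge q)
  || (e == edge (swap p q).1) || (e == edge (swap p q).2).
Proof.
by rewrite /switch !inE negb_or -/(edge p) -/(edge q) -orbA [_ && (e \in M)]andbC andbA.
Qed.

Section Switch.
Variables (M : {set {set H}}) (p q : H * H).
Hypotheses (cM : configuration M) (pM : p \in oriented M) (qM : q \in oriented M)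
  (pq : edge p != edge q).
Notation M' := (switch M p q).
Notation p' := (swap p q).1.
Notation q' := (swap p q).2.

Lemma switch_distinct : [/\ p.1 != p.2, q.1 != q.2 &
  [/\ p.1 != q.1, p.1 != q.2, p.2 != q.1 & p.2 != q.2]].
Proof.
have D h : h \in edge p -> h \in edge q -> False.
  by move=> h1 h2; case/eqP: pq; exact: (oriented_disj cM pM qM h1 h2).
split; rewrite ?(oriented_neq cM) //; split; apply/eqP => E.
- by apply: (D p.1); rewrite !in_edge ?E eqxx ?orbT.
- by apply: (D p.1); rewrite !in_edge ?E eqxx ?orbT.
- by apply: (D p.2); rewrite !in_edge ?E eqxx ?orbT.
- by apply: (D p.2); rewrite !in_edge ?E eqxx ?orbT.
Qed.

Lemma swap_notin : (edge p' \notin M) * (edge q' \notin M).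
Proof.
have [_ _ [a1 a2 a3 a4]] := switch_distinct.
split; apply/negP => E.
- have E2 : edge p' = edge p.
    by apply: (oriented_disj cM (p := p') (q := p) (h := p.1));
      rewrite ?mem_oriented ?E -?mem_oriented // in_edge eqxx.
  have : q.2 \in edge p by rewrite -E2 !in_edge eqxx orbT.
  by rewrite !in_edge (eq_sym q.2) (negPf a2) eq_sym (negPf a4).
- have E2 : edge q' = edge q.
    by apply: (oriented_disj cM (p := q') (q := q) (h := q.1));
      rewrite ?mem_oriented ?E -?mem_oriented // in_edge eqxx.
  have : p.2 \in edge q by rewrite -E2 !in_edge eqxx orbT.
  by rewrite !in_edge (negPf a3) (negPf a4).
Qed.

Lemma swap_neq : edge p' != edge q'.
Proof.
have [_ _ [a1 a2 a3 a4]] := switch_distinct.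
apply/eqP => E; have : p.1 \in edge q' by rewrite -E !in_edge eqxx.
have [a _ _] := switch_distinct.
by rewrite !in_edge /= (negPf a1) (negPf a).
Qed.

Lemma swap_oriented : (p' \in oriented M') * (q' \in oriented M').
Proof. by rewrite !mem_oriented !mem_switch !eqxx !orbT. Qed.

Lemma switchK : switch M' p' q' = M.
Proof.
have [n1 n2] := swap_notin.
have [pM1 qM1] : edge p \in M /\ edge q \in M by rewrite -!mem_oriented.
apply/setP => e; rewrite !mem_switch.
have -> : edge (swap p' q').1 = edge p by [].
have -> : edge (swap p' q').2 = edge q by [].
have [->|e1] := eqVneq e (edge p); first by rewrite pM1 !orbT.
have [->|e2] := eqVneq e (edge q); first by rewrite qM1 !orbT.
have [->|e3] := eqVneq e (edge p'); first by rewrite (negPf n1).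
have [->|e4] := eqVneq e (edge q'); first by rewrite (negPf n2).
by case: (e \in M).
Qed.

Lemma switch_conf : configuration M'.
Proof.
have [c2 cov tr] := configurationP _ cM.
have [b1 b2 [a1 a2 a3 a4]] := switch_distinct.
have out e h : e \in M -> e != edge p -> e != edge q -> h \in e ->
    h \notin edge p' /\ h \notin edge q'.
  move=> eM ep eq he.
  have X h' : h' \in edge p :|: edge q -> h' != h.
    move=> h'in; apply/eqP => E; move: h'in; rewrite E finset.in_setU => /orP[h1|h1].
      by case/eqP: ep; apply: tr he h1 => //; rewrite -mem_oriented.
    by case/eqP: eq; apply: tr he h1 => //; rewrite -mem_oriented.
  by rewrite !in_edge !negb_or !(eq_sym h) !X // finset.in_setU !in_edge eqxx ?orbT.
have pq' h : h \in edge p' -> h \in edge q' -> False.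
  rewrite !in_edge => /orP[]/eqP -> /=.
    by rewrite (negPf a1) (negPf b1).
  by rewrite eq_sym (negPf b2) eq_sym (negPf a4).
apply/configurationP; split.
- move=> e; rewrite mem_switch => /orP[/orP[/andP[/andP[/c2//]]|/eqP->]|/eqP->].
    by rewrite cards2 /= a2.
  by rewrite cards2 /= eq_sym a3.
- move=> h; have [e eM he] := cov h.
  have [E|e1] := eqVneq e (edge p).
    move: he; rewrite E !in_edge => /orP[]/eqP ->.
      by exists (edge p'); rewrite ?mem_switch ?eqxx ?orbT // !in_edge eqxx.
    by exists (edge q'); rewrite ?mem_switch ?eqxx ?orbT // !in_edge eqxx orbT.
  have [E|e2] := eqVneq e (edge q).
    move: he; rewrite E !in_edge => /orP[]/eqP ->.
      by exists (edge q'); rewrite ?mem_switch ?eqxx ?orbT // !in_edge eqxx.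
    by exists (edge p'); rewrite ?mem_switch ?eqxx ?orbT // !in_edge eqxx orbT.
  by exists e; rewrite // mem_switch eM e1 e2.
- move=> e f h; rewrite !mem_switch.
  move=> /orP[/orP[/andP[/andP[eM e1] e2]|/eqP->]|/eqP->];
  move=> /orP[/orP[/andP[/andP[fM f1] f2]|/eqP->]|/eqP->] he hf //.
  + exact: tr he hf.
  + by case: (out _ _ eM e1 e2 he); rewrite hf.
  + by case: (out _ _ eM e1 e2 he); rewrite hf.
  + by case: (out _ _ fM f1 f2 hf); rewrite he.
  + by case: (pq' h).
  + by case: (out _ _ fM f1 f2 hf); rewrite he.
  + by case: (pq' h).
Qed.

End Switch.

Lemma swap_switch M p q :
  edge p \in M -> edge q \in M -> edge p != edge q -> configuration M ->
  M :\: [set edge p; edge q] =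
  switch M p q :\: [set edge (swap p q).1; edge (swap p q).2].
Proof.
move=> pM qM pq cM; rewrite -!mem_oriented in pM qM.
have [n1 n2] := swap_notin cM pM qM pq.
apply/setP => e.
rewrite !finset.in_setD !finset.in_set2 mem_switch !negb_or.
have [->|] := eqVneq e (edge (swap p q).1); first by rewrite (negPf n1) andbF.
have [->|] := eqVneq e (edge (swap p q).2); first by rewrite (negPf n2) !andbF.
by rewrite /= !orbF => _ _; rewrite andbC andbA.
Qed.

Lemma switch_flip M p q : switch M (flip p) (flip q) = switch M p q.
Proof.
rewrite /switch /=; congr (_ :\: _ :|: _).
- by rewrite (finset.setUC [set p.2]) (finset.setUC [set q.2]).
- by rewrite finset.setUC (finset.setUC [set p.2]) (finset.setUC [set q.2]).
Qed.

(** Switchings of disjoint pairs of edges act on different edges of [M], and by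
    [swap_notin] neither creates an edge that the other one removes. *)
Lemma switchC M p q p0 q0 : configuration M ->
  p \in oriented M -> q \in oriented M -> p0 \in oriented M -> q0 \in oriented M ->
  edge p != edge q -> edge p0 != edge q0 ->
  edge p != edge p0 -> edge p != edge q0 -> edge q != edge p0 -> edge q != edge q0 ->
  switch (switch M p0 q0) p q = switch (switch M p q) p0 q0.
Proof.
move=> cM pM qM p0M q0M pq pq0 h1 h2 h3 h4.
have [n1 n2] := swap_notin cM pM qM pq.
have [n3 n4] := swap_notin cM p0M q0M pq0.
rewrite !mem_oriented in pM qM p0M q0M.
have N2 e : e \in M -> [/\ e != edge (swap p q).1, e != edge (swap p q).2,
    e != edge (swap p0 q0).1 & e != edge (swap p0 q0).2].
  by move=> eM; split; apply/eqP => E; [move: n1|move: n2|move: n3|move: n4];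
     rewrite -E eM.
have [pa pb pc pd] := N2 _ pM; have [qa qb qc qd] := N2 _ qM.
have [ra rb rc rd] := N2 _ p0M; have [sa sb sc sd] := N2 _ q0M.
apply/setP => e; rewrite !mem_switch.
have [->|_] := eqVneq e (edge (swap p q).1).
  by rewrite (eq_sym _ (edge p0)) (eq_sym _ (edge q0)) ra sa !orbT.
have [->|_] := eqVneq e (edge (swap p q).2).
  by rewrite (eq_sym _ (edge p0)) (eq_sym _ (edge q0)) rb sb !orbT.
have [->|_] := eqVneq e (edge (swap p0 q0).1).
  by rewrite (eq_sym _ (edge p)) (eq_sym _ (edge q)) pc qc !orbT.
have [->|_] := eqVneq e (edge (swap p0 q0).2).
  by rewrite (eq_sym _ (edge p)) (eq_sym _ (edge q)) pd qd !orbT.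
by rewrite !orbF -!andbA; do !bool_congr.
Qed.

End Configurations.

(** * Bad edges and the switchings that remove them *)

Section BadEdges.
Variables (n : nat) (d : 'I_n -> nat).
Notation H := (half_edge d).
Implicit Types (M : {set {set H}}) (e f g : {set H}) (p q : H * H) (h : H).

Definition badset M := [set e | bad M e].

Lemma badset_sub M e : e \in badset M -> e \in M.
Proof. by rewrite inE => /andP[]. Qed.

Lemma badsetP M e : reflect (e \in M /\ (loop e \/ exists f, [/\ f \in M, f != e & ends f = ends e]))
  (e \in badset M).
Proof.
rewrite inE /bad; apply: (iffP andP) => -[eM H1]; split=> //.
  case/orP: H1 => [|/exists_inP[f fM /andP[fe /eqP E]]]; first by left.
  by right; exists f.
case: H1 => [->//|[f [fM fe E]]]; apply/orP; right.
by apply/exists_inP; exists f => //; rewrite fe E eqxx.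
Qed.

Lemma badset_parallel M e f : e \in M -> f \in M -> f != e -> ends f = ends e ->
  e \in badset M.
Proof. by move=> eM fM fe E; apply/badsetP; split=> //; right; exists f. Qed.

Lemma badset_loop M e : e \in M -> loop e -> e \in badset M.
Proof. by move=> eM le; apply/badsetP; split=> //; left. Qed.

Lemma has_badE M : has_bad M = (badset M != set0).
Proof.
apply/existsP/set0Pn => -[e]; first by exists e; rewrite inE.
by rewrite inE; exists e.
Qed.

(** The bad edges of a generic configuration form items: isolated loops, and pairs
    of twins. *)
Definition generic M := [forall e in M, forall f in M, (f != e) && (ends f == ends e) ==>
  ~~ loop e && [forall g in M, (ends g == ends e) ==> (g == e) || (g == f)]].

Lemma genericP M : reflect (forall e f, e \in M -> f \in M -> f != e -> ends f = ends e ->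
    ~~ loop e /\ forall g, g \in M -> ends g = ends e -> g = e \/ g = f) (generic M).
Proof.
apply: (iffP forall_inP) => [G e f eM fM fe E|G e eM].
  move: (forall_inP (G e eM) f fM); rewrite fe E eqxx /= => /andP[nl /forall_inP G2].
  split=> // g gM gE; move: (G2 g gM); rewrite gE eqxx /=.
  by case/orP=> /eqP ->; [left|right].
apply/forall_inP => f fM; apply/implyP => /andP[fe /eqP E].
have [nl G2] := G e f eM fM fe E; rewrite nl /=.
apply/forall_inP => g gM; apply/implyP => /eqP gE.
by case: (G2 g gM gE) => ->; rewrite eqxx ?orbT.
Qed.

Lemma generic_badset M M' : badset M' \subset badset M -> generic M -> generic M'.
Proof.
move=> /subsetP sB /genericP G; apply/genericP => e f eM fM fe E.
have eB : e \in badset M by apply: sB; apply: badset_parallel fe E.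
have fB : f \in badset M.
  by apply/sB/(badset_parallel (f := e)) => //; rewrite 1?eq_sym.
have [nl G2] := G e f (badset_sub eB) (badset_sub fB) fe E.
split=> // g gM gE; have [->|ge] := eqVneq g e; first by left.
apply: G2 => //; apply: badset_sub; apply: sB.
by apply: (badset_parallel (f := e)) => //; rewrite eq_sym.
Qed.

(** The switching destroys the item of [p], leaves all the other items in place and
    creates none; a switching at another item remains possible after it. *)
Definition good M p q :=
  badset (switch M p q) == badset M :\: [set e | ends e == ends (edge p)].

Lemma goodP M p q : good M p q ->
  forall e, (e \in badset (switch M p q)) = (e \in badset M) && (ends e != ends (edge p)).
Proof. by move=> /eqP -> e; rewrite finset.in_setD inE andbC. Qed.

Lemma good_sub M p q : good M p q -> badset (switch M p q) \subset badset M.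
Proof. by move=> /eqP ->; apply: subsetDl. Qed.

(** The ways in which switching [p] with [q] may destroy another item or create one:
    [q] is bad, a new edge is a loop, or a new edge is parallel to one of [M].  The
    two new edges are parallel to each other only if [q] is a loop or parallel to
    [p], hence bad. *)
Definition conflict M p q := [|| edge q \in badset M, tag q.2 == tag p.1, tag q.1 == tag p.2,
  [exists r in oriented M, (tag r.1 == tag p.1) && (tag r.2 == tag q.2)] |
  [exists r in oriented M, (tag r.1 == tag p.2) && (tag r.2 == tag q.1)]].

Lemma conflict_good M p q : configuration M -> generic M ->
  p \in oriented M -> q \in oriented M -> edge p != edge q -> edge p \in badset M ->
  ~~ conflict M p q -> good M p q.
Proof.
move=> cM gM pM qM pq pB; rewrite !negb_or => /and5P[c1 c2 c3 /exists_inP c4 /exists_inP c5].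
have [pM1 qM1] : edge p \in M /\ edge q \in M by rewrite -!mem_oriented.
have n1 e : e \in M -> ends e != ends (edge (swap p q).1).
  move=> /(edge_orient cM)[r rM ->]; apply/eqP; rewrite !ends_tag => /eqP/edge_eqP E.
  apply: c4; case: E => -[E1 E2]; first by exists r; rewrite // E1 E2 !eqxx.
  by exists (flip r); rewrite ?flip_oriented //= E1 E2 !eqxx.
have n2 e : e \in M -> ends e != ends (edge (swap p q).2).
  move=> /(edge_orient cM)[r rM ->]; apply/eqP; rewrite !ends_tag => /eqP/edge_eqP E.
  apply: c5; case: E => -[E1 E2]; last by exists r; rewrite // E1 E2 !eqxx.
  by exists (flip r); rewrite ?flip_oriented //= E1 E2 !eqxx.
have n12 : ends (edge (swap p q).1) != ends (edge (swap p q).2).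
  apply/eqP; rewrite !ends_tag => /eqP/edge_eqP[][] /= E1 E2.
    case/negP: c1; apply: (badset_parallel (f := edge p)) => //.
    by rewrite !ends_tag E1 E2.
  by case/negP: c1; apply: badset_loop; rewrite // loop_edge E2 eqxx.
have l1 : ~~ loop (edge (swap p q).1) by rewrite loop_edge /= eq_sym.
have l2 : ~~ loop (edge (swap p q).2) by rewrite loop_edge.
have G := genericP _ gM.
apply/eqP/setP => e; rewrite finset.in_setD [in RHS]inE; apply/idP/andP.
  move=> /badsetP[]; rewrite mem_switch -orbA => /orP[|/orP[]].
  - move=> /andP[/andP[eM ep] eq]; case=> [le|[f [fM' fe E]]].
      have eB := badset_loop eM le; split=> //; apply/eqP => E.
      by have [] := G e (edge p) eM pM1 _ (esym E); rewrite ?le // eq_sym.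
    move: fM'; rewrite mem_switch -orbA => /orP[/andP[/andP[fM fp] fq]|/orP[]/eqP Ef].
    + split; last exact: (badset_parallel eM fM).
      apply/eqP => E2; have [_ /(_ _ pM1 (esym E2))[E3|E3]] := G e f eM fM fe E.
        by rewrite E3 eqxx in ep.
      by rewrite E3 eqxx in fp.
    + by have := n1 e eM; rewrite -E Ef eqxx.
    + by have := n2 e eM; rewrite -E Ef eqxx.
  - move=> /eqP ->; case=> [l|[f []]]; first by rewrite l in l1.
    rewrite mem_switch -orbA => /orP[/andP[/andP[fM _] _]|/orP[]/eqP ->].
    + by move=> _ E; have := n1 f fM; rewrite E eqxx.
    + by rewrite eqxx.
    + by move=> _ E; rewrite E eqxx in n12.
  - move=> /eqP ->; case=> [l|[f []]]; first by rewrite l in l2.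
    rewrite mem_switch -orbA => /orP[/andP[/andP[fM _] _]|/orP[]/eqP ->].
    + by move=> _ E; have := n2 f fM; rewrite E eqxx.
    + by move=> _ E; rewrite E eqxx in n12.
    + by rewrite eqxx.
move=> [ep eB]; have eM := badset_sub eB.
have eq : e != edge q by apply/eqP => E; rewrite -E eB in c1.
have ep' : e != edge p by apply/eqP => E; rewrite E eqxx in ep.
have eM' : e \in switch M p q by rewrite mem_switch eM ep' eq.
case/badsetP: eB => _ [le|[f [fM fe E]]]; first exact: badset_loop.
apply: (badset_parallel (f := f)) => //; rewrite mem_switch fM /=.
have -> : f != edge p by apply/eqP => E2; rewrite -E E2 eqxx in ep.
suff -> : f != edge q by [].
apply/eqP => E2; case/negP: c1; rewrite -E2.
by apply: (badset_parallel (f := e)) => //; rewrite eq_sym.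
Qed.

Lemma card_bigcup_le (I T : finType) (A : {pred I}) (F : I -> {set T}) :
  (#|\bigcup_(i in A) F i| <= \sum_(i in A) #|F i|)%N.
Proof.
elim/big_rec2: _ => [|i m B _ le]; first by rewrite cards0.
by rewrite (leq_trans (leq_card_setU _ _)) // leq_add2l.
Qed.

Lemma card_vertex i : #|[set h : H | tag h == i]| = d i.
Proof.
rewrite -[RHS]card_ord -[RHS](card_imset _ (f := fun a : 'I_(d i) => (Tagged (fun i => 'I_(d i)) a : H))).
  apply: eq_card => h; rewrite inE; apply/eqP/imsetP; last by case=> a _ ->.
  by case: h => j a /= E; subst j; exists a.
by move=> a b /eqP; rewrite eq_Tagged => /eqP.
Qed.

Lemma card_oriented_fst M (P : pred (H * H)) (A : {set H}) : configuration M ->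
  (forall q, q \in oriented M -> P q -> q.1 \in A) ->
  (#|[set q in oriented M | P q]| <= #|A|)%N.
Proof.
move=> cM PA; rewrite -(card_in_imset (f := fst)).
  apply: subset_leq_card; apply/subsetP => h /imsetP[q]; rewrite inE => /andP[qM Pq] ->.
  exact: PA.
move=> q r; rewrite !inE => /andP[qM _] /andP[rM _].
by apply: (oriented_fst_inj cM); rewrite inE.
Qed.

Lemma card_oriented_snd M (P : pred (H * H)) (A : {set H}) : configuration M ->
  (forall q, q \in oriented M -> P q -> q.2 \in A) ->
  (#|[set q in oriented M | P q]| <= #|A|)%N.
Proof.
move=> cM PA; rewrite -(card_in_imset (f := snd)).
  apply: subset_leq_card; apply/subsetP => h /imsetP[q]; rewrite inE => /andP[qM Pq] ->.
  exact: PA.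
move=> q r; rewrite !inE => /andP[qM _] /andP[rM _].
by apply: (oriented_snd_inj cM); rewrite inE.
Qed.

Lemma card_oriented_in M (B : {set {set H}}) : configuration M -> B \subset M ->
  (#|[set q in oriented M | edge q \in B]| <= 2 * #|B|)%N.
Proof.
move=> cM /subsetP BM; apply: leq_trans (card_oriented_fst (A := cover B) cM _) _.
  by move=> q _ qB; apply/bigcupP; exists (edge q); rewrite // in_edge eqxx.
apply: leq_trans (card_bigcup_le _ _) _; rewrite mulnC -sum_nat_const leq_sum // => e /BM eM.
by case/configurationP: cM => ->.
Qed.

Variable D : nat.
Hypothesis dD : forall i, (d i <= D)%N.

Lemma card_neighbours M i : configuration M ->
  (#|\bigcup_(r in [set r in oriented M | tag r.1 == i]) [set h : H | tag h == tag r.2]| <= D * D)%N.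
Proof.
move=> cM; apply: leq_trans (card_bigcup_le _ _) _.
apply: (@leq_trans (\sum_(r in [set r in oriented M | tag r.1 == i]) D)).
  by apply: leq_sum => r _; rewrite card_vertex.
rewrite sum_nat_const leq_mul2r; apply/orP; right.
apply: leq_trans (card_oriented_fst (A := [set h | tag h == i]) cM _) _ => [q _|].
  by rewrite inE.
by rewrite card_vertex.
Qed.

Lemma card_conflict M p : configuration M ->
  (#|[set q in oriented M | conflict M p q]| <= 2 * #|badset M| + 2 * D + 2 * D * D)%N.
Proof.
move=> cM.
set S1 := [set q in oriented M | edge q \in badset M].
set S2 := [set q in oriented M | tag q.2 == tag p.1].
set S3 := [set q in oriented M | tag q.1 == tag p.2].
set S4 := [set q in oriented M | [exists r in oriented M, (tag r.1 == tag p.1) && (tag r.2 == tag q.2)]].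
set S5 := [set q in oriented M | [exists r in oriented M, (tag r.1 == tag p.2) && (tag r.2 == tag q.1)]].
have sub : [set q in oriented M | conflict M p q] \subset S1 :|: (S2 :|: S3) :|: (S4 :|: S5).
  apply/subsetP => q; rewrite !inE => /andP[-> /=].
  by rewrite /conflict inE => /or4P[->|->|->|/orP[]->]; rewrite ?orbT.
apply: leq_trans (subset_leq_card sub) _.
have c1 : (#|S1| <= 2 * #|badset M|)%N.
  by apply: card_oriented_in => //; apply/subsetP => e; apply: badset_sub.
have c2 : (#|S2| <= D)%N.
  apply: leq_trans (card_oriented_snd (A := [set h | tag h == tag p.1]) cM _) _ => [q _|].
    by rewrite inE.
  by rewrite card_vertex.
have c3 : (#|S3| <= D)%N.
  apply: leq_trans (card_oriented_fst (A := [set h | tag h == tag p.2]) cM _) _ => [q _|].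
    by rewrite inE.
  by rewrite card_vertex.
have c4 : (#|S4| <= D * D)%N.
  apply: leq_trans (card_oriented_snd cM _) (card_neighbours (tag p.1) cM) => q _.
  case/exists_inP => r rM /andP[r1 r2]; apply/bigcupP; exists r; rewrite ?inE ?r1 ?andbT //.
  by rewrite -mem_oriented.
  by rewrite eq_sym.
have c5 : (#|S5| <= D * D)%N.
  apply: leq_trans (card_oriented_fst cM _) (card_neighbours (tag p.2) cM) => q _.
  case/exists_inP => r rM /andP[r1 r2]; apply/bigcupP; exists r; rewrite ?inE ?r1 ?andbT //.
  by rewrite -mem_oriented.
  by rewrite eq_sym.
have := leq_card_setU (S1 :|: (S2 :|: S3)) (S4 :|: S5).
have := leq_card_setU S1 (S2 :|: S3).
have := leq_card_setU S2 S3; have := leq_card_setU S4 S5.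
move=> -[h1 _] [h2 _] [h3 _] [h4 _]; lia.
Qed.

End BadEdges.

(** * The worst-case probability of ending in a set of graphs *)

Section Values.
Variables (R : realType) (n : nat) (d : 'I_n -> nat).
Notation H := (half_edge d).
Implicit Types (e f g : {set H}) (p q : H * H) (h : H).
Implicit Types (s : {perm H}) (A : {set {set {set 'I_n}}}) (M : {set {set H}}).

(** Compares sums over two sets of indices that agree up to a small exceptional set;
    each exception costs at most 1. *)
Lemma ler_sum_except (I : finType) (A B C : {set I}) (F G : I -> R) :
  (forall i, F i <= 1) -> (forall i, 0 <= G i) ->
  (forall i, i \in A -> i \notin C -> F i <= 0 \/ i \in B /\ F i <= G i) ->
  \sum_(i in A) F i <= \sum_(i in B) G i + #|C|%:R.
Proof.
move=> F1 G0 sub; rewrite -sum1_card natr_sum big_mkcond.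
rewrite [X in _ <= X + _]big_mkcond [X in _ <= _ + X]big_mkcond -big_split /=.
apply: ler_sum => i _; have := F1 i; have := G0 i; have := sub i.
case: (i \in A) => [/(_ isT)|_]; case: (i \in C) => /=.
- by case: ifP => _ _; lra.
- by move=> /(_ isT)[le0|[-> le0]]; [case: ifP => _|]; lra.
- by case: ifP => _; lra.
- by case: ifP => _; lra.
Qed.

Lemma sum_in01 (I : finType) (A : {set I}) (F : I -> R) :
  (forall i, 0 <= F i <= 1) -> 0 <= \sum_(i in A) F i <= #|A|%:R.
Proof.
move=> F01; apply/andP; split; first by apply: sumr_ge0 => i _; case/andP: (F01 i).
rewrite -sum1_card natr_sum; apply: ler_sum => i _; by case/andP: (F01 i).
Qed.

Definition partners M p := [set q in oriented M | edge q != edge p].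

Lemma partnersP M p q : reflect (q \in oriented M /\ edge q != edge p) (q \in partners M p).
Proof. by rewrite [_ \in partners _ _]inE; apply: andP. Qed.

Lemma card_oriented M : configuration M -> #|oriented M| = #|{: H}|.
Proof.
move=> cM; rewrite -(card_in_imset (f := fst)); last first.
  by move=> q r qM rM; apply: (oriented_fst_inj cM).
rewrite -[RHS]cardsT; apply: eq_card => h; rewrite [RHS]inE; apply/imsetP.
by have [p pM <-] := orient_at h cM; exists p.
Qed.

Lemma card_same_edge p : (#|[set q | edge q == edge p]| <= 2)%N.
Proof.
rewrite (_ : [set q | _] = [set p; flip p]); first by rewrite cards2; case: (_ != _).
by apply/setP => q; rewrite !inE; apply/edge_eqP/orP => -[]/eqP; auto.
Qed.

Lemma card_partners M p : configuration M -> p \in oriented M ->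
  #|partners M p| = (#|{: H}| - 2)%N.
Proof.
move=> cM pM; rewrite -(card_oriented cM).
have -> : partners M p = oriented M :\: [set p; flip p].
  apply/setP => q; rewrite finset.in_setD finset.in_set2 andbC [LHS]inE; congr (_ && ~~ _).
  by apply/edge_eqP/orP => -[]/eqP; auto.
rewrite cardsD (setIidPr _) ?cards2; last first.
  by apply/subsetP => q; rewrite finset.in_set2 => /orP[]/eqP -> //; rewrite flip_oriented.
have := oriented_neq cM pM; case: p {pM} => a b /= ab.
by rewrite /flip /= xpair_eqE (negPf ab).
Qed.

Definition avg (phi : {set {set H}} -> R) M p : R :=
  (#|{: H}| - 2)%:R^-1 * \sum_(q in partners M p) phi (switch M p q).

Lemma avg01 phi M p : configuration M -> p \in oriented M ->
  (forall M', 0 <= phi M' <= 1) -> 0 <= avg phi M p <= 1.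
Proof.
move=> cM pM phi01; have /andP[l u] := sum_in01 (partners M p) (fun q => phi01 (switch M p q)).
rewrite /avg mulr_ge0 ?invr_ge0 ?ler0n //= card_partners // in u *.
have [->|N0] := posnP (#|{: H}| - 2); first by rewrite invr0 mul0r ler01.
by rewrite mulrC ler_pdivrMr ?ltr0n // mul1r.
Qed.

Lemma le_avg phi psi M p : configuration M -> p \in oriented M ->
  (forall M', configuration M' -> phi M' <= psi M') -> avg phi M p <= avg psi M p.
Proof.
move=> cM pM le; apply: ler_wpM2l; first by rewrite invr_ge0 ler0n.
apply: ler_sum => q /partnersP[qM qp]; apply/le/switch_conf => //.
by rewrite eq_sym.
Qed.

(** Switching [p] written in the other order with [q] is switching [p] with [q]
    written in the other order, and both orders of [q] occur in the average. *)
Lemma avg_flip phi M p : avg phi M (flip p) = avg phi M p.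
Proof.
rewrite /avg; congr (_ * _).
rewrite (reindex_inj (inv_inj (@flipK H))) /=.
apply: eq_big => [q|q _]; last by rewrite switch_flip.
by apply/partnersP/partnersP; rewrite flip_oriented !edge_flip.
Qed.

(** The least probability, over all adaptive choices of the bad edge to be switched,
    that a run from [M] stops within [t] switchings at a graph of [A].  Unlike the
    same probability for a given rule, it is invariant under relabelling the
    half-edges.  No average exceeds the default 1 of the minimum. *)
Fixpoint value A t M : R :=
  if ~~ has_bad M then (project M \in A)%:R else
  if t is t'.+1 then
    \big[Order.min/1]_(p in oriented M | edge p \in badset M) avg (value A t') M p
  else 0.

Lemma value_stop A t M : ~~ has_bad M -> value A t M = (project M \in A)%:R.
Proof. by case: t => [|t] /= ->. Qed.

Lemma value0_bad A M : has_bad M -> value A 0 M = 0.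
Proof. by move=> /= ->. Qed.

Lemma valueS A t M : has_bad M -> value A t.+1 M =
    \big[Order.min/1]_(p in oriented M | edge p \in badset M) avg (value A t) M p.
Proof. by move=> /= ->. Qed.

Lemma value_step A t M p : p \in oriented M -> edge p \in badset M ->
  value A t.+1 M <= avg (value A t) M p.
Proof.
move=> pM pB; have hb : has_bad M by rewrite has_badE; apply/set0Pn; exists (edge p).
by rewrite valueS //; apply: bigmin_le_cond; rewrite pM.
Qed.

Lemma le_value A t M c : has_bad M -> c <= 1 ->
  (forall p, p \in oriented M -> edge p \in badset M -> c <= avg (value A t) M p) ->
  c <= value A t.+1 M.
Proof. by move=> hb c1 le; rewrite valueS //; apply: le_bigmin => // p /andP[]; apply: le. Qed.

Lemma value_ge0 A t M : 0 <= value A t M.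
Proof.
elim: t M => [|t IH] M /=; case: ifP => // _.
apply: le_bigmin; first exact: ler01.
by move=> p _; rewrite /avg mulr_ge0 ?invr_ge0 // sumr_ge0.
Qed.

Lemma value_le1 A t M : value A t M <= 1.
Proof.
case: t => [|t] /=; case: ifP => _ //; try by case: (_ \in A); rewrite ?ler01 ?lexx.
exact: bigmin_le_id.
Qed.

Lemma value01 A t M : 0 <= value A t M <= 1.
Proof. by rewrite value_ge0 value_le1. Qed.

Lemma value_mono A t M : configuration M -> value A t M <= value A t.+1 M.
Proof.
elim: t M => [|t IH] M cM; have [hb|hb] := boolP (has_bad M); try by rewrite !value_stop.
  by rewrite value0_bad // value_ge0.
apply: le_value => //; first exact: value_le1.
move=> p pM pB; apply: le_trans (value_step _ _ pM pB) _.
exact: le_avg.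
Qed.

Arguments value : simpl never.

(** ** Relabelling the half-edges at their vertices *)

Definition relabel s M : {set {set H}} := [set [set s h | h in (e : {set H})] | e in M].
Definition pairm s p : H * H := (s p.1, s p.2).

Lemma imset_perm_inj s : injective (fun e : {set H} => s @: e).
Proof. exact/imset_inj/perm_inj. Qed.

Lemma mem_relabel s M e : (s @: e \in relabel s M) = (e \in M).
Proof. by rewrite /relabel mem_imset //; apply: imset_perm_inj. Qed.

Lemma edge_pairm s p : edge (pairm s p) = s @: edge p.
Proof. by rewrite /edge imsetU !imset_set1. Qed.

Lemma pairm_inj s : injective (pairm s).
Proof. by move=> [a b] [k l] [/perm_inj -> /perm_inj ->]. Qed.

Lemma relabelP s M e : reflect (exists2 f, f \in M & e = s @: f) (e \in relabel s M).
Proof. exact: imsetP. Qed.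

Section TagPreserving.
Variable s : {perm H}.
Hypothesis sT : forall h, tag (s h) = tag h.

Lemma ends_relabel e : ends (s @: e) = ends e.
Proof.
rewrite /ends -imset_comp; apply: eq_imset => h /=; exact: sT.
Qed.

Lemma badset_relabel M e : (s @: e \in badset (relabel s M)) = (e \in badset M).
Proof.
apply/badsetP/badsetP; rewrite mem_relabel => -[eM H1]; split=> //.
  case: H1 => [|[f [/relabelP[f' f'M ->]]]]; first by rewrite /loop ends_relabel; left.
  rewrite (inj_eq (@imset_perm_inj s)) !ends_relabel => fe E; right; by exists f'.
case: H1 => [|[f [fM fe E]]]; first by rewrite /loop ends_relabel; left.
by right; exists (s @: f); rewrite mem_relabel (inj_eq (@imset_perm_inj s)) !ends_relabel.
Qed.

Lemma has_bad_relabel M : has_bad (relabel s M) = has_bad M.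
Proof.
rewrite !has_badE; apply/set0Pn/set0Pn => -[e].
  move=> eB; have /relabelP[f fM E] := badset_sub eB.
  by exists f; rewrite -badset_relabel -E.
by move=> eB; exists (s @: e); rewrite badset_relabel.
Qed.

Lemma project_relabel M : project (relabel s M) = project M.
Proof.
rewrite /project /relabel -imset_comp; apply: eq_imset => e /=; exact: ends_relabel.
Qed.

Lemma switch_relabel M p q :
  switch (relabel s M) (pairm s p) (pairm s q) = relabel s (switch M p q).
Proof.
apply/setP => e.
have [f ->] : exists f, e = s @: f.
  exists ((s^-1)%g @: e); rewrite -imset_comp -[LHS]imset_id.
  by apply: eq_imset => h /=; rewrite permKV.
rewrite mem_relabel !mem_switch mem_relabel.
have E p' : (s @: f == edge (pairm s p')) = (f == edge p').
  by rewrite edge_pairm (inj_eq (@imset_perm_inj s)).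
by rewrite !E; congr (_ || _ || _); rewrite -E // -E.
Qed.

Lemma oriented_relabel M p : (pairm s p \in oriented (relabel s M)) = (p \in oriented M).
Proof. by rewrite !mem_oriented edge_pairm mem_relabel. Qed.

Lemma avg_relabel phi M p : (forall M', phi (relabel s M') = phi M') ->
  avg phi (relabel s M) (pairm s p) = avg phi M p.
Proof.
move=> inv; rewrite /avg; congr (_ * _).
rewrite (reindex_inj (@pairm_inj s)) /=; apply: eq_big => [q|q _].
  apply/partnersP/partnersP; rewrite oriented_relabel !edge_pairm.
    by rewrite (inj_eq (@imset_perm_inj s)).
  by rewrite (inj_eq (@imset_perm_inj s)).
by rewrite switch_relabel inv.
Qed.

Lemma value_relabel A t M : value A t (relabel s M) = value A t M.
Proof.
elim: t M => [|t IH] M.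
  by rewrite /value has_bad_relabel project_relabel.
have [hb|hb] := boolP (has_bad M); last first.
  by rewrite !value_stop ?has_bad_relabel // project_relabel.
rewrite !valueS ?has_bad_relabel //.
rewrite (reindex_inj (@pairm_inj s)) /=; apply: eq_big => [p|p _].
  by rewrite oriented_relabel edge_pairm badset_relabel.
exact: avg_relabel.
Qed.

End TagPreserving.

(** The permutation that interchanges the half-edges of the two twins maps the
    configuration to itself and one twin to the other, and the value is invariant
    under it. *)
Lemma avg_twin A t M p p0 : configuration M -> p \in oriented M -> p0 \in oriented M ->
  ends (edge p) = ends (edge p0) -> avg (value A t) M p = avg (value A t) M p0.
Proof.
move=> cM pM p0M E.
wlog [E1 E2] : p0 p0M E / tag p.1 = tag p0.1 /\ tag p.2 = tag p0.2.
  move=> W; have : edge (tag p.1, tag p.2) == edge (tag p0.1, tag p0.2) by rewrite -!ends_tag E.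
  case/edge_eqP => -[E1 E2].
  - exact: W.
  - rewrite -[RHS]avg_flip; apply: W; rewrite ?flip_oriented ?edge_flip //.
have [Ep|Np] := eqVneq (edge p) (edge p0).
  by case/eqP/edge_eqP: Ep => ->; rewrite ?avg_flip.
have [b1 b2 [a1 a2 a3 a4]] := switch_distinct cM pM p0M Np.
pose s := (tperm p.1 p0.1 * tperm p.2 p0.2)%g.
have sT h : tag (s h) = tag h.
  have tp a b : tag a = tag b -> forall h', tag (tperm a b h') = tag h' :> 'I_n.
    by move=> ab h'; case: tpermP => [->|->|].
  by rewrite permM !tp.
have sym (x y : H) : x != y -> y != x by rewrite eq_sym.
have sp : pairm s p = p0.
  rewrite /pairm /s !permM tpermL (tpermD a3 (sym _ _ b2)) (tpermD b1 (sym _ _ a3)) tpermL.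
  by case: (p0).
have sp0 : pairm s p0 = p.
  rewrite /pairm /s !permM tpermR (tpermD (sym _ _ b1) (sym _ _ a2)) (tpermD a2 b2) tpermR.
  by case: (p).
have sM : relabel s M = M.
  have sub e : e \in M -> s @: e \in M.
    move=> eM; have [->|ep] := eqVneq e (edge p).
      by rewrite -edge_pairm sp -mem_oriented.
    have [->|ep0] := eqVneq e (edge p0).
      by rewrite -edge_pairm sp0 -mem_oriented.
    suff -> : s @: e = e by [].
    rewrite -[RHS]imset_id; apply: eq_in_imset => h he.
    have [_ _ tr] := configurationP _ cM; rewrite !mem_oriented in pM p0M.
    have hp : h \notin edge p by apply/negP => h1; case/eqP: ep; apply: tr he h1.
    have hp0 : h \notin edge p0 by apply/negP => h1; case/eqP: ep0; apply: tr he h1.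
    move: hp hp0; rewrite !in_edge !negb_or => /andP[h1 h2] /andP[h3 h4].
    by rewrite permM !tpermD // eq_sym.
  apply/eqP; rewrite eqEcard; apply/andP; split.
    by apply/subsetP => e /relabelP[f fM ->]; apply: sub.
  by rewrite card_imset //; apply: imset_perm_inj.
by rewrite -(avg_relabel (s := s)) ?sM ?sp // => M'; apply: value_relabel.
Qed.

(** ** Two switchings in either order *)

Lemma good_stays M p q e : configuration M -> p \in oriented M -> q \in oriented M ->
  edge p != edge q -> good M p q -> e \in badset M -> ends e != ends (edge p) ->
  e \in badset (switch M p q) /\ e != edge q.
Proof.
move=> cM pM qM pq g eB ee; have eB' : e \in badset (switch M p q) by rewrite (goodP g) eB.
split=> //; have [n1 n2] := swap_notin cM pM qM pq.
have eM := badset_sub eB; have := badset_sub eB'; rewrite mem_switch eM.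
have -> : (e == edge (swap p q).1) = false by apply/eqP => E; rewrite -E eM in n1.
have -> : (e == edge (swap p q).2) = false by apply/eqP => E; rewrite -E eM in n2.
by rewrite !orbF => /andP[].
Qed.

Section Exchange.
Variables (K kappa : nat).
Hypothesis few_conflicts : forall M p, configuration M -> generic M ->
  (#|badset M| <= K)%N -> p \in oriented M -> edge p \in badset M ->
  (#|[set q in partners M p | ~~ good M p q]| <= kappa)%N.
Hypothesis H2 : (2 < #|{: H}|)%N.

Notation O := ((#|{: H}| - 2)%:R : R).

(** Each of the [t + 1] steps of the comparison of two bad edges loses at most
    [2 kappa + 4] partners: [kappa] conflicting ones for either edge, and the 4
    orders of the two edges created by the first switching, which have no
    counterpart before it. *)
Definition slack (t : nat) : R := t.+1%:R * ((2 * kappa + 4)%:R / O).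

Lemma O_gt0 : 0 < O.
Proof. by rewrite ltr0n subn_gt0. Qed.

Lemma slack_ge0 t : 0 <= slack t.
Proof. by rewrite /slack mulr_ge0 ?ler0n // divr_ge0 ?ler0n // ltW // O_gt0. Qed.

Lemma slackS t : O * slack t.+1 = O * slack t + kappa%:R + (kappa + 4)%:R.
Proof.
rewrite /slack -[t.+2]addn1 natrD mulrDl mul1r mulrDr -addrA; congr (_ + _).
rewrite mulrC divfK ?lt0r_neq0 ?O_gt0 // -natrD; congr _%:R; lia.
Qed.

Lemma avg_le_slack phi M p p0 (x : R) :
  \sum_(q in partners M p) phi (switch M p q) <=
    \sum_(q in partners M p0) phi (switch M p0 q) + O * x ->
  avg phi M p - x <= avg phi M p0.
Proof.
move=> le; rewrite lerBlDr /avg -[x](mulKf (lt0r_neq0 O_gt0)) -mulrDr.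
by rewrite ler_pM2l ?invr_gt0 ?O_gt0.
Qed.

Lemma card_good M p (P : pred (H * H)) : configuration M -> p \in oriented M ->
  (#|[set q in partners M p | P q]|)%:R <= O.
Proof.
move=> cM pM; rewrite ler_nat -(card_partners cM pM).
by apply: subset_leq_card; apply/subsetP => q; rewrite inE => /andP[].
Qed.

(** Switch [p0] first.  By induction the value that remains is, up to the slack, at
    least its average after switching [p] next.  The two switchings commute when
    they are good, so this is the double average for [p] switched first and [p0]
    second; and having switched [p], the value is at most the average for switching
    [p0].  When one switching is left the average for [p] is small, since the item of
    [p0] survives a good switching. *)
Lemma exchange A t M p p0 : configuration M -> generic M -> (#|badset M| <= K)%N ->
  p \in oriented M -> edge p \in badset M -> p0 \in oriented M -> edge p0 \in badset M ->
  avg (value A t) M p - slack t <= avg (value A t) M p0.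
Proof.
elim: t M p p0 => [|t IH] M p p0 cM gM KM pM pB p0M p0B;
have [E|E] := eqVneq (ends (edge p)) (ends (edge p0)); have O0 := O_gt0;
  try by rewrite (avg_twin _ _ cM pM p0M E) lerBlDr lerDl slack_ge0.
(* One switching left: after a good switching of [p] the edge [p0] is still bad. *)
- have sum_le : \sum_(q in partners M p) value A 0 (switch M p q) <= kappa%:R.
    have := few_conflicts cM gM KM pM pB; rewrite -(ler_nat R); apply: le_trans.
    have := @ler_sum_except _ (partners M p) finset.set0
      [set q in partners M p | ~~ good M p q]
      (fun q => value A 0 (switch M p q)) (fun=> 0).
    rewrite big_set0 add0r; apply => [q|//|q qP]; first exact: value_le1.
    rewrite inE qP /= negbK => g; left; have /partnersP[qM qp] := qP.
    rewrite -[X in X <= _]/(value A 0 (switch M p q)) value0_bad // has_badE.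
    apply/set0Pn; exists (edge p0).
    by apply: (good_stays _ pM qM _ g p0B _).1 => //; rewrite eq_sym.
  have : 0 <= avg (value A 0) M p0.
    by case/andP: (avg01 cM p0M (value01 A 0)).
  suff : avg (value A 0) M p <= slack 0 by lra.
  rewrite /avg /slack mul1r mulrC ler_pM2r ?invr_gt0 //.
  apply: le_trans sum_le _; rewrite ler_nat; lia.
set G0 := [set q in partners M p0 | good M p0 q].
set G1 := [set q in partners M p | good M p q].
have G0P q0 : q0 \in G0 -> [/\ q0 \in oriented M, edge p0 != edge q0 & good M p0 q0].
  by rewrite inE => /andP[/partnersP[? ?] ?]; rewrite eq_sym.
have G1P q : q \in G1 -> [/\ q \in oriented M, edge p != edge q & good M p q].
  by rewrite inE => /andP[/partnersP[? ?] ?]; rewrite eq_sym.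
(* Switching [p0] first and then [p] is nearly optimal, by induction. *)
have stepa : \sum_(q0 in G0) (avg (value A t) (switch M p0 q0) p - slack t) <=
    \sum_(q0 in partners M p0) value A t.+1 (switch M p0 q0).
  rewrite [X in _ <= X](big_setID G0) /= -[X in X <= _]addr0.
  have -> : partners M p0 :&: G0 = G0.
    by apply/setIidPr/subsetP => q; rewrite inE => /andP[].
  apply: lerD; last by apply: sumr_ge0 => q _; apply: value_ge0.
  apply: ler_sum => q0 /G0P[q0M pq0 g].
  have pB0 := (good_stays cM p0M q0M pq0 g pB E).1.
  have cM0 := switch_conf cM p0M q0M pq0.
  have pM0 : p \in oriented (switch M p0 q0) by rewrite mem_oriented (badset_sub pB0).
  apply: le_value.
  - by rewrite has_badE; apply/set0Pn; exists (edge p).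
  - have /andP[_] := avg01 cM0 pM0 (value01 A t).
    have := slack_ge0 t; lra.
  - move=> r rM rB; apply: IH => //.
      exact: generic_badset (good_sub g) gM.
    exact: leq_trans (subset_leq_card (good_sub g)) KM.
have pp0 : edge p != edge p0 by apply: contraNneq E => ->.
(* The second average, restricted to pairs of good switchings, with the two
   switchings put in the other order. *)
have stepb q0 : q0 \in G0 ->
    O^-1 * (\sum_(q in G1 | edge q != edge q0) value A t (switch (switch M p q) p0 q0))
    <= avg (value A t) (switch M p0 q0) p.
  move=> /G0P[q0M pq0 g]; rewrite /avg ler_pM2l ?invr_gt0 //.
  have [_ pnq0] := good_stays cM p0M q0M pq0 g pB E.
  rewrite big_mkcond [X in _ <= X]big_mkcond; apply: ler_sum => q _.
  case: ifP => [/andP[/G1P[qM pq g1] qq0]|_]; last by case: ifP => // _; apply: value_ge0.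
  have [_ p0q] : edge p0 \in badset (switch M p q) /\ edge p0 != edge q.
    by apply: good_stays; rewrite // eq_sym.
  rewrite eq_sym in p0q; rewrite ifT; last first.
    apply/partnersP; split; last by rewrite eq_sym.
    by rewrite mem_oriented mem_switch -mem_oriented qM p0q qq0.
  by rewrite (switchC cM pM qM p0M q0M pq pq0 pp0 pnq0 p0q qq0).
(* After switching [p], the value is at most the average for switching [p0]; the
   sum on the right lacks [kappa + 4] of its partners. *)
have stepd q : q \in G1 ->
    value A t.+1 (switch M p q) - O^-1 * (kappa + 4)%:R <=
    O^-1 * (\sum_(q0 in G0 | edge q != edge q0) value A t (switch (switch M p q) p0 q0)).
  move=> /G1P[qM pq g].
  have [p0B' p0q] : edge p0 \in badset (switch M p q) /\ edge p0 != edge q.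
    by apply: good_stays; rewrite // eq_sym.
  have p0M' : p0 \in oriented (switch M p q) by rewrite mem_oriented (badset_sub p0B').
  apply: (@le_trans _ _ (avg (value A t) (switch M p q) p0 - O^-1 * (kappa + 4)%:R)).
    by rewrite lerD2r; apply: value_step.
  rewrite /avg -mulrBr ler_pM2l ?invr_gt0 // lerBlDr.
  set C := [set q0 | edge q0 == edge (swap p q).1] :|:
    [set q0 | edge q0 == edge (swap p q).2] :|: [set q0 in partners M p0 | ~~ good M p0 q0].
  have cC : (#|C| <= kappa + 4)%N.
    have [h1 _] := leq_card_setU ([set q0 | edge q0 == edge (swap p q).1] :|:
      [set q0 | edge q0 == edge (swap p q).2]) [set q0 in partners M p0 | ~~ good M p0 q0].
    have [h2 _] := leq_card_setU [set q0 | edge q0 == edge (swap p q).1]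
      [set q0 | edge q0 == edge (swap p q).2].
    have h3 := card_same_edge (swap p q).1; have h4 := card_same_edge (swap p q).2.
    have h5 := few_conflicts cM gM KM p0M p0B.
    apply: leq_trans h1 _; rewrite addnC leq_add //.
    by apply: leq_trans h2 _; apply: (leq_add h3 h4).
  rewrite [X in X + _](_ : _ = \sum_(q0 in [set q0 in G0 | edge q != edge q0])
     value A t (switch (switch M p q) p0 q0)); last by apply: eq_bigl => q0; rewrite inE.
  have cCR : #|C|%:R <= (kappa + 4)%:R :> R by rewrite ler_nat.
  apply: (le_trans _ (lerD (lexx _) cCR)).
  apply: ler_sum_except => [q0|q0|q0]; rewrite ?value_le1 ?value_ge0 //.
  move=> /partnersP[q0M' q0p0]; rewrite !finset.in_setU !negb_or => /andP[/andP[e1 e2] e3].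
  rewrite inE in e1; rewrite inE in e2.
  move: q0M'; rewrite mem_oriented mem_switch (negPf e1) (negPf e2) !orbF -mem_oriented.
  move=> /andP[/andP[q0M q0p] q0q].
  have q0P : q0 \in partners M p0 by apply/partnersP.
  right; rewrite lexx; split=> //; rewrite inE eq_sym q0q andbT /G0 inE q0P.
  by move: e3; rewrite inE q0P /= negbK.
have card0 : #|G0|%:R <= O by apply: card_good.
have card1 : #|G1|%:R <= O by apply: card_good.
have stepe : \sum_(q in partners M p) value A t.+1 (switch M p q) <=
    \sum_(q in G1) value A t.+1 (switch M p q) + kappa%:R.
  have kR : #|[set q in partners M p | ~~ good M p q]|%:R <= kappa%:R :> R.
    by rewrite ler_nat; apply: few_conflicts.
  apply: (le_trans _ (lerD (lexx _) kR)).
  apply: ler_sum_except => [q|q|q qP]; rewrite ?value_le1 ?value_ge0 //.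
  by rewrite inE qP /= negbK => g; right; rewrite /G1 inE qP g.
have main : \sum_(q in G1) value A t.+1 (switch M p q) - (kappa + 4)%:R <=
    \sum_(q0 in partners M p0) value A t.+1 (switch M p0 q0) + O * slack t.
  apply: (@le_trans _ _ (\sum_(q in G1) (value A t.+1 (switch M p q) - O^-1 * (kappa + 4)%:R))).
    set c := O^-1 * (kappa + 4)%:R.
    have cO : #|G1|%:R * c <= (kappa + 4)%:R.
      by rewrite /c mulrCA ler_pdivrMl // ler_wpM2r.
    by rewrite sumrB sumr_const -[c *+ _]mulr_natl; lra.
  apply: (@le_trans _ _ (\sum_(q0 in G0) avg (value A t) (switch M p0 q0) p)).
    apply: le_trans (ler_sum _ stepb).
    rewrite -mulr_sumr (exchange_big_dep (mem G1)) /=; last by move=> q0 q _ /andP[].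
    rewrite mulr_sumr; apply: ler_sum => q qG1; apply: le_trans (stepd q qG1) _.
    rewrite ler_pM2l ?invr_gt0 // le_eqVlt; apply/orP; left; apply/eqP.
    by apply: eq_bigl => q0; rewrite qG1.
  move: stepa; rewrite sumrB sumr_const -[slack t *+ _]mulr_natl => stepa.
  have := ler_wpM2r (slack_ge0 t) card0; lra.
apply: avg_le_slack; rewrite slackS; apply: le_trans stepe _.
by move: main; rewrite lerBlDr -!addrA [_ + (kappa + 4)%:R]addrC; lra.
Qed.

End Exchange.
End Values.

(** * Levels and the switching involution *)

Section Levels.
Variables (R : realType) (n : nat) (d : 'I_n -> nat).
Notation H := (half_edge d).
Implicit Types (M : {set {set H}}) (e f g : {set H}) (p q r : H * H) (h : H).

(** The triples [(M, p, q)] are permuted by the involution that switches [p] and [q]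
    in [M] and keeps the edges created in place of [p] and [q]. *)
Lemma sum_switch (F : {set {set H}} -> H * H -> H * H -> R) :
  \sum_(M in configurations d) \sum_(p in oriented M) \sum_(q in partners M p) F M p q =
  \sum_(M in configurations d) \sum_(p in oriented M) \sum_(q in partners M p)
     F (switch M p q) (swap p q).1 (swap p q).2.
Proof.
pose T := ({set {set H}} * ((H * H) * (H * H)))%type.
pose P (x : T) := [&& configuration x.1, x.2.1 \in oriented x.1 & x.2.2 \in partners x.1 x.2.1].
have E (G : {set {set H}} -> H * H -> H * H -> R) :
    \sum_(M in configurations d) \sum_(p in oriented M) \sum_(q in partners M p) G M p q =
    \sum_(x : T | P x) G x.1 x.2.1 x.2.2.
  under eq_bigr => M _ do rewrite pair_big_dep /=.
  rewrite pair_big_dep /=; apply: eq_bigl => x; by rewrite inE /P.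
rewrite !E.
pose tau (x : T) : T := (switch x.1 x.2.1 x.2.2, swap x.2.1 x.2.2).
have tauK x : P x -> tau (tau x) = x.
  case: x => M [p q] /and3P[/= cM pM /partnersP[qM pq]]; rewrite eq_sym in pq.
  by rewrite /tau /= (switchK cM pM qM pq) swapK.
have tauP x : P x -> P (tau x).
  case: x => M [p q] /and3P[/= cM pM /partnersP[qM pq]]; rewrite eq_sym in pq.
  apply/and3P; split=> /=; first exact: switch_conf.
    exact: (swap_oriented _ _ _).1.
  apply/partnersP; split; first exact: (swap_oriented _ _ _).2.
  by rewrite eq_sym; apply: (swap_neq cM pM qM pq).
rewrite (reindex_onto tau tau) /=; last exact: tauK.
apply: eq_bigl => x; apply/andP/idP => [[Pt /eqP <-]|Px]; first exact: tauP.
by rewrite tauP // tauK.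
Qed.

(** A loop has weight 2 and an edge with a twin weight 1: the total over the two
    orders of a loop, or over the four ordered edges of a pair of twins, is then 4
    for every item.  Leaving out [q] makes the weight a function of the edges that
    the switching does not move, the same before and after it. *)
Definition weight M p q : nat :=
  2 * loop (edge p) +
  #|[set g in M :\: [set edge p; edge q] | (ends g == ends (edge p)) && ~~ loop g]|.

Definition full_weight M e : nat :=
  2 * loop e + #|[set g in M :\ e | (ends g == ends e) && ~~ loop g]|.

Lemma weight_le M p q : (weight M p q <= full_weight M (edge p))%N.
Proof.
rewrite leq_add2l; apply: subset_leq_card; apply/subsetP => g.
by rewrite !inE negb_or -!andbA => /and5P[-> _ -> -> ->].
Qed.

Lemma weightE M p q : edge p \in M -> edge q \in M -> edge q != edge p ->
  edge q \notin badset M -> weight M p q = full_weight M (edge p).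
Proof.
move=> pM qM qp qB; congr (_ + _)%N; apply: eq_card => g.
rewrite !inE negb_or -!andbA; congr (_ && _).
have [->|//] := eqVneq g (edge q); rewrite /= qM /=.
case: eqP => //= E; case/negP: qB.
by apply: (badset_parallel qM pM) => //; rewrite eq_sym.
Qed.

Lemma full_weight_bad M e : e \in M -> (0 < full_weight M e)%N = (e \in badset M).
Proof.
move=> eM; rewrite /full_weight addn_gt0; apply/orP/badsetP.
  case=> [|/card_gt0P[g]]; first by case l: (loop e) => // _; split=> //; left.
  rewrite !inE => /andP[/andP[ge gM] /andP[/eqP E _]]; split=> //; right.
  by exists g.
case=> _ H1; have [l|l] := boolP (loop e); first by left.
right; case: H1 => [l2|[f [fM fe E]]]; first by rewrite l2 in l.
by apply/card_gt0P; exists f; rewrite !inE fe fM E eqxx (loop_ends E) l.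
Qed.

Lemma full_weight_le M e : e \in M -> (full_weight M e <= 2 + #|badset M|)%N.
Proof.
move=> eM; apply: leq_add; first by case: (loop e).
apply: subset_leq_card; apply/subsetP => g; rewrite !inE => /andP[/andP[ge gM] /andP[/eqP E _]].
by move: (badset_parallel (e := g) gM eM); rewrite !inE => -> //; rewrite eq_sym.
Qed.

(** Distinct items have distinct ends. *)
Definition items M : nat := #|[set ends e | e in badset M]|.

Lemma sum_full_weight M : generic M ->
  (\sum_(e in badset M) full_weight M e = 2 * items M)%N.
Proof.
move=> /genericP G.
rewrite (partition_big (fun e => ends e) (mem [set ends e | e in badset M])) /=; last first.
  by move=> e eB; apply: imset_f.
rewrite mulnC /items -sum_nat_const; apply: eq_bigr => x /imsetP[e eB ->].
have eM := badset_sub eB.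
have [le|nle] := boolP (loop e).
  have uniq f : f \in M -> ends f = ends e -> f = e.
    move=> fM E; apply/eqP/negPn/negP => fe.
    by have [] := G e f eM fM fe E; rewrite le.
  rewrite (big_pred1 e) => [|f].
    rewrite /full_weight le (_ : [set g in _ | _] = finset.set0) ?cards0 //.
    apply/setP => g; rewrite !inE; apply/negP => /andP[/andP[ge gM] /andP[/eqP E _]].
    by rewrite (uniq g gM E) eqxx in ge.
  apply/andP/eqP => [[fB /eqP E]|->]; last by rewrite eqxx.
  exact: uniq (badset_sub fB) E.
have /badsetP[_ [|[f [fM fe E]]]] := eB; first by rewrite (negPf nle).
have [_ G2] := G e f eM fM fe E.
have nlf : ~~ loop f by rewrite (loop_ends E).
have fB : f \in badset M by apply: (badset_parallel fM eM) => //; rewrite eq_sym.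
have one a b : a \in M -> b \in M -> a != b -> ends a = ends e -> ends b = ends e ->
    ~~ loop a -> (forall g, g \in M -> ends g = ends e -> g = a \/ g = b) -> full_weight M a = 1%N.
  move=> aM bM ab Ea Eb nla G3; rewrite /full_weight (negPf nla) add0n.
  rewrite (_ : [set g in _ | _] = [set b]) ?cards1 //.
  apply/setP => g; rewrite !inE; apply/idP/eqP => [|->].
    move=> /andP[/andP[ga gM] /andP[/eqP Eg _]]; rewrite Ea in Eg.
    by case: (G3 g gM Eg) => // E2; rewrite E2 eqxx in ga.
  by rewrite eq_sym ab bM Ea Eb eqxx /= (loop_ends Eb).
rewrite (bigD1 e) ?eB ?eqxx //= (bigD1 f) /=; last by rewrite fB E eqxx.
rewrite big1 => [|g /andP[/andP[/andP[gB /eqP Eg] ge] gf]]; last first.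
  by case: (G2 g (badset_sub gB) Eg) => E2; [rewrite E2 eqxx in ge|rewrite E2 eqxx in gf].
rewrite (one e f) // 1?eq_sym // (one f e) // => g gM Eg.
by case: (G2 g gM Eg); auto.
Qed.

Lemma card_badset_items M : generic M -> (#|badset M| <= 2 * items M)%N.
Proof.
move=> gM; rewrite -(sum_full_weight gM) -sum1_card; apply: leq_sum => e eB.
by rewrite full_weight_bad ?(badset_sub eB).
Qed.

Lemma items_le_badset M : (items M <= #|badset M|)%N.
Proof. exact: leq_imset_card. Qed.

Lemma items_good M p q : good M p q -> edge p \in badset M ->
  items M = (items (switch M p q)).+1.
Proof.
move=> g pB; rewrite /items (cardsD1 (ends (edge p))) imset_f //=; congr _.+1.
apply: eq_card => x; rewrite finset.in_setD1; apply/andP/imsetP.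
  move=> [xp /imsetP[e eB E]]; exists e => //.
  by rewrite (goodP g) eB -E.
move=> [e]; rewrite (goodP g) => /andP[eB ep] ->; split=> //.
exact: imset_f.
Qed.

Lemma sum_oriented_edge M (F : {set H} -> R) : configuration M ->
  \sum_(p in oriented M) F (edge p) = 2 * \sum_(e in M) F e.
Proof.
move=> cM; rewrite (partition_big (@edge H) (mem M)) /=; last by move=> p; rewrite mem_oriented.
rewrite mulr_sumr; apply: eq_bigr => e eM.
rewrite (eq_bigr (fun=> F e)) => [|p /andP[_ /eqP ->] //].
have [p pM Ep] := edge_orient cM eM.
rewrite (eq_bigl (mem [set p; flip p])) => [|q].
  rewrite sumr_const cards2 mulr_natl; congr (_ *+ _).
  by have := oriented_neq cM pM; case: (p) => a b /= ab; rewrite /flip xpair_eqE (negPf ab).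
rewrite -[RHS]/(q \in [set p; flip p]) finset.in_set2 Ep.
apply/andP/orP => [[_ /edge_eqP[]/eqP]|[]/eqP ->]; auto.
by rewrite flip_oriented edge_flip.
Qed.

Definition level k := [set M in configurations d | generic M && (items M == k)].

Lemma levelP k M : reflect [/\ configuration M, generic M & items M = k] (M \in level k).
Proof.
by rewrite 2!inE; apply: (iffP and3P) => -[? ? /eqP ?]; split=> //; apply/eqP.
Qed.

(** An edge that was not bad becomes bad only by being parallel to a new edge.  Two
    edges with the same ends are both bad beforehand, so each new edge accounts for
    at most one, besides itself. *)
Lemma card_badset_switch M p q : configuration M ->
  p \in oriented M -> q \in oriented M -> edge p != edge q ->
  (#|badset (switch M p q)| <= #|badset M| + 4)%N.
Proof.
move=> cM pM qM pq.
pose A (x : H * H) := [set e in M | (e \notin badset M) && (ends e == ends (edge x))].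
have cA x : (#|A x| <= 1)%N.
  apply/card_le1_eqP => e f; rewrite !inE => /and3P[eM eB /eqP Ee] /and3P[fM fB /eqP Ef].
  apply/eqP/negPn/negP => ef; have := badset_parallel eM fM ef.
  by rewrite Ee Ef inE (negPf eB) => /(_ erefl).
set n1 := (swap p q).1; set n2 := (swap p q).2.
have sub : badset (switch M p q) \subset
    (badset M :|: [set edge n1; edge n2]) :|: (A n1 :|: A n2).
  apply/subsetP => e eB; have := badset_sub eB.
  rewrite mem_switch -orbA => /orP[/andP[/andP[eM _] _]|e12]; last first.
    by rewrite !finset.in_setU !finset.in_set1 e12 orbT.
  have [eB'|eNB] := boolP (e \in badset M); first by rewrite !finset.in_setU eB'.
  case/badsetP: eB => _ [le|[f [+ fe E]]]; first by rewrite badset_loop in eNB.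
  rewrite mem_switch -orbA => /orP[/andP[/andP[fM _] _]|/orP[]/eqP Ef].
  - by rewrite (badset_parallel eM fM fe E) in eNB.
  - by rewrite !finset.in_setU [e \in A n1]inE eM eNB -E Ef eqxx !orbT.
  - by rewrite !finset.in_setU [e \in A n2]inE eM eNB -E Ef eqxx !orbT.
apply: leq_trans (subset_leq_card sub) _.
have [h1 _] := leq_card_setU (badset M :|: [set edge n1; edge n2]) (A n1 :|: A n2).
have [h2 _] := leq_card_setU (badset M) [set edge n1; edge n2].
have [h3 _] := leq_card_setU (A n1) (A n2).
have h4 : (#|[set edge n1; edge n2]| <= 2)%N by rewrite cards2; case: (_ != _).
apply: leq_trans h1 _; rewrite -[4%N]/(2 + 2)%N addnA leq_add //.
  by apply: leq_trans h2 _; rewrite leq_add2l.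
by apply: leq_trans h3 _; apply: (leq_add (cA _) (cA _)).
Qed.

Lemma sum_weight_le M K : configuration M -> (#|badset M| <= K)%N ->
  \sum_(p in oriented M) (full_weight M (edge p))%:R <= (2 * K * (K + 2))%:R :> R.
Proof.
move=> cM MK; rewrite (sum_oriented_edge (fun e => (full_weight M e)%:R)) //.
rewrite -mulnA natrM ler_wpM2l // -natr_sum ler_nat.
rewrite (big_setID (badset M)) /= [X in (_ + X)%N]big1 ?addn0 => [|e].
  rewrite (setIidPr _); last by apply/subsetP => e; apply: badset_sub.
  apply: (@leq_trans (\sum_(e in badset M) (K + 2))).
    apply: leq_sum => e /badset_sub eM; rewrite addnC.
    by apply: leq_trans (full_weight_le eM) _; rewrite leq_add2l.
  by rewrite sum_nat_const leq_mul2r MK orbT.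
rewrite finset.in_setD => /andP[eB eM]; apply/eqP; rewrite -leqn0 leqNgt.
by rewrite full_weight_bad.
Qed.

Lemma weight_swap M p q : configuration M -> p \in oriented M -> q \in oriented M ->
  edge p != edge q ->
  weight (switch M p q) (swap p q).1 (swap p q).2 =
  (2 * (tag p.1 == tag q.2) + #|[set g in M :\: [set edge p; edge q] |
      (ends g == ends (edge (p.1, q.2))) && ~~ loop g]|)%N.
Proof.
by move=> cM pM qM pq; rewrite /weight -swap_switch -?mem_oriented // loop_edge.
Qed.

(** The weight of the reverse switching. *)
Definition cross M p q := weight (switch M p q) (swap p q).1 (swap p q).2.

Lemma switch_level k M p q : configuration M -> p \in oriented M -> q \in oriented M ->
  edge p != edge q -> edge p \in badset M -> generic M -> good M p q ->
  (switch M p q \in level k) = (M \in level k.+1).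
Proof.
move=> cM pM qM pq pB gM g; have cM' := switch_conf cM pM qM pq.
have gM' := generic_badset (good_sub g) gM.
by rewrite !inE cM cM' gM gM' (items_good g pB) eqSS.
Qed.

(** A good switching of a bad edge leads from level [k + 1] to level [k], and the
    involution [sum_switch] exchanges the two ways of summing over these switchings.
    The error comes from the switchings that are not good: at most [kappa] for each
    bad edge of a generic configuration, and any number for the others. *)
Lemma level_exchange k kappa (V : {set {set H}} -> R) :
  (forall M p, configuration M -> generic M ->
    (#|badset M| <= 2 * k + 4)%N -> p \in oriented M -> edge p \in badset M ->
    (#|[set q in partners M p | ~~ good M p q]| <= kappa)%N) ->
  (forall M, 0 <= V M <= 1) ->
  `| \sum_(M in level k.+1) \sum_(p in oriented M) \sum_(q in partners M p)
       (weight M p q)%:R * V (switch M p q)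
     - \sum_(M in level k) V M * \sum_(p in oriented M) \sum_(q in partners M p) (cross M p q)%:R |
  <= (2 * (2 * k + 4) * (2 * k + 4 + 2))%:R *
     (#|{: H}|%:R * #|[set M in configurations d | ~~ generic M]|%:R
       + kappa%:R * #|configurations d|%:R).
Proof.
set K := (2 * k + 4)%N => few V01.
have V0 M : 0 <= V M by case/andP: (V01 M).
have V1 M : V M <= 1 by case/andP: (V01 M).
have sub j : level j = [set M in configurations d | M \in level j].
  by apply/setP => M; rewrite !inE; case: (configuration M).
have E1 : \sum_(M in level k.+1) \sum_(p in oriented M) \sum_(q in partners M p)
       (weight M p q)%:R * V (switch M p q) =
    \sum_(M in configurations d) \sum_(p in oriented M) \sum_(q in partners M p)
       (weight M p q)%:R * V (switch M p q) * (M \in level k.+1)%:R.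
  rewrite {1}sub (eq_bigl (fun M => (M \in configurations d) && (M \in level k.+1))) => [|M].
    rewrite big_mkcondr; apply: eq_bigr => M _; case: ifP => _.
      by apply: eq_bigr => p _; apply: eq_bigr => q _; rewrite mulr1.
    by rewrite big1 // => p _; rewrite big1 // => q _; rewrite mulr0.
  by rewrite [LHS]inE.
have E2 : \sum_(M in level k) V M * \sum_(p in oriented M) \sum_(q in partners M p) (cross M p q)%:R =
    \sum_(M in configurations d) \sum_(p in oriented M) \sum_(q in partners M p)
       (weight M p q)%:R * V (switch M p q) * (switch M p q \in level k)%:R.
  rewrite (sum_switch (fun M p q => (weight M p q)%:R * V (switch M p q) * (switch M p q \in level k)%:R)).
  rewrite {1}sub (eq_bigl (fun M => (M \in configurations d) && (M \in level k))) => [|M].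
    rewrite big_mkcondr; apply: eq_bigr => M; rewrite inE => cM.
    have -> : (if M \in level k then V M * \sum_(p in oriented M) \sum_(q in partners M p) (cross M p q)%:R
        else 0) = (M \in level k)%:R * V M * \sum_(p in oriented M) \sum_(q in partners M p) (cross M p q)%:R.
      by case: ifP; rewrite ?mul1r ?mul0r.
    rewrite mulr_sumr; apply: eq_bigr => p pM; rewrite mulr_sumr.
    apply: eq_bigr => q /partnersP[qM qp]; rewrite eq_sym in qp.
    by rewrite (switchK cM pM qM qp) -/(cross M p q) mulrC [_ * V M]mulrC mulrA.
  by rewrite [LHS]inE.
rewrite E1 E2 -sumrB; apply: le_trans (ler_norm_sum _ _ _) _.
rewrite mulrDr mulrA -sum1_card natr_sum mulr_sumr -[#|configurations d|]sum1_card natr_sum !mulr_sumr.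
rewrite [X in _ <= X + _](eq_bigl (fun M => (M \in configurations d) && ~~ generic M)) => [|M];
  last by rewrite !inE.
rewrite big_mkcondr -big_split /=; apply: ler_sum => M; rewrite inE => cM.
set S := (2 * K * (K + 2))%:R.
rewrite !mulr1 [X in _ <= X](_ : _ = S * ((~~ generic M)%:R * #|{: H}|%:R + kappa%:R)); last first.
  by rewrite mulrDr; case: (generic M); rewrite ?mul0r ?mulr0 ?mul1r ?mulr1.
have bound_ge0 : 0 <= (~~ generic M)%:R * #|{: H}|%:R + kappa%:R :> R.
  by rewrite addr_ge0 ?mulr_ge0 ?ler0n.
(* A configuration with too many bad edges is in neither level, not even after a
   switching. *)
have [MK|MK] := leqP #|badset M| K; last first.
  rewrite [X in `|X|](_ : _ = 0) ?normr0 ?mulr_ge0 ?ler0n //.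
  have -> : M \in level k.+1 = false.
    apply/negP => /levelP[_ gM iM]; have := card_badset_items gM; rewrite iM => le.
    by move: MK; rewrite ltnNge => /negP; apply; apply: leq_trans le _; rewrite /K; lia.
  rewrite -sumrB big1 // => p pM; rewrite -sumrB big1 // => q /partnersP[qM qp].
  rewrite eq_sym in qp.
  have -> : switch M p q \in level k = false.
    apply/negP => /levelP[_ gM iM]; have le := card_badset_items gM.
    have [pM' qM'] := swap_oriented M p q; have pq' := swap_neq cM pM qM qp.
    have := card_badset_switch (switch_conf cM pM qM qp) pM' qM' pq'.
    rewrite (switchK cM pM qM qp) leqNgt => /negP; apply; apply: leq_ltn_trans MK.
    by rewrite /K leq_add2r -iM.
  by rewrite !mulr0 subr0.
rewrite -sumrB; apply: le_trans (ler_norm_sum _ _ _) _.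
apply: le_trans (ler_wpM2r bound_ge0 (sum_weight_le cM MK)).
rewrite mulr_suml; apply: ler_sum => p pM; rewrite -sumrB.
apply: le_trans (ler_norm_sum _ _ _) _.
have pM1 : edge p \in M by rewrite -mem_oriented.
have [pB|pB] := boolP (edge p \in badset M); last first.
  have w0 : full_weight M (edge p) = 0%N.
    by apply/eqP; rewrite -leqn0 leqNgt full_weight_bad.
  rewrite w0 mul0r big1 // => q _; have := weight_le M p q.
  by rewrite w0 leqn0 => /eqP ->; rewrite !mul0r subr0 normr0.
apply: (@le_trans _ _ (\sum_(q in [set q in partners M p | ~~ (generic M && good M p q)])
    (full_weight M (edge p))%:R)).
  rewrite big_mkcond [X in _ <= X]big_mkcond; apply: ler_sum => q _.
  have -> : (q \in [set q in partners M p | ~~ (generic M && good M p q)]) =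
      (q \in partners M p) && ~~ (generic M && good M p q) by rewrite inE.
  case: ifP => [qP|_ //] /=; have /partnersP[qM qp] := qP; rewrite eq_sym in qp.
  case: ifP => [_|/negbFE/andP[gM g]]; last first.
    by rewrite switch_level // subrr normr0.
  rewrite -mulrBr normrM ger0_norm ?mulr_ge0 //.
  apply: (@le_trans _ _ ((full_weight M (edge p))%:R * 1 * 1)); last by rewrite !mulr1.
  rewrite !ler_pM ?mulr_ge0 ?ler_nat ?weight_le //.
  by case: (_ \in _); case: (_ \in _); rewrite ?subrr ?subr0 ?sub0r ?normrN ?normr0 ?normr1 ?ler01.
rewrite sumr_const -[X in X <= _]mulr_natr ler_wpM2l //.
have [gM|gM] := boolP (generic M).
  by rewrite mul0r add0r ler_nat; apply: few.
rewrite mul1r; apply: (@le_trans _ _ #|partners M p|%:R).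
  by rewrite ler_nat; apply: subset_leq_card; apply/subsetP => q; rewrite inE => /andP[].
apply: (@le_trans _ _ #|{: H}|%:R); last by rewrite lerDl.
by rewrite ler_nat card_partners // leq_subr.
Qed.

End Levels.

(** * Counting the switchings that create an item *)

Section CrossSums.
Variables (n : nat) (d : 'I_n -> nat).
Notation H := (half_edge d).
Implicit Types (M : {set {set H}}) (e f g : {set H}) (p q r : H * H) (h : H).

(** The number of other half-edges at the vertex of [h]. *)
Definition spare h : nat := (d (tag h)).-1.
Definition spare_sum : nat := \sum_h spare h.
Definition spare_product M : nat := \sum_(r in oriented M) spare r.1 * spare r.2.

Lemma deg_gt0 h : (0 < d (tag h))%N.
Proof. by case: h => i a /=; apply: leq_ltn_trans (ltn_ord a). Qed.

Lemma spareS h : d (tag h) = (spare h).+1.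
Proof. by rewrite /spare prednK ?deg_gt0. Qed.

Lemma sum_oriented_fst M (F : H -> nat) : configuration M ->
  (\sum_(p in oriented M) F p.1 = \sum_h F h)%N.
Proof.
move=> cM; rewrite -(big_imset (h := fst) F) /=; last first.
  by move=> p q pM qM; apply: (oriented_fst_inj cM).
apply: eq_bigl => h; apply/imsetP.
by have [p pM <-] := orient_at h cM; exists p.
Qed.

Lemma sum_oriented_snd M (F : H -> nat) : configuration M ->
  (\sum_(p in oriented M) F p.2 = \sum_h F h)%N.
Proof.
move=> cM; rewrite -(sum_oriented_fst F cM) (reindex_inj (inv_inj (@flipK H))) /=.
by apply: eq_bigl => p; rewrite flip_oriented.
Qed.

Lemma sum_oriented_split M p (F : H * H -> nat) : configuration M -> p \in oriented M ->
  (\sum_(q in oriented M) F q = F p + F (flip p) + \sum_(q in partners M p) F q)%N.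
Proof.
move=> cM pM; rewrite (bigD1 p) //= (bigD1 (flip p)) /=; last first.
  rewrite flip_oriented pM /=; have := oriented_neq cM pM; case: (p) => a b /= ab.
  by rewrite /flip xpair_eqE eq_sym (negPf ab).
rewrite addnA; congr (_ + _)%N; apply: eq_bigl => q.
rewrite -andbA -negb_or; apply/andP/partnersP => -[qM N]; split=> //.
  by apply: contraNN N => /edge_eqP[] ->; rewrite eqxx ?orbT.
by apply: contraNN N => /orP[]/eqP ->; rewrite ?edge_flip.
Qed.

Lemma sum_tag i : (\sum_(h : H) (tag h == i) = d i)%N.
Proof.
rewrite -(card_vertex d i) -sum1_card [RHS]big_mkcond; apply: eq_bigr => h _.
by rewrite inE; case: eqP.
Qed.

Lemma sum_partners_snd M r : configuration M -> r \in oriented M -> ~~ loop (edge r) ->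
  (\sum_(q in partners M r) (tag q.2 == tag r.2) = spare r.2)%N.
Proof.
move=> cM rM nl; have := sum_oriented_split (fun q => (tag q.2 == tag r.2) : nat) cM rM.
rewrite (sum_oriented_snd (fun h => (tag h == tag r.2) : nat) cM) sum_tag spareS eqxx /=.
rewrite loop_edge in nl; rewrite (negPf nl); lia.
Qed.

Lemma sum_partners_fst M r : configuration M -> r \in oriented M -> ~~ loop (edge r) ->
  (\sum_(q in partners M r) (tag q.1 == tag r.1) = spare r.1)%N.
Proof.
move=> cM rM nl; have := sum_oriented_split (fun q => (tag q.1 == tag r.1) : nat) cM rM.
rewrite (sum_oriented_fst (fun h => (tag h == tag r.1) : nat) cM) sum_tag spareS eqxx /=.
rewrite loop_edge in nl; rewrite eq_sym (negPf nl); lia.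
Qed.

(** The other half-edges at the vertex of [p.1] are the second half-edges of as many
    ordered edges; one of these is [p] itself when [p] is a loop. *)
Lemma sum_partners_loop M p : configuration M -> p \in oriented M ->
  (\sum_(q in partners M p) (tag p.1 == tag q.2) + loop (edge p) = spare p.1)%N.
Proof.
move=> cM pM; have := sum_oriented_split (fun q => (tag p.1 == tag q.2) : nat) cM pM.
rewrite (sum_oriented_snd (fun h => (tag p.1 == tag h) : nat) cM).
under eq_bigr => h _ do rewrite eq_sym.
rewrite sum_tag spareS eqxx /= loop_edge.
by rewrite addn1 addSn => -[->]; rewrite addnC.
Qed.

(** The edges that the switching of [p] and [q] leaves in place and that become twins
    of the new edge [(p.1, q.2)]. *)
Definition twin_count M p q :=
  #|[set g in M :\: [set edge p; edge q] | (ends g == ends (edge (p.1, q.2))) && ~~ loop g]|.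

Definition oriented_twin r p q : bool :=
  [&& edge r != edge p, edge r != edge q, tag p.1 == tag r.1, tag q.2 == tag r.2 & ~~ loop (edge r)].

Lemma twin_countE M p q : configuration M ->
  twin_count M p q = (\sum_(r in oriented M) oriented_twin r p q)%N.
Proof.
move=> cM; rewrite /twin_count -big_mkcondr sum1dep_card /=.
rewrite -(card_in_imset (f := @edge H)).
  apply: eq_card => g; rewrite !inE negb_or -andbA; apply/idP/imsetP.
    case/and4P => /andP[gp gq] gM /eqP E nl.
    have [r rM Er] := edge_orient cM gM; subst g.
    move/eqP: E; rewrite !ends_tag => /edge_eqP[][E1 E2].
      by exists r => //; rewrite inE rM /oriented_twin gp gq E1 E2 !eqxx.
    exists (flip r); rewrite ?edge_flip // inE flip_oriented rM /oriented_twin edge_flip gp gq.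
    by rewrite /= E1 E2 !eqxx.
  case=> r; rewrite inE => /andP[rM /and5P[rp rq /eqP E1 /eqP E2 nl]] ->.
  by rewrite rp rq nl -mem_oriented rM !ends_tag /= E1 E2 eqxx.
move=> r r'; rewrite !inE => /andP[_ /and5P[_ _ /eqP E1 /eqP E2 nl]].
move=> /andP[_ /and5P[_ _ /eqP E1' /eqP E2' _]] /eqP/edge_eqP[//|E].
by move: nl; rewrite loop_edge {1}E /= -E2' E2 eqxx.
Qed.

Variable D : nat.
Hypothesis dD : forall i, (d i <= D)%N.

Lemma twin_sum_le M r : configuration M -> r \in oriented M ->
  (\sum_(p in oriented M) \sum_(q in partners M p) oriented_twin r p q <= D * D)%N.
Proof.
move=> cM rM.
apply: (@leq_trans (\sum_(p in oriented M) (tag p.1 == tag r.1) * D)).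
  apply: leq_sum => p pM; case E : (tag p.1 == tag r.1); last first.
    by rewrite big1 // => q _; rewrite /oriented_twin E !andbF.
  rewrite mul1n; apply: leq_trans (dD (tag r.2)).
  rewrite -(sum_tag (tag r.2)) -(sum_oriented_snd (fun h => (tag h == tag r.2) : nat) cM).
  rewrite (sum_oriented_split _ cM pM); apply: leq_trans (leq_addl _ _).
  by apply: leq_sum => q _; rewrite /oriented_twin; case: (_ == tag r.2); rewrite ?andbF ?leq_b1.
rewrite -big_distrl /= leq_mul2r; apply/orP; right.
by rewrite (sum_oriented_fst (fun h => (tag h == tag r.1) : nat) cM) sum_tag.
Qed.

(** The new edge [(p.1, q.2)] is a twin of [r] when [p.1] and [q.2] are other
    half-edges at the two ends of [r]; as [r] is not bad, these are independent
    choices. *)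
Lemma twin_sumE M r : configuration M -> r \in oriented M -> edge r \notin badset M ->
  (\sum_(p in oriented M) \sum_(q in partners M p) oriented_twin r p q = spare r.1 * spare r.2)%N.
Proof.
move=> cM rM rB; have rM1 : edge r \in M by rewrite -mem_oriented.
have nl : ~~ loop (edge r) by apply: contraNN rB; apply: badset_loop.
have auto p q : p \in oriented M -> q \in oriented M -> edge r != edge p ->
    tag p.1 = tag r.1 -> tag q.2 = tag r.2 -> edge q != edge p.
  move=> pM qM rp E1 E2; apply/negP => /edge_eqP[E|E].
    case/negP: rB; apply: (badset_parallel rM1 (f := edge p)); rewrite -?mem_oriented 1?eq_sym //.
    by rewrite !ends_tag E1 -E2 E.
  by move: nl; rewrite loop_edge -E1 -E2 E eqxx.
have inner p : p \in oriented M -> (\sum_(q in partners M p) oriented_twin r p q =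
    (edge p != edge r) * (tag p.1 == tag r.1) * spare r.2)%N.
  move=> pM; have [E|rp] := eqVneq (edge p) (edge r).
    by rewrite !mul0n big1 // => q _; rewrite /oriented_twin E eqxx.
  rewrite mul1n; case: eqP => [E1|/eqP E1]; last first.
    by rewrite big1 // => q _; rewrite /oriented_twin (negPf E1) !andbF.
  rewrite mul1n -(sum_partners_snd cM rM nl) big_mkcond [RHS]big_mkcond.
  rewrite eq_sym in rp.
  apply: eq_bigr => q _; rewrite /oriented_twin rp nl E1 eqxx /= andbT.
  have [qM|qM] := boolP (q \in oriented M); last first.
    by case: partnersP => [[]|_]; rewrite ?(negPf qM) //; case: partnersP => [[]|]; rewrite ?(negPf qM).
  have [E2|E2] := eqVneq (tag q.2) (tag r.2); last by rewrite andbF; do 2 case: ifP.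
  have qp := auto p q pM qM rp E1 E2.
  have [E|rq] := eqVneq (edge r) (edge q).
    by rewrite /= [q \in partners M r](introF (partnersP _ _ _)) ?if_same // => -[_]; rewrite E eqxx.
  rewrite (introT (partnersP _ _ _) (conj qM qp)).
  by rewrite (introT (partnersP _ _ _)) // eq_sym.
rewrite (eq_bigr _ inner) -big_distrl /= ; congr (_ * _)%N.
rewrite -(sum_partners_fst cM rM nl) big_mkcond [RHS]big_mkcond; apply: eq_bigr => p _.
rewrite [p \in partners M r]inE; case: (p \in _) => //=.
by case: (_ != _); rewrite ?mul1n ?mul0n.
Qed.

Lemma sum_edge_bad M : configuration M ->
  (\sum_(p in oriented M) (edge p \in badset M) <= 2 * #|badset M|)%N.
Proof.
move=> cM; rewrite -big_mkcondr sum1dep_card /=.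
apply: card_oriented_in => //; apply/subsetP => e; exact: badset_sub.
Qed.

(** The new edge [(p.1, q.2)] is a loop for about [spare_sum] pairs, each of weight 2,
    and it is a twin of [r] for [spare r.1 * spare r.2] pairs by [twin_sumE].  Only
    the loops [p] and the bad edges [r] deviate from this count. *)
Lemma cross_sum M : configuration M ->
  (\sum_(p in oriented M) \sum_(q in partners M p) cross M p q
     <= 2 * spare_sum + spare_product M + 2 * #|badset M| * (D * D) /\
   2 * spare_sum + spare_product M <=
   \sum_(p in oriented M) \sum_(q in partners M p) cross M p q
     + 4 * #|badset M| + 2 * #|badset M| * (D * D))%N.
Proof.
move=> cM; set B := (2 * #|badset M|)%N.
pose part1 := (\sum_(p in oriented M) \sum_(q in partners M p) (tag p.1 == tag q.2))%N.
pose part2 := (\sum_(r in oriented M) \sum_(p in oriented M) \sum_(q in partners M p) oriented_twin r p q)%N.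
have E : (\sum_(p in oriented M) \sum_(q in partners M p) cross M p q = 2 * part1 + part2)%N.
  rewrite /part2 exchange_big /= /part1 big_distrr -big_split /=; apply: eq_bigr => p pM.
  rewrite exchange_big /= big_distrr -big_split /=; apply: eq_bigr => q /partnersP[qM qp].
  by rewrite -twin_countE // /cross weight_swap // eq_sym.
have p1 : (part1 + \sum_(p in oriented M) loop (edge p) = spare_sum)%N.
  rewrite /spare_sum -(sum_oriented_fst spare cM) /part1 -big_split /=.
  by apply: eq_bigr => p pM; rewrite sum_partners_loop.
have lB : (\sum_(p in oriented M) loop (edge p) <= B)%N.
  apply: leq_trans (sum_edge_bad cM); apply: leq_sum => p pM.
  case l : (loop (edge p)) => //; by rewrite badset_loop // -mem_oriented.
have p2a : (part2 <= spare_product M + B * (D * D))%N.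
  apply: (@leq_trans (spare_product M + (\sum_(r in oriented M) (edge r \in badset M)) * (D * D))).
    rewrite /part2 /spare_product big_distrl -big_split /=; apply: leq_sum => r rM.
    have [rB|rB] := boolP (edge r \in badset M).
      by rewrite mul1n; apply: leq_trans (twin_sum_le cM rM) (leq_addl _ _).
    by rewrite twin_sumE // leq_addr.
  by rewrite leq_add2l leq_mul2r sum_edge_bad ?orbT.
have p2b : (spare_product M <= part2 + B * (D * D))%N.
  apply: (@leq_trans (part2 + (\sum_(r in oriented M) (edge r \in badset M)) * (D * D))).
    rewrite /part2 /spare_product big_distrl -big_split /=; apply: leq_sum => r rM.
    have [rB|rB] := boolP (edge r \in badset M).
      rewrite mul1n; apply: leq_trans (leq_addl _ _); apply: leq_mul;
      by rewrite (leq_trans (leq_pred _)).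
    by rewrite twin_sumE // leq_addr.
  by rewrite leq_add2l leq_mul2r sum_edge_bad ?orbT.
rewrite E; split; rewrite /B in lB p2a p2b *; lia.
Qed.

End CrossSums.

(** * Moments of edge counts in a uniform configuration *)

Section Moments.
Variables (R : realType) (n : nat) (d : 'I_n -> nat).
Notation H := (half_edge d).
Implicit Types (M F : {set {set H}}) (e f g : {set H}) (p q r : H * H) (h a b : H).

Lemma relabel_conf (s : {perm H}) M : configuration M -> configuration (relabel s M).
Proof.
move=> /configurationP[c2 cov tr]; apply/configurationP; split.
- by move=> e /relabelP[f fM ->]; rewrite card_imset ?c2 //; apply: perm_inj.
- move=> h; have [e eM he] := cov ((s^-1)%g h).
  by exists (s @: e); rewrite ?mem_relabel //; apply/imsetP; exists ((s^-1)%g h); rewrite ?permKV.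
- move=> e f h /relabelP[e' eM ->] /relabelP[f' fM ->] /imsetP[a ae ->] /imsetP[b bf /perm_inj E].
  by rewrite E in ae; rewrite (tr e' f' b).
Qed.

Lemma relabel_inj (s : {perm H}) : injective (relabel s).
Proof. exact/imset_inj/imset_perm_inj. Qed.

Definition containing F := [set M in configurations d | F \subset M].

Lemma containingP F M : reflect (configuration M /\ F \subset M) (M \in containing F).
Proof. by rewrite 2!inE; apply: andP. Qed.

(** Transposing [b] and [b'] maps one family into the other. *)
Lemma containing_swap F a b b' : b \notin cover F -> b' \notin cover F -> a != b -> a != b' ->
  (#|containing (edge (a, b) |: F)| <= #|containing (edge (a, b') |: F)|)%N.
Proof.
move=> bF bF' ab ab'; rewrite -(card_imset _ (relabel_inj (s := tperm b b'))).
apply: subset_leq_card; apply/subsetP => M' /imsetP[M /containingP[cM /subsetP FM] ->].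
apply/containingP; split; first exact: relabel_conf.
apply/subsetP => e; rewrite finset.in_setU1 => /orP[/eqP ->|eF].
  have -> : edge (a, b') = tperm b b' @: edge (a, b).
    by rewrite -edge_pairm /pairm /= tpermL tpermD // eq_sym.
  by rewrite mem_relabel; apply: FM; rewrite finset.in_setU1 eqxx.
have -> : e = tperm b b' @: e.
  rewrite -[LHS]imset_id; apply: eq_in_imset => h he; rewrite tpermD //.
    by apply: contraNneq bF => ->; apply/bigcupP; exists e.
  by apply: contraNneq bF' => ->; apply/bigcupP; exists e.
by rewrite mem_relabel; apply: FM; rewrite finset.in_setU1 eF orbT.
Qed.

(** A configuration contains exactly one edge at [a]. *)
Lemma containing_sum F a : a \notin cover F ->
  (\sum_(b in ~: (a |: cover F)) #|containing (edge (a, b) |: F)| = #|containing F|)%N.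
Proof.
move=> aF; under eq_bigr => b _ do rewrite -sum1_card big_mkcond.
rewrite exchange_big /= -sum1_card [RHS]big_mkcond; apply: eq_bigr => M _.
case: ifP => [/containingP[cM FM]|nM]; last first.
  rewrite big1 // => b _; case: ifP => // /containingP[cM /subsetP FM].
  case/negP: (negbT nM); apply/containingP; split=> //; apply/subsetP => e eF.
  by apply: FM; rewrite finset.in_setU1 eF orbT.
have [[a' b] pM /= Ea] := orient_at a cM; subst a'.
have bF : b \in ~: (a |: cover F).
  rewrite finset.in_setC finset.in_setU1 negb_or eq_sym (oriented_neq cM pM) /=.
  apply/negP => /bigcupP[e eF be]; case/negP: aF; apply/bigcupP; exists e => //.
  have [_ _ tr] := configurationP _ cM; rewrite mem_oriented in pM.
  have -> : e = edge (a, b) by apply: (tr _ _ b) => //; [exact: (subsetP FM)|rewrite in_edge eqxx orbT].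
  by rewrite in_edge eqxx.
rewrite (bigD1 b) //= ifT ?big1 ?addn0 // => [c /andP[_ cb]|].
  case: ifP => // /containingP[_ /subsetP FM'].
  have cM' : (a, c) \in oriented M by rewrite mem_oriented; apply: FM'; rewrite finset.in_setU1 eqxx.
  by have [E] := oriented_fst_inj cM cM' pM erefl; rewrite E eqxx in cb.
apply/containingP; split=> //; apply/subsetP => e; rewrite finset.in_setU1.
by case/orP => [/eqP ->|/(subsetP FM) //]; rewrite -mem_oriented.
Qed.

(** Given the edges of [F], all the half-edges outside [F] are equally likely to be
    the partner of [a]. *)
Lemma containing_step F a b : a \notin cover F -> b \notin cover F -> a != b ->
  (#|containing (edge (a, b) |: F)| * (#|{: H}| - #|cover F| - 1) = #|containing F|)%N.
Proof.
move=> aF bF ab; rewrite -(containing_sum aF).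
rewrite (eq_bigr (fun=> #|containing (edge (a, b) |: F)|)) => [|b'].
  rewrite sum_nat_const mulnC; congr (_ * _)%N.
  rewrite -subnDA -(cardsC (a |: cover F)) cardsU1 aF; lia.
rewrite finset.in_setC finset.in_setU1 negb_or eq_sym => /andP[ab' b'F].
by apply/eqP; rewrite eqn_leq !containing_swap.
Qed.

Local Notation N := (#|{: H}|).
Local Notation Om := (#|configurations d|%:R : R).

(** Enough half-edges for [N - 1], [N - 3] and [N - 5] to be positive and
    comparable with [N]. *)
Hypothesis N6 : (6 < N)%N.

Lemma card_containing1 p : p.1 != p.2 -> #|containing [set edge p]|%:R * (N - 1)%:R = Om.
Proof.
case: p => a b /= ab; have c0 : cover (finset.set0 : {set {set H}}) = finset.set0.
  by rewrite /cover big_set0.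
have := @containing_step finset.set0 a b; rewrite c0 !finset.in_set0 cards0 subn0 => /(_ isT isT ab).
rewrite finset.setU0 => E; rewrite -natrM E; congr (_%:R); apply: eq_card => M.
by rewrite [LHS]inE finset.sub0set andbT.
Qed.

Lemma cover1 p : cover [set edge p] = edge p.
Proof. by rewrite /cover big_set1. Qed.

Definition apart p q := [&& p.1 \notin edge q, p.2 \notin edge q & p.1 != p.2].

Lemma card_containing2 p q : apart p q -> q.1 != q.2 ->
  #|containing [set edge p; edge q]|%:R * ((N - 1)%:R * (N - 3)%:R) = Om.
Proof.
move=> /and3P[h1 h2 h3] h4; rewrite -(card_containing1 h4) mulrCA [RHS]mulrC; congr (_ * _).
have := @containing_step [set edge q] p.1 p.2; rewrite cover1 => /(_ h1 h2 h3).
by rewrite cards2 h4 -subnDA -surjective_pairing -natrM => <-.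
Qed.

Lemma card_containing3 p q r : apart p q -> apart p r -> apart q r -> r.1 != r.2 ->
  #|containing [set edge p; edge q; edge r]|%:R * ((N - 1)%:R * (N - 3)%:R * (N - 5)%:R) = Om.
Proof.
move=> pq pr qr h4; rewrite -(card_containing2 qr h4) mulrCA [RHS]mulrC; congr (_ * _).
have /and3P[h1 h2 h3] := pq; have /and3P[h5 h6 _] := pr; have /and3P[h7 h8 h9] := qr.
have cov : cover [set edge q; edge r] = edge q :|: edge r.
  by rewrite /cover big_setU1 ?big_set1 //= finset.in_set1; apply: contraNneq h7 => <-; rewrite in_edge eqxx.
have := @containing_step [set edge q; edge r] p.1 p.2; rewrite cov.
have outU x : x \notin edge q -> x \notin edge r -> x \notin edge q :|: edge r.
  by rewrite finset.in_setU negb_or => -> ->.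
move=> /(_ (outU _ h1 h5) (outU _ h2 h6) h3).
have -> : #|edge q :|: edge r| = 4%N.
  have dis : [disjoint edge q & edge r].
    rewrite -setI_eq0; apply/eqP/setP => h; rewrite finset.in_setI finset.in_set0.
    by apply/negP => /andP[]; rewrite [h \in edge q]in_edge => /orP[]/eqP ->; apply/negP.
  by have [_] := leq_card_setU (edge q) (edge r); rewrite dis => /eqP ->; rewrite !cards2 h9 h4.
by rewrite -subnDA -surjective_pairing finset.setUA -natrM => <-.
Qed.

Lemma oriented_apart M p q : configuration M -> p \in oriented M -> q \in oriented M ->
  edge p != edge q -> apart p q.
Proof.
move=> cM pM qM pq; have [h1 h2 [h3 h4 h5 h6]] := switch_distinct cM pM qM pq.
by rewrite /apart !in_edge !negb_or h1 h3 h4 h5 h6.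
Qed.

Lemma sub2 (T : finType) (x y : T) (A : {set T}) : ([set x; y] \subset A) = (x \in A) && (y \in A).
Proof. by rewrite finset.subUset !sub1set. Qed.

Lemma moment1 (u : H * H -> R) :
  (N - 1)%:R * (\sum_(M in configurations d) \sum_(p in oriented M) u p) =
  Om * \sum_(p | p.1 != p.2) u p.
Proof.
under [X in _ * X]eq_bigr => M _ do rewrite big_mkcond.
rewrite exchange_big /= !mulr_sumr [RHS]big_mkcond; apply: eq_bigr => p _.
have -> : \sum_(M in configurations d) (if p \in oriented M then u p else 0) =
    #|containing [set edge p]|%:R * u p.
  rewrite mulr_natl -sumr_const -big_mkcondr; apply: eq_bigl => M.
  by rewrite [RHS]inE mem_oriented sub1set.
case: ifP => [pp|/negbFE/eqP pp]; first by rewrite mulrA mulrC -[_ * #|_|%:R]mulrC card_containing1 // mulrC.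
suff -> : containing [set edge p] = finset.set0 by rewrite cards0 mul0r mulr0.
apply/setP => M; rewrite finset.in_set0; apply/negP => /containingP[cM].
by rewrite sub1set -mem_oriented => /(oriented_neq cM); rewrite pp eqxx.
Qed.

Lemma sum2_mkcond M (u : H * H -> H * H -> R) :
  \sum_(p in oriented M) \sum_(q in partners M p) u p q =
  \sum_p \sum_q (if (p \in oriented M) && (q \in partners M p) then u p q else 0).
Proof.
rewrite big_mkcond; apply: eq_bigr => p _; case: ifP => _; first by rewrite big_mkcond.
by rewrite big1.
Qed.

Lemma sum3_mkcond M (u : H * H -> H * H -> H * H -> R) :
  \sum_(p in oriented M) \sum_(q in partners M p)
     \sum_(r in partners M p | edge r != edge q) u p q r =
  \sum_p \sum_q \sum_r (if [&& p \in oriented M, q \in partners M p,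
     r \in partners M p & edge r != edge q] then u p q r else 0).
Proof.
rewrite sum2_mkcond; apply: eq_bigr => p _; apply: eq_bigr => q _.
case E : (_ && _); last by rewrite big1 // => r _; rewrite andbA E.
by rewrite big_mkcond; apply: eq_bigr => r _; rewrite andbA E.
Qed.

(** Only an inequality, because the sum on the right also runs over pairs of edges
    that meet and so never occur together. *)
Lemma moment2 (u : H * H -> H * H -> R) : (forall p q, 0 <= u p q) ->
  (N - 1)%:R * (N - 3)%:R *
    (\sum_(M in configurations d) \sum_(p in oriented M) \sum_(q in partners M p) u p q) <=
  Om * \sum_p \sum_q u p q.
Proof.
move=> u0.
have -> : \sum_(M in configurations d) \sum_(p in oriented M) \sum_(q in partners M p) u p q =
   \sum_p \sum_q #|[set M in configurations d | (p \in oriented M) && (q \in partners M p)]|%:R * u p q.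
  under eq_bigr => M _ do rewrite sum2_mkcond.
  rewrite exchange_big /=; apply: eq_bigr => p _; rewrite exchange_big /=; apply: eq_bigr => q _.
  rewrite mulr_natl -sumr_const [RHS]big_mkcond [LHS]big_mkcond; apply: eq_bigr => M _.
  by rewrite [in RHS]inE; case: (M \in _).
rewrite !mulr_sumr; apply: ler_sum => p _; rewrite !mulr_sumr; apply: ler_sum => q _.
rewrite mulrA ler_wpM2r //.
have [->|/set0Pn[M0]] := eqVneq
    [set M in configurations d | (p \in oriented M) && (q \in partners M p)] finset.set0.
  by rewrite cards0 mulr0.
rewrite !inE => /and3P[cM0]; rewrite -/(oriented M0) => pM0 /andP[qM0 qp0].
rewrite -mem_oriented in pM0; rewrite -mem_oriented in qM0; rewrite eq_sym in qp0.
rewrite mulrC -(card_containing2 (oriented_apart cM0 pM0 qM0 qp0) (oriented_neq cM0 qM0)).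
rewrite ler_wpM2r ?mulr_ge0 // ler_nat; apply: subset_leq_card; apply/subsetP => M.
rewrite inE => /and3P[cM pM /partnersP[qM _]].
by rewrite inE cM sub2 -!mem_oriented pM qM.
Qed.

Lemma moment3 (u : H * H -> H * H -> H * H -> R) : (forall p q r, 0 <= u p q r) ->
  (N - 1)%:R * (N - 3)%:R * (N - 5)%:R *
    (\sum_(M in configurations d) \sum_(p in oriented M) \sum_(q in partners M p)
       \sum_(r in partners M p | edge r != edge q) u p q r) <=
  Om * \sum_p \sum_q \sum_r u p q r.
Proof.
move=> u0.
have -> : \sum_(M in configurations d) \sum_(p in oriented M) \sum_(q in partners M p)
       \sum_(r in partners M p | edge r != edge q) u p q r =
   \sum_p \sum_q \sum_r #|[set M in configurations d |
     [&& p \in oriented M, q \in partners M p, r \in partners M p & edge r != edge q]]|%:R * u p q r.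
  under eq_bigr => M _ do rewrite sum3_mkcond.
  rewrite exchange_big /=; apply: eq_bigr => p _; rewrite exchange_big /=; apply: eq_bigr => q _.
  rewrite exchange_big /=; apply: eq_bigr => r _.
  rewrite mulr_natl -sumr_const [RHS]big_mkcond [LHS]big_mkcond; apply: eq_bigr => M _.
  by rewrite [in RHS]inE; case: (M \in _).
rewrite !mulr_sumr; apply: ler_sum => p _; rewrite !mulr_sumr; apply: ler_sum => q _.
rewrite !mulr_sumr; apply: ler_sum => r _.
rewrite mulrA ler_wpM2r //.
set S := [set M in configurations d | _].
have [->|/set0Pn[M0]] := eqVneq S finset.set0; first by rewrite cards0 mulr0.
rewrite inE => /and5P[cM0 pM0 /partnersP[qM0 qp0] /partnersP[rM0 rp0] rq0].
rewrite inE in cM0.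
rewrite eq_sym in qp0; rewrite eq_sym in rp0; rewrite eq_sym in rq0.
have h1 := oriented_apart cM0 pM0 qM0 qp0; have h2 := oriented_apart cM0 pM0 rM0 rp0.
have h3 := oriented_apart cM0 qM0 rM0 rq0.
rewrite mulrC -(card_containing3 h1 h2 h3 (oriented_neq cM0 rM0)).
rewrite ler_wpM2r ?mulr_ge0 // ler_nat; apply: subset_leq_card; apply/subsetP => M.
rewrite inE => /and5P[cM pM /partnersP[qM _] /partnersP[rM _] _].
by rewrite inE cM finset.subUset sub2 sub1set -!mem_oriented pM qM rM.
Qed.

End Moments.

(** * Bad edges and spare products in terms of the degrees *)

Section Estimates.
Variables (R : realType) (n : nat) (d : 'I_n -> nat).
Notation H := (half_edge d).
Implicit Types (M : {set {set H}}) (e f g : {set H}) (p q r : H * H) (h a b : H).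

Lemma sum_half_edge (F : 'I_n -> nat) :
  (\sum_(h : H) F (tag h) = \sum_i d i * F i)%N.
Proof.
rewrite (partition_big (fun h : H => tag h) xpredT) //=; apply: eq_bigr => i _.
rewrite (eq_bigr (fun=> F i)) => [|h /eqP -> //].
rewrite sum_nat_const -(card_vertex d i); congr (_ * _)%N; apply: eq_card => h.
by rewrite [RHS]inE.
Qed.

Lemma card_half_edge : #|{: H}| = (\sum_i d i)%N.
Proof. by rewrite -sum1_card (sum_half_edge (fun=> 1%N)); apply: eq_bigr => i _; rewrite muln1. Qed.

Definition sum_sq : nat := \sum_(h : H) d (tag h).

Lemma sum_sqE : sum_sq = (\sum_i d i ^ 2)%N.
Proof. by rewrite /sum_sq (sum_half_edge d); apply: eq_bigr. Qed.

Lemma sum_pair (F G : H -> R) :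
  \sum_(p : H * H) F p.1 * G p.2 = (\sum_h F h) * (\sum_h G h).
Proof.
by rewrite big_distrlr /= (pair_bigA _ (fun a b => F a * G b)).
Qed.

Lemma sum_tagR i : \sum_(h : H) (tag h == i)%:R = (d i)%:R :> R.
Proof. by rewrite -natr_sum sum_tag. Qed.

Lemma sum_tag_pair i j :
  \sum_(q : H * H) ((tag q.1 == i) && (tag q.2 == j))%:R = (d i)%:R * (d j)%:R :> R.
Proof.
rewrite -!sum_tagR -sum_pair; apply: eq_bigr => q _.
by case: (_ == i); rewrite ?mul1r ?mul0r.
Qed.

Lemma le_term2 (I : finType) (J : I -> {set I}) (A : {set I}) (u : I -> I -> R) i j :
  (forall i j, 0 <= u i j) -> i \in A -> j \in J i ->
  u i j <= \sum_(i in A) \sum_(j in J i) u i j.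
Proof.
move=> u0 iA jJ; rewrite (bigD1 i) //= (bigD1 j) //= -addrA lerDl addr_ge0 //.
  by apply: sumr_ge0.
by apply: sumr_ge0 => k _; apply: sumr_ge0.
Qed.

Lemma ends_orient M p e : configuration M -> e \in M -> ends e = ends (edge p) ->
  exists2 q, q \in oriented M & e = edge q /\ ((tag q.1 == tag p.1) && (tag q.2 == tag p.2)).
Proof.
move=> cM eM E; have [q qM Eq] := edge_orient cM eM; subst e.
move/eqP: E; rewrite !ends_tag => /edge_eqP[][E1 E2].
  by exists q; rewrite // E1 E2 !eqxx.
by exists (flip q); rewrite ?flip_oriented ?edge_flip //= E1 E2 !eqxx.
Qed.

Definition same_tags p q : bool := (tag q.1 == tag p.1) && (tag q.2 == tag p.2).

(** A loop is counted in its two orders by the first sum, an edge with a parallel one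
    by the second. *)
Lemma card_badset_le M : configuration M ->
  2 * #|badset M|%:R <= \sum_(p in oriented M) (tag p.1 == tag p.2)%:R
    + \sum_(p in oriented M) \sum_(q in partners M p) (same_tags p q)%:R :> R.
Proof.
move=> cM.
have -> : #|badset M|%:R = \sum_(e in M) (e \in badset M)%:R :> R.
  rewrite -sum1_card natr_sum big_mkcond [RHS]big_mkcond; apply: eq_bigr => e _.
  by case: ifP => [/badset_sub ->|_]; rewrite ?if_same.
rewrite -(sum_oriented_edge (fun e => (e \in badset M)%:R)) // -big_split /=.
apply: ler_sum => p pM; case: badsetP => [[_ [l|[f [fM fp E]]]]|_].
- by rewrite -loop_edge l lerDl sumr_ge0.
- have [q qM [Eq sq]] := ends_orient cM fM E; subst f.
  rewrite (bigD1 q) /=; last by apply/partnersP.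
  by rewrite /same_tags sq addrCA lerDl addr_ge0 // sumr_ge0.
- by rewrite addr_ge0 // sumr_ge0.
Qed.

Definition double_loop p q : bool := (tag p.1 == tag p.2) && same_tags p q.

(** Union bound: a configuration is not generic because of a loop with a parallel
    edge, or of three parallel edges. *)
Lemma nongeneric_le M : configuration M ->
  (~~ generic M)%:R <= \sum_(p in oriented M) \sum_(q in partners M p) (double_loop p q)%:R
    + \sum_(p in oriented M) \sum_(q in partners M p)
       \sum_(r in partners M p | edge r != edge q) (same_tags p q && same_tags p r)%:R :> R.
Proof.
move=> cM; have [|] := boolP (generic M).
  by rewrite addr_ge0 // sumr_ge0 // => p _; rewrite sumr_ge0 // => q _; rewrite sumr_ge0.
rewrite /generic negb_forall_in => /exists_inP[e eM].
rewrite negb_forall_in => /exists_inP[f fM]; rewrite negb_imply => /andP[/andP[fe /eqP Ef]].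
have [p pM Ep] := edge_orient cM eM; subst e.
have [q qM [Eq sq]] := ends_orient cM fM Ef; subst f.
have qP : q \in partners M p by apply/partnersP.
rewrite negb_and negbK => /orP[l|].
  apply: (@le_trans _ _ (double_loop p q)%:R).
    by rewrite /double_loop /same_tags sq -loop_edge l.
  apply: le_trans (le_term2 (u := fun p q => (double_loop p q)%:R) _ pM qP) _ => //.
  by rewrite lerDl; apply: sumr_ge0 => p' _; apply: sumr_ge0 => q' _; apply: sumr_ge0.
rewrite negb_forall_in => /exists_inP[g gM]; rewrite negb_imply negb_or => /andP[/eqP Eg /andP[ge gf]].
have [r rM [Er sr]] := ends_orient cM gM Eg; subst g.
have rP : r \in partners M p by apply/partnersP.
apply: (@le_trans _ _ (\sum_(r in partners M p | edge r != edge q) (same_tags p q && same_tags p r)%:R)).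
  by rewrite (bigD1 r) /= ?rP // /same_tags sq sr lerDl sumr_ge0.
apply: le_trans (le_term2 (u := fun p q => \sum_(r in partners M p | edge r != edge q)
    (same_tags p q && same_tags p r)%:R) _ pM qP) _.
  by move=> p' q'; apply: sumr_ge0.
by rewrite lerDr; apply: sumr_ge0 => p' _; apply: sumr_ge0.
Qed.

Local Notation N := (#|{: H}|).
Local Notation Om := (#|configurations d|%:R : R).
Local Notation P2 := (sum_sq%:R : R).

Variable D : nat.
Hypothesis dD : forall i, (d i <= D)%N.
Hypothesis N6 : (6 < N)%N.

Lemma sum_same_tags : \sum_p \sum_q (same_tags p q)%:R = P2 ^+ 2 :> R.
Proof.
under eq_bigr => p _ do rewrite sum_tag_pair.
by rewrite (sum_pair (fun h => (d (tag h))%:R) (fun h => (d (tag h))%:R)) expr2 -natr_sum.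
Qed.

Lemma sum_loop_tags : \sum_(p : H * H) (tag p.1 == tag p.2)%:R = P2 :> R.
Proof.
rewrite -(pair_bigA _ (fun a b : H => (tag a == tag b)%:R)) /=.
rewrite /sum_sq natr_sum; apply: eq_bigr => a _.
by rewrite -(sum_tagR (tag a)); apply: eq_bigr => b _; rewrite eq_sym.
Qed.

Lemma sum_double_loop : \sum_p \sum_q (double_loop p q)%:R <= D%:R ^+ 2 * P2.
Proof.
rewrite -sum_loop_tags mulr_sumr; apply: ler_sum => p _; rewrite /double_loop.
case: (_ == _); last by rewrite big1 ?mulr0.
rewrite sum_tag_pair mulr1 expr2 ler_pM // ler_nat; exact: dD.
Qed.

Lemma sum_triple : \sum_p \sum_q \sum_r (same_tags p q && same_tags p r)%:R <= D%:R ^+ 2 * P2 ^+ 2 :> R.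
Proof.
rewrite -sum_same_tags mulr_sumr; apply: ler_sum => p _; rewrite mulr_sumr; apply: ler_sum => q _.
case: (same_tags p q); last by rewrite big1 ?mulr0.
rewrite sum_tag_pair mulr1 expr2 ler_pM // ler_nat; exact: dD.
Qed.

Local Notation W := ((spare_sum d)%:R : R).
Definition spare_sq : nat := \sum_(h : H) spare h ^ 2.
Local Notation Q := (spare_sq%:R : R).

Lemma spare_le h : (spare h <= d (tag h))%N.
Proof. exact: leq_pred. Qed.

Lemma W_le : W <= P2.
Proof. by rewrite ler_nat; apply: leq_sum => h _; apply: spare_le. Qed.

Lemma Q_le : Q <= D%:R * P2.
Proof.
rewrite -natrM ler_nat big_distrr /=; apply: leq_sum => h _.
by rewrite -mulnn leq_mul // ?spare_le // (leq_trans (spare_le h)).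
Qed.

Lemma sum_spare_offdiag : \sum_(p : H * H | p.1 != p.2) (spare p.1 * spare p.2)%:R = W ^+ 2 - Q.
Proof.
apply/eqP; rewrite eq_sym subr_eq eq_sym; apply/eqP.
have -> : Q = \sum_(p : H * H | ~~ (p.1 != p.2)) (spare p.1 * spare p.2)%:R.
  rewrite /spare_sq natr_sum.
  rewrite -(pair_big_dep xpredT (fun a b : H => ~~ (a != b)) (fun a b => (spare a * spare b)%:R : R)) /=.
  by apply: eq_bigr => a _; rewrite (big_pred1 a) ?mulnn // => b; rewrite negbK eq_sym.
rewrite expr2 natr_sum -sum_pair [RHS](bigID (fun p : H * H => p.1 != p.2)) /=.
by congr (_ + _); apply: eq_bigr => p _; rewrite natrM.
Qed.

Lemma mean_product : (N - 1)%:R * \sum_(M in configurations d) (spare_product M)%:R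
  = Om * (W ^+ 2 - Q).
Proof.
rewrite -sum_spare_offdiag -moment1; congr (_ * _).
by apply: eq_bigr => M _; rewrite natr_sum.
Qed.

(** Expanding the square, [q = p] and [q = flip p] give the term in [Q ^+ 2], and
    [moment2] bounds the contribution of the other pairs. *)
Lemma square_product : \sum_(M in configurations d) (spare_product M)%:R ^+ 2 <=
  Om * (2 * Q ^+ 2 / (N - 1)%:R + W ^+ 4 / ((N - 1)%:R * (N - 3)%:R)).
Proof.
have N1 : 0 < (N - 1)%:R :> R by rewrite ltr0n; lia.
have N3 : 0 < (N - 3)%:R :> R by rewrite ltr0n; lia.
pose x p : R := (spare p.1 * spare p.2)%:R.
have x0 p : 0 <= x p by rewrite ler0n.
have E : \sum_(M in configurations d) (spare_product M)%:R ^+ 2 =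
   2 * \sum_(M in configurations d) \sum_(p in oriented M) x p ^+ 2
   + \sum_(M in configurations d) \sum_(p in oriented M) \sum_(q in partners M p) x p * x q.
  rewrite mulr_sumr -big_split; apply: eq_bigr => M; rewrite inE => cM /=.
  rewrite natr_sum expr2 mulr_suml mulr_sumr -big_split; apply: eq_bigr => p pM /=.
  rewrite (bigD1 p) //= (bigD1 (flip p)) /=; last first.
    rewrite flip_oriented pM /=; have := oriented_neq cM pM; case: (p) => a b /= ab.
    by rewrite /flip xpair_eqE eq_sym (negPf ab).
  rewrite mulrDr mulrDr addrA; congr (_ + _).
    by rewrite /x /= [(spare p.2 * _)%N]mulnC [RHS]mulr_natl expr2 mulr2n.
  rewrite mulr_sumr; apply: eq_bigl => q.
  rewrite -andbA -negb_or; apply/andP/partnersP => -[qM NN]; split=> //.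
    by apply: contraNN NN => /edge_eqP[] ->; rewrite eqxx ?orbT.
  by apply: contraNN NN => /orP[]/eqP ->; rewrite ?edge_flip.
rewrite E mulrDr; apply: lerD.
  suff hS : (N - 1)%:R * (\sum_(M in configurations d) \sum_(p in oriented M) x p ^+ 2)
      <= Om * Q ^+ 2.
    by rewrite mulrA ler_pdivlMr //; lra.
  rewrite moment1 ler_wpM2l //.
  apply: (@le_trans _ _ (\sum_(p : H * H) x p ^+ 2)).
    by rewrite big_mkcond; apply: ler_sum => p _; case: ifP => // _; rewrite exprn_ge0.
  rewrite expr2 /spare_sq natr_sum -sum_pair; apply: ler_sum => p _.
  by rewrite /x -natrX expnMn natrM.
rewrite mulrA ler_pdivlMr ?mulr_gt0 // mulrC; apply: le_trans (moment2 _) _.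
  by move=> p q; rewrite mulr_ge0.
rewrite ler_wpM2l // -[4%N]/(2 * 2)%N exprM le_eqVlt; apply/orP; left; apply/eqP.
rewrite [RHS]expr2; under eq_bigr => p _ do rewrite -mulr_sumr.
rewrite -mulr_suml; congr (_ * _).
  by rewrite expr2 natr_sum -sum_pair; apply: eq_bigr => p _; rewrite /x natrM.
by rewrite expr2 natr_sum -sum_pair; apply: eq_bigr => p _; rewrite /x natrM.
Qed.

End Estimates.

(** * Probability estimates for bounded second degree moment *)

Section Concentration.
Variables (R : realType) (n : nat) (d : 'I_n -> nat).
Notation H := (half_edge d).
Implicit Types (M : {set {set H}}).
Local Notation N := (#|{: H}|).
Local Notation Om := (#|configurations d|%:R : R).
Local Notation P2 := ((sum_sq d)%:R : R).
Local Notation W := ((spare_sum d)%:R : R).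
Local Notation Q := ((spare_sq d)%:R : R).

Variables (D : nat) (C theta : R).
Hypothesis dD : forall i, (d i <= D)%N.
Hypothesis N6 : (6 < N)%N.
Hypothesis C1 : 1 <= C.
Hypothesis th0 : 0 < theta.
Hypothesis PC : P2 <= C * N%:R.
Hypothesis Dth : D%:R ^+ 2 <= theta ^+ 2 * N%:R.

Local Notation x := (N%:R : R).

Lemma N_ge7 : 7 <= x.
Proof. by rewrite ler_nat. Qed.

Lemma nat_minus k : (k <= N)%N -> (N - k)%:R = x - k%:R.
Proof. by move=> kN; rewrite natrB. Qed.

Lemma D_gt0 : (0 < D)%N.
Proof.
have /card_gt0P[h _] : (0 < #|{: H}|)%N by apply: leq_trans N6.
exact: leq_trans (deg_gt0 h) (dD _).
Qed.

Lemma theta_x : 1 <= theta ^+ 2 * x.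
Proof.
apply: le_trans Dth; rewrite -natrX ler1n expn_gt0 D_gt0 //.
Qed.

Lemma D_le : D%:R <= theta ^+ 2 * x.
Proof.
by apply: le_trans Dth; rewrite -natrX ler_nat -mulnn leq_pmulr ?D_gt0.
Qed.

Lemma quad_bound : x ^+ 2 <= 4 * ((x - 1) * (x - 3)).
Proof. have := N_ge7; nra. Qed.

Lemma cube_bound : x ^+ 3 <= 8 * ((x - 1) * (x - 3) * (x - 5)).
Proof.
have h := N_ge7; have [y [y0 ->]] : exists y, 0 <= y /\ x = y + 7 by exists (x - 7); split; lra.
rewrite -subr_ge0.
have -> : 8 * ((y + 7 - 1) * (y + 7 - 3) * (y + 7 - 5)) - (y + 7) ^+ 3
   = 7 * y ^+ 3 + 75 * y ^+ 2 + 205 * y + 41 by ring.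
by rewrite !addr_ge0 ?mulr_ge0 ?exprn_ge0 //.
Qed.

Lemma P2_ge0 : 0 <= P2. Proof. exact: ler0n. Qed.

Lemma P2_sq : P2 ^+ 2 <= C ^+ 2 * x ^+ 2.
Proof. by rewrite -exprMn ler_pXn2r // nnegrE ?P2_ge0 // mulr_ge0 // ?(le_trans _ C1). Qed.

Lemma mean_badset : \sum_(M in configurations d) #|badset M|%:R <= Om * (3 * C ^+ 2).
Proof.
have h := N_ge7; have Om0 : 0 <= Om by exact: ler0n.
have N1 : (N - 1)%:R = x - 1 by rewrite nat_minus //; lia.
have N3 : (N - 3)%:R = x - 3 by rewrite nat_minus //; lia.
set S1 := \sum_(M in configurations d) \sum_(p in oriented M) (tag p.1 == tag p.2)%:R : R.
set S2 := \sum_(M in configurations d) \sum_(p in oriented M) \sum_(q in partners M p) (same_tags p q)%:R : R.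
have le : 2 * (\sum_(M in configurations d) #|badset M|%:R) <= S1 + S2.
  rewrite mulr_sumr -big_split; apply: ler_sum => M; rewrite inE => cM; exact: card_badset_le.
have b1 : S1 <= Om * (2 * C).
  have e1 : (N - 1)%:R * S1 <= Om * (C * x).
    rewrite moment1 ler_wpM2l //; apply: le_trans PC; rewrite -sum_loop_tags.
    by rewrite big_mkcond; apply: ler_sum => p _; case: ifP.
  have x1 : 0 < x - 1 by lra.
  rewrite -(ler_pM2l x1) -N1; apply: le_trans e1 _; rewrite N1 [X in _ <= X]mulrCA ler_wpM2l //.
  have := C1; nra.
have b2 : S2 <= Om * (4 * C ^+ 2).
  have e2 : (N - 1)%:R * (N - 3)%:R * S2 <= Om * (C ^+ 2 * x ^+ 2).
    apply: le_trans (moment2 _) _ => [p q|]; first exact: ler0n.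
    by rewrite ler_wpM2l // sum_same_tags P2_sq.
  have x1 : 0 < (x - 1) * (x - 3) by rewrite mulr_gt0 //; lra.
  rewrite -(ler_pM2l x1) -{1}N1 -{1}N3; apply: le_trans e2 _; rewrite [X in _ <= X]mulrCA ler_wpM2l //.
  have -> : (x - 1) * (x - 3) * (4 * C ^+ 2) = C ^+ 2 * (4 * ((x - 1) * (x - 3))) by ring.
  by rewrite ler_wpM2l ?exprn_ge0 ?(le_trans _ C1) // quad_bound.
have C2 : Om * (2 * C) <= Om * (2 * C ^+ 2).
  by rewrite ler_wpM2l //; have := C1; nra.
move: le b1 b2 C2; lra.
Qed.

Lemma few_nongeneric :
  #|[set M in configurations d | ~~ generic M]|%:R <= Om * (12 * C ^+ 2 * theta ^+ 2).
Proof.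
have h := N_ge7; have Om0 : 0 <= Om by exact: ler0n.
have N1 : (N - 1)%:R = x - 1 by rewrite nat_minus //; lia.
have N3 : (N - 3)%:R = x - 3 by rewrite nat_minus //; lia.
have N5 : (N - 5)%:R = x - 5 by rewrite nat_minus //; lia.
set S1 := \sum_(M in configurations d) \sum_(p in oriented M) \sum_(q in partners M p) (double_loop p q)%:R : R.
set S2 := \sum_(M in configurations d) \sum_(p in oriented M) \sum_(q in partners M p)
       \sum_(r in partners M p | edge r != edge q) (same_tags p q && same_tags p r)%:R : R.
have le : #|[set M in configurations d | ~~ generic M]|%:R <= S1 + S2.
  rewrite -sum1_card natr_sum (eq_bigl (fun M => (M \in configurations d) && ~~ generic M)) => [|M].
    rewrite big_mkcondr -big_split; apply: ler_sum => M; rewrite inE => cM.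
    by apply: le_trans (nongeneric_le R cM); case: (generic M).
  by rewrite inE.
have C0 : 0 <= C by apply: le_trans C1.
have t20 : 0 <= theta ^+ 2 by rewrite exprn_ge0 // ltW.
have x0 : 0 <= x by lra.
have b1 : S1 <= Om * (4 * C ^+ 2 * theta ^+ 2).
  have e1 : (N - 1)%:R * (N - 3)%:R * S1 <= Om * (theta ^+ 2 * C * x ^+ 2).
    apply: le_trans (moment2 _) _ => [p q|]; first exact: ler0n.
    rewrite ler_wpM2l //; apply: le_trans (sum_double_loop R dD) _.
    apply: (@le_trans _ _ ((theta ^+ 2 * x) * (C * x))).
      by rewrite ler_pM // ?exprn_ge0.
    by rewrite le_eqVlt; apply/orP; left; apply/eqP; ring.
  have x1 : 0 < (x - 1) * (x - 3) by rewrite mulr_gt0 //; lra.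
  rewrite -(ler_pM2l x1) -{1}N1 -{1}N3; apply: le_trans e1 _; rewrite [X in _ <= X]mulrCA ler_wpM2l //.
  apply: (@le_trans _ _ (theta ^+ 2 * C * (4 * ((x - 1) * (x - 3))))).
    by apply: ler_wpM2l; [exact: mulr_ge0|exact: quad_bound].
  apply: (@le_trans _ _ (theta ^+ 2 * C ^+ 2 * (4 * ((x - 1) * (x - 3))))).
    apply: ler_wpM2r; first by apply: mulr_ge0 => //; exact: ltW.
    by apply: ler_wpM2l => //; rewrite expr2 ler_peMl.
  by rewrite le_eqVlt; apply/orP; left; apply/eqP; ring.
have b2 : S2 <= Om * (8 * C ^+ 2 * theta ^+ 2).
  have e2 : (N - 1)%:R * (N - 3)%:R * (N - 5)%:R * S2 <= Om * (theta ^+ 2 * C ^+ 2 * x ^+ 3).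
    apply: le_trans (moment3 _) _ => [p q r|]; first exact: ler0n.
    rewrite ler_wpM2l //; apply: le_trans (sum_triple R dD) _.
    apply: (@le_trans _ _ ((theta ^+ 2 * x) * (C ^+ 2 * x ^+ 2))).
      by rewrite ler_pM // ?exprn_ge0 // P2_sq.
    by rewrite le_eqVlt; apply/orP; left; apply/eqP; ring.
  have x1 : 0 < (x - 1) * (x - 3) * (x - 5) by rewrite !mulr_gt0 //; lra.
  rewrite -(ler_pM2l x1) -{1}N1 -{1}N3 -{1}N5; apply: le_trans e2 _; rewrite [X in _ <= X]mulrCA ler_wpM2l //.
  apply: (@le_trans _ _ (theta ^+ 2 * C ^+ 2 * (8 * ((x - 1) * (x - 3) * (x - 5))))).
    by apply: ler_wpM2l; [apply: mulr_ge0 => //; exact: exprn_ge0|exact: cube_bound].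
  by rewrite le_eqVlt; apply/orP; left; apply/eqP; ring.
move: le b1 b2; lra.
Qed.

(** The mean of [spare_product], up to the diagonal correction in [mean_product]. *)
Definition centre : R := W ^+ 2 / (N - 1)%:R.

Lemma W_ge0 : 0 <= W. Proof. exact: ler0n. Qed.

Lemma W_leC : W <= C * x.
Proof. exact: le_trans (W_le R d) PC. Qed.

Lemma centre_le : 2 * W + centre <= 8 * C ^+ 2 * (N - 2)%:R.
Proof.
have h := N_ge7; have C0 : 0 <= C by apply: le_trans C1.
have N1 : (N - 1)%:R = x - 1 by rewrite nat_minus //; lia.
have N2 : (N - 2)%:R = x - 2 by rewrite nat_minus //; lia.
have W2 : W ^+ 2 <= C ^+ 2 * x ^+ 2.
  by rewrite -exprMn ler_pXn2r ?nnegrE ?W_ge0 ?W_leC ?mulr_ge0 //; lra.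
have c_le : centre <= C ^+ 2 * (2 * (x - 1)).
  rewrite /centre N1 ler_pdivrMr; last by lra.
  apply: le_trans W2 _.
  have -> : C ^+ 2 * (2 * (x - 1)) * (x - 1) = C ^+ 2 * (2 * (x - 1) ^+ 2) by ring.
  by apply: ler_wpM2l; [exact: exprn_ge0|nra].
have w_le : 2 * W <= C ^+ 2 * (2 * x).
  have := W_leC; have h2 : C * x <= C ^+ 2 * x by rewrite ler_wpM2r ?expr2 ?ler_peMl //; lra.
  lra.
rewrite N2; apply: le_trans (lerD w_le c_le) _; rewrite -mulrDr.
have -> : 8 * C ^+ 2 * (x - 2) = C ^+ 2 * (8 * (x - 2)) by ring.
by apply: ler_wpM2l; [exact: exprn_ge0|lra].
Qed.

(** In the variance the terms of order [W ^+ 4 / N ^+ 2] cancel up to a factor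
    [1 / N], and what remains involves [Q <= D * sum_sq d = O(D N)]: its square
    divided by [N] is [O(D ^+ 2 * N)], which is at most [theta ^+ 2 * N ^+ 2] up to
    a constant. *)
Lemma variance_product :
  \sum_(M in configurations d) ((spare_product M)%:R - centre) ^+ 2 <=
  Om * (16 * C ^+ 4 * theta ^+ 2 * x ^+ 2).
Proof.
have h := N_ge7; have C0 : 0 <= C by apply: le_trans C1.
have Om0 : 0 <= Om by exact: ler0n.
have N1 : (N - 1)%:R = x - 1 by rewrite nat_minus //; lia.
have N3 : (N - 3)%:R = x - 3 by rewrite nat_minus //; lia.
have t20 : 0 <= theta ^+ 2 by rewrite exprn_ge0 // ltW.
have x0 : 0 <= x by lra.
have x1 : 0 < x - 1 by lra.
have x3 : 0 < x - 3 by lra.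
have mean : \sum_(M in configurations d) (spare_product M)%:R = Om * ((W ^+ 2 - Q) / (x - 1)).
  apply: (mulfI (lt0r_neq0 x1)); rewrite -[in LHS]N1 mean_product.
  by rewrite mulrCA [(x - 1) * _]mulrC divfK // lt0r_neq0.
have -> : \sum_(M in configurations d) ((spare_product M)%:R - centre) ^+ 2 =
  \sum_(M in configurations d) (spare_product M)%:R ^+ 2
   - 2 * centre * (\sum_(M in configurations d) (spare_product M)%:R) + centre ^+ 2 * Om.
  rewrite mulr_sumr -sumrB -sum1_card natr_sum mulr_sumr -big_split; apply: eq_bigr => M _ /=; ring.
apply: (@le_trans _ _ (Om * (2 * Q ^+ 2 / (x - 1) + 2 * W ^+ 4 / ((x - 1) ^+ 2 * (x - 3))
    + 2 * W ^+ 2 * Q / (x - 1) ^+ 2))).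
  have := square_product R N6; rewrite N1 N3 mean /centre N1 => sq.
  apply: le_trans (lerD (lerB sq (lexx _)) (lexx _)) _.
  rewrite le_eqVlt; apply/orP; left; apply/eqP; field.
  by rewrite !lt0r_neq0.
rewrite ler_wpM2l //.
have Q0 : 0 <= Q by exact: ler0n.
have Q_1 : Q <= D%:R * (C * x) by apply: le_trans (Q_le R dD) _; rewrite ler_wpM2l.
have Q_2 : Q <= theta ^+ 2 * C * x ^+ 2.
  apply: le_trans Q_1 _; apply: (@le_trans _ _ ((theta ^+ 2 * x) * (C * x))).
    by rewrite ler_wpM2r ?mulr_ge0 // D_le.
  by rewrite le_eqVlt; apply/orP; left; apply/eqP; ring.
have QQ : Q ^+ 2 <= theta ^+ 2 * C ^+ 2 * x ^+ 3.
  apply: (@le_trans _ _ ((D%:R * (C * x)) ^+ 2)).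
    by rewrite ler_pXn2r // nnegrE ?mulr_ge0.
  rewrite exprMn; apply: (@le_trans _ _ ((theta ^+ 2 * x) * (C * x) ^+ 2)).
    by rewrite ler_wpM2r // exprn_ge0 // mulr_ge0.
  by rewrite le_eqVlt; apply/orP; left; apply/eqP; ring.
have Wk k : W ^+ k <= C ^+ k * x ^+ k.
  case: k => [|k]; first by rewrite !expr0 mulr1.
  by rewrite -exprMn ler_pXn2r ?nnegrE ?W_ge0 ?W_leC ?mulr_ge0.
have CC2 : C ^+ 2 <= C ^+ 4 by rewrite ler_weXn2l.
have CC3 : C ^+ 3 <= C ^+ 4 by rewrite ler_weXn2l.
set T := theta ^+ 2 * x ^+ 2; have T0 : 0 <= T by rewrite mulr_ge0 // exprn_ge0.
have b1 : 2 * Q ^+ 2 / (x - 1) <= 4 * C ^+ 2 * T.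
  rewrite ler_pdivrMr //; apply: (@le_trans _ _ (2 * (theta ^+ 2 * C ^+ 2 * x ^+ 3))).
    by rewrite ler_wpM2l.
  have -> : 2 * (theta ^+ 2 * C ^+ 2 * x ^+ 3) = C ^+ 2 * T * (2 * x) by rewrite /T; ring.
  have -> : 4 * C ^+ 2 * T * (x - 1) = C ^+ 2 * T * (4 * (x - 1)) by ring.
  by apply: ler_wpM2l; [apply: mulr_ge0 => //; exact: exprn_ge0|lra].
have b2 : 2 * W ^+ 4 / ((x - 1) ^+ 2 * (x - 3)) <= 8 * C ^+ 4 * T.
  rewrite ler_pdivrMr; last by rewrite mulr_gt0 // exprn_gt0.
  apply: (@le_trans _ _ (2 * (C ^+ 4 * x ^+ 4))); first by rewrite ler_wpM2l.
  have -> : 2 * (C ^+ 4 * x ^+ 4) = C ^+ 4 * (x * 2 * x ^+ 3) by ring.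
  have -> : 8 * C ^+ 4 * T * ((x - 1) ^+ 2 * (x - 3)) =
     C ^+ 4 * (T * (8 * ((x - 1) ^+ 2 * (x - 3)))) by ring.
  rewrite ler_wpM2l ?exprn_ge0 //.
  apply: (@le_trans _ _ (x * (8 * ((x - 1) ^+ 2 * (x - 3))))).
    rewrite -mulrA ler_wpM2l //.
    (* Expanded at the smallest possible value 7, the difference has nonnegative
       coefficients. *)
    have y0 : 0 <= x - 7 by lra.
    rewrite -subr_ge0.
    have -> : 8 * ((x - 1) ^+ 2 * (x - 3)) - 2 * x ^+ 3 =
      6 * (x - 7) ^+ 3 + 86 * (x - 7) ^+ 2 + 378 * (x - 7) + 466 by ring.
    move: (x - 7) y0 => y y0; clear -y0.
    by rewrite !addr_ge0 ?mulr_ge0 ?exprn_ge0 //.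
  rewrite ler_wpM2r; first by [].
    by rewrite mulr_ge0 // mulr_ge0 ?exprn_ge0 // ltW.
  by rewrite /T expr2 mulrA ler_peMl // theta_x.
have b3 : 2 * W ^+ 2 * Q / (x - 1) ^+ 2 <= 4 * C ^+ 3 * T.
  rewrite ler_pdivrMr; last by rewrite exprn_gt0.
  apply: (@le_trans _ _ (2 * (C ^+ 2 * x ^+ 2) * (theta ^+ 2 * C * x ^+ 2))).
    by rewrite ler_pM ?mulr_ge0 ?exprn_ge0 ?W_ge0 // ler_wpM2l.
  have -> : 2 * (C ^+ 2 * x ^+ 2) * (theta ^+ 2 * C * x ^+ 2) = C ^+ 3 * T * (2 * x ^+ 2) by rewrite /T; ring.
  have -> : 4 * C ^+ 3 * T * (x - 1) ^+ 2 = C ^+ 3 * T * (4 * (x - 1) ^+ 2) by ring.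
  by apply: ler_wpM2l; [apply: mulr_ge0 => //; exact: exprn_ge0|nra].
have b4 := ler_wpM2r T0 CC2; have b5 := ler_wpM2r T0 CC3.
have -> : 16 * C ^+ 4 * theta ^+ 2 * x ^+ 2 = 16 * (C ^+ 4 * T) by rewrite /T; ring.
move: b1 b2 b3 b4 b5; rewrite -!mulrA; lra.
Qed.

(** The inequality [`|y| <= t + y ^+ 2 / t] with [t = theta * N] balances both terms. *)
Lemma deviation_product :
  \sum_(M in configurations d) `|(spare_product M)%:R - centre| <= Om * (17 * C ^+ 4 * theta * x).
Proof.
have h := N_ge7; have Om0 : 0 <= Om by exact: ler0n.
set t := theta * x; have t0 : 0 < t by rewrite mulr_gt0 //; lra.
apply: (@le_trans _ _ (\sum_(M in configurations d) (((spare_product M)%:R - centre) ^+ 2 / t + t))).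
  apply: ler_sum => M _; set y := _ - _.
  have [yt|yt] := leP `|y| t; first by rewrite -[X in X <= _]add0r lerD // divr_ge0 ?sqr_ge0 // ltW.
  apply: (@le_trans _ _ (y ^+ 2 / t)); last by rewrite lerDl ltW.
  by rewrite ler_pdivlMr // -real_normK ?num_real // expr2 ler_wpM2l // ltW.
rewrite big_split /= -mulr_suml sumr_const -[t *+ _]mulr_natl.
have v : (\sum_(M in configurations d) ((spare_product M)%:R - centre) ^+ 2) / t <= Om * (16 * C ^+ 4 * t).
  rewrite ler_pdivrMr //; apply: le_trans variance_product _.
  by rewrite le_eqVlt; apply/orP; left; apply/eqP; rewrite /t; ring.
apply: le_trans (lerD v (lexx _)) _; rewrite -mulrDr ler_wpM2l //.
have -> : 17 * C ^+ 4 * theta * x = 16 * C ^+ 4 * t + C ^+ 4 * t by rewrite /t; ring.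
by rewrite lerD2l ler_peMl ?exprn_ege1 // ltW.
Qed.

End Concentration.

(** * Induction over the levels *)

Lemma cross_error_lower b k X : (b <= 2 * k -> 4 * b + 2 * b * X <= 2 * k * (4 + 2 * X))%N.
Proof.
move=> bk; have h : (2 * b * X <= 2 * (2 * k) * X)%N by rewrite !leq_mul.
apply: leq_trans (leq_add (leqnn _) h) _; lia.
Qed.

Lemma cross_error_upper b k X : (b <= 2 * k -> 2 * b * X <= 2 * k * (4 + 2 * X))%N.
Proof. by move=> bk; apply: leq_trans (cross_error_lower X bk); apply: leq_addl. Qed.

Section LevelInduction.
Variables (R : realType) (n : nat) (d : 'I_n -> nat).
Notation H := (half_edge d).
Implicit Types (M : {set {set H}}) (p q r : H * H).
Local Notation N := (#|{: H}|).
Local Notation Om := (#|configurations d|%:R : R).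
Local Notation O := ((#|{: H}| - 2)%:R : R).

(** [c] is the centre of [spare_product], [Lam] a bound on the rate per partner,
    [target] the uniform mass of [A], and [eps] a relative error, all sums being
    measured in units of [O = N - 2] partners and of [Om] configurations. *)
Variables (D K : nat) (c eps Lam target : R) (A : {set {set {set 'I_n}}}).
Hypothesis dD : forall i, (d i <= D)%N.
Hypothesis N2 : (2 < N)%N.

(** The bound of [card_conflict] when there are at most [2 K + 4] bad edges: the
    configurations of level up to [K] have at most [2 K], and 4 is the possible gain
    by one switching. *)
Definition conflict_bound : nat := 2 * (2 * K + 4) + 2 * D + 2 * D * D.

Hypothesis small_conflict : conflict_bound%:R <= eps * O.
Hypothesis small_const : 4 + 2 * (D * D)%:R <= eps * O.
Hypothesis small_nongeneric :
  N%:R * #|[set M in configurations d | ~~ generic M]|%:R <= eps * O * Om.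
Hypothesis small_deviation :
  \sum_(M in configurations d) `|(spare_product M)%:R - c| <= eps * O * Om.
Hypothesis rate_le : 2 * (spare_sum d)%:R + c <= Lam * O.
Hypothesis rate_ge0 : 0 <= 2 * (spare_sum d)%:R + c.
Hypothesis eps_ge0 : 0 <= eps.
Hypothesis target01 : 0 <= target <= 1.

Local Notation rate := (2 * (spare_sum d)%:R + c : R).
Local Notation V := (value R A).

Lemma few_not_good M p : configuration M -> generic M -> (#|badset M| <= 2 * K + 4)%N ->
  p \in oriented M -> edge p \in badset M ->
  (#|[set q in partners M p | ~~ good M p q]| <= conflict_bound)%N.
Proof.
move=> cM gM MK pM pB; apply: leq_trans (subset_leq_card _) _; last first.
  apply: leq_trans (card_conflict dD p cM) _.
  by rewrite /conflict_bound !leq_add2r leq_mul2l MK orbT.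
apply/subsetP => q; rewrite inE => /andP[/partnersP[qM qp]].
have -> : (q \in [set q0 in oriented M | conflict M p q0]) = conflict M p q by rewrite inE qM.
apply: contraNT.
by apply: conflict_good => //; rewrite eq_sym.
Qed.

Definition step_error (k : nat) : R :=
  12 * k.+1%:R ^+ 2 + 2 * (2 * (2 * k + 4) * (2 * k + 4 + 2))%:R + 1 + 6 * k%:R.

Lemma O0 : 0 < O.
Proof. by rewrite ltr0n subn_gt0. Qed.

Lemma Om0 : 0 <= Om.
Proof. exact: ler0n. Qed.

(** The number of reverse switchings is replaced by the constant [rate]: the error is
    that of [cross_sum], with at most [2 k] bad edges, plus the deviation of
    [spare_product] from its centre. *)
Lemma cross_deviation k (phi : {set {set H}} -> R) : (forall M, 0 <= phi M <= 1) ->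
  `| \sum_(M in level d k) phi M * (\sum_(p in oriented M) \sum_(q in partners M p) (cross M p q)%:R)
    - rate * \sum_(M in level d k) phi M | <= (1 + 2 * k%:R) * (eps * O) * Om.
Proof.
move=> phi01; rewrite mulr_sumr -sumrB; apply: le_trans (ler_norm_sum _ _ _) _.
have kO : 0 <= 2 * k%:R * (eps * O) by rewrite !mulr_ge0 // ltW // O0.
apply: (@le_trans _ _ (\sum_(M in configurations d) (`|(spare_product M)%:R - c| + 2 * k%:R * (eps * O)))).
  rewrite big_mkcond [X in _ <= X]big_mkcond; apply: ler_sum => M _.
  case: ifP => [/levelP[cM gM iM]|_]; last by case: ifP => // _; rewrite addr_ge0.
  rewrite [M \in configurations d]inE cM.
  have /andP[phi0 phi1] := phi01 M.
  set S := \sum_(p in oriented M) _.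
  have badk : (#|badset M| <= 2 * k)%N by rewrite -iM; apply: card_badset_items.
  have [le1 le2] := cross_sum dD cM.
  have SE : S = (\sum_(p in oriented M) \sum_(q in partners M p) cross M p q)%:R.
    by rewrite natr_sum; apply: eq_bigr => p _; rewrite natr_sum.
  have dev : `|S - (2 * (spare_sum d)%:R + (spare_product M)%:R)| <= 2 * k%:R * (eps * O).
    apply: (@le_trans _ _ ((2 * k * (4 + 2 * (D * D)))%:R)); last first.
      rewrite natrM natrM ler_wpM2l ?mulr_ge0 // natrD natrM; exact: small_const.
    set e := (2 * k * (4 + 2 * (D * D)))%N.
    have le1' : S <= 2 * (spare_sum d)%:R + (spare_product M)%:R + e%:R.
      rewrite SE -natrM -!natrD ler_nat; apply: leq_trans le1 _.
      by rewrite leq_add2l cross_error_upper.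
    have le2' : 2 * (spare_sum d)%:R + (spare_product M)%:R <= S + e%:R.
      rewrite SE -natrM -!natrD ler_nat; apply: leq_trans le2 _.
      by rewrite -addnA leq_add2l cross_error_lower.
    by rewrite ler_norml; apply/andP; split; lra.
  rewrite [rate * _]mulrC -mulrBr normrM ger0_norm //.
  apply: (@le_trans _ _ `|S - rate|); first by rewrite ler_piMl.
  have -> : S - rate = ((spare_product M)%:R - c) + (S - (2 * (spare_sum d)%:R + (spare_product M)%:R)) by lra.
  by apply: le_trans (ler_normD _ _) _; rewrite lerD2l.
rewrite big_split /= sumr_const -[_ *+ #|_|]mulr_natr.
have := small_deviation; lra.
Qed.

Lemma level_sum_bound k (phi : {set {set H}} -> R) : (k < K)%N -> (forall M, 0 <= phi M <= 1) ->
  `| \sum_(M in level d k.+1) \sum_(p in oriented M) \sum_(q in partners M p)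
       (weight M p q)%:R * phi (switch M p q) - rate * \sum_(M in level d k) phi M |
  <= (1 + 2 * k%:R + 2 * (2 * (2 * k + 4) * (2 * k + 4 + 2))%:R) * (eps * O) * Om.
Proof.
move=> kK phi01.
have few M p : configuration M -> generic M -> (#|badset M| <= 2 * k + 4)%N ->
    p \in oriented M -> edge p \in badset M ->
    (#|[set q in partners M p | ~~ good M p q]| <= conflict_bound)%N.
  move=> cM gM MK; apply: few_not_good => //; apply: leq_trans MK _.
  by rewrite leq_add2r leq_mul2l /= ltnW.
have ex := level_exchange few phi01; have dev := cross_deviation k phi01.
set S := (2 * (2 * k + 4) * (2 * k + 4 + 2))%:R in ex *.
have ex2 : S * (N%:R * #|[set M in configurations d | ~~ generic M]|%:R
    + conflict_bound%:R * Om) <= 2 * S * (eps * O) * Om.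
  have -> : 2 * S * (eps * O) * Om = S * (eps * O * Om + eps * O * Om) by ring.
  by rewrite ler_wpM2l // lerD // ler_wpM2r // Om0.
apply: le_trans (ler_distD _ _ _) _; apply: le_trans (lerD (le_trans ex ex2) dev) _.
by rewrite le_eqVlt; apply/orP; left; apply/eqP; ring.
Qed.

Lemma full_weight0 M e : e \in M -> e \notin badset M -> full_weight M e = 0%N.
Proof. by move=> eM eB; apply/eqP; rewrite -leqn0 leqNgt full_weight_bad. Qed.

Lemma sum_full_weight_level k M : M \in level d k ->
  \sum_(p in oriented M) (full_weight M (edge p))%:R = 4 * k%:R :> R.
Proof.
move=> /levelP[cM gM iM].
rewrite (sum_oriented_edge (fun e => (full_weight M e)%:R)) //.
rewrite (big_setID (badset M)) /= [X in _ + X]big1 ?addr0 => [|e].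
  rewrite (setIidPr _); last by apply/subsetP => e; apply: badset_sub.
  by rewrite -natr_sum sum_full_weight // iM natrM mulrA; congr (_ * _); rewrite -natrM.
by rewrite finset.in_setD => /andP[eB eM]; rewrite full_weight0.
Qed.

(** By [exchange] the value at level [k + 1] is nearly the average after switching
    any of the bad edges, hence nearly their weighted mean, the total weight being
    [4 (k + 1)]; the weighted sum of the averages is then passed to level [k]. *)
Lemma level_lower k : (k < K)%N ->
  rate * \sum_(M in level d k) V k M - step_error k * (eps * O) * Om
  <= 4 * k.+1%:R * O * \sum_(M in level d k.+1) V k.+1 M.
Proof.
move=> kK; have OO := O0;
have /ler_normlP[h1 _] := level_sum_bound kK (fun M => value01 R A k M).
rewrite opprB in h1.
set s := slack R d conflict_bound k.
have s_ge0 : 0 <= s by apply: slack_ge0.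
have s_le : O * s <= 3 * k.+1%:R * (eps * O).
  rewrite /s /slack mulrCA (mulrC O) divfK ?lt0r_neq0 //.
  have -> : 3 * k.+1%:R * (eps * O) = k.+1%:R * (3 * (eps * O)) by ring.
  rewrite ler_wpM2l //.
  rewrite natrD natrM; have := small_const; have := small_conflict.
  have : 0 <= (D * D)%:R :> R by []. 
  lra.
have step : \sum_(M in level d k.+1) \sum_(p in oriented M) \sum_(q in partners M p)
       (weight M p q)%:R * V k (switch M p q) <=
    4 * k.+1%:R * O * \sum_(M in level d k.+1) V k.+1 M
     + 4 * k.+1%:R * (O * s) * Om.
  have -> : 4 * k.+1%:R * (O * s) * Om = \sum_(M in configurations d) 4 * k.+1%:R * (O * s).
    by rewrite sumr_const [LHS]mulr_natr.
  apply: (@le_trans _ _ (\sum_(M in level d k.+1) (4 * k.+1%:R * O * V k.+1 M + 4 * k.+1%:R * (O * s)))).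
    apply: ler_sum => M Ml; have /levelP[cM gM iM] := Ml.
    have badk : (#|badset M| <= 2 * k.+1)%N by rewrite -iM; apply: card_badset_items.
    have MK : (#|badset M| <= 2 * K + 4)%N.
      by apply: leq_trans badk _; apply: leq_trans (leq_addr _ _); rewrite leq_mul2l.
    rewrite -mulrA -mulrDr -mulrDr -(sum_full_weight_level Ml) mulr_suml.
    apply: ler_sum => p pM.
    apply: (@le_trans _ _ ((full_weight M (edge p))%:R * \sum_(q in partners M p) V k (switch M p q))).
      rewrite mulr_sumr; apply: ler_sum => q _; rewrite ler_wpM2r ?value_ge0 //.
      by rewrite ler_nat weight_le.
    have pM1 : edge p \in M by rewrite -mem_oriented.
    have [pB|pB] := boolP (edge p \in badset M); last first.
      by rewrite full_weight0 // !mul0r.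
    rewrite ler_wpM2l //.
    suff : avg (V k) M p - s <= V k.+1 M.
      rewrite /avg => le; have := ler_wpM2l (ltW OO) le.
      by rewrite mulrBr mulVKf ?lt0r_neq0 // mulrDr; lra.
    apply: le_value.
    - by rewrite has_badE; apply/set0Pn; exists (edge p).
    - have /andP[_] := avg01 cM pM (value01 R A k); lra.
    - by move=> r rM rB; apply: (exchange R few_not_good N2).
  rewrite big_split /=; apply: lerD; first by rewrite -mulr_sumr.
  rewrite big_mkcond [X in _ <= X]big_mkcond; apply: ler_sum => M _.
  case: ifP => [/levelP[cM _ _]|_]; first by rewrite inE cM.
  by case: ifP => // _; rewrite !mulr_ge0 // ltW.
have s_le2 : 4 * k.+1%:R * (O * s) * Om <= 12 * k.+1%:R ^+ 2 * (eps * O) * Om.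
  rewrite ler_wpM2r ?Om0 //; apply: (@le_trans _ _ (4 * k.+1%:R * (3 * k.+1%:R * (eps * O)))).
    by rewrite ler_wpM2l // mulr_ge0.
  by rewrite le_eqVlt; apply/orP; left; apply/eqP; ring.
have kO : 0 <= k%:R * (eps * O) * Om by rewrite !mulr_ge0 // ltW.
move: h1 step s_le2 kO; rewrite /step_error; set S := (2 * (2 * k + 4) * _)%:R; lra.
Qed.

(** The counterpart of [level_lower] for the constant function 1, in the opposite
    direction.  Here the weights have to be bounded from below, and the weight
    differs from its full version only when [q] is bad too. *)
Lemma level_upper k : (k < K)%N ->
  4 * k.+1%:R * O * #|level d k.+1|%:R <=
  rate * #|level d k|%:R + step_error k * (eps * O) * Om.
Proof.
move=> kK; have OO := O0.
have /ler_normlP[_ h1] := level_sum_bound kK (fun M => (ltac:(by rewrite ler01 lexx) : 0 <= (1 : R) <= 1)).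
rewrite sumr_const in h1.
have step : 4 * k.+1%:R * O * #|level d k.+1|%:R <=
   \sum_(M in level d k.+1) \sum_(p in oriented M) \sum_(q in partners M p)
       (weight M p q)%:R * 1 + 4 * k.+1%:R * (eps * O) * Om.
  have -> : 4 * k.+1%:R * (eps * O) * Om = \sum_(M in configurations d) 4 * k.+1%:R * (eps * O).
    by rewrite sumr_const [LHS]mulr_natr.
  apply: (@le_trans _ _ (\sum_(M in level d k.+1) (\sum_(p in oriented M) \sum_(q in partners M p)
       (weight M p q)%:R * 1 + 4 * k.+1%:R * (eps * O)))).
    rewrite mulr_natr -sumr_const; apply: ler_sum => M Ml; have /levelP[cM gM iM] := Ml.
    have badk : (#|badset M| <= 2 * k.+1)%N by rewrite -iM; apply: card_badset_items.
    rewrite -(sum_full_weight_level Ml) !mulr_suml -big_split /=; apply: ler_sum => p pM.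
    have pM1 : edge p \in M by rewrite -mem_oriented.
    rewrite -lerBlDl.
    have -> : (full_weight M (edge p))%:R * O = \sum_(q in partners M p) (full_weight M (edge p))%:R.
      by rewrite sumr_const card_partners // mulr_natr.
    rewrite -sumrB.
    apply: (@le_trans _ _ (\sum_(q in [set q in oriented M | edge q \in badset M])
      (full_weight M (edge p))%:R)).
      rewrite big_mkcond [X in _ <= X]big_mkcond; apply: ler_sum => q _.
      case: partnersP => [[qM qp]|_]; last by case: ifP.
      have -> : (q \in [set q in oriented M | edge q \in badset M]) = (edge q \in badset M).
        by rewrite inE qM.
      rewrite mulr1; case: ifPn => [_|qB]; first by rewrite lerBlDr lerDl.
      by rewrite weightE // ?subrr // -mem_oriented.
    rewrite sumr_const -[X in X <= _]mulr_natr ler_wpM2l //.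
    apply: le_trans small_conflict; rewrite ler_nat.
    apply: leq_trans (card_oriented_in cM _) _.
      by apply/subsetP => e; apply: badset_sub.
    rewrite /conflict_bound -addnA; apply: leq_trans (leq_addr (2 * D + 2 * D * D) (2 * (2 * K + 4))).
    rewrite leq_mul2l /=.
    by apply: leq_trans badk _; apply: leq_trans (leq_addr _ _); rewrite leq_mul2l.
  rewrite big_split /= lerD2l big_mkcond [X in _ <= X]big_mkcond; apply: ler_sum => M _.
  case: ifP => [/levelP[cM _ _]|_]; first by rewrite inE cM.
  by case: ifP => // _; rewrite !mulr_ge0 // ltW.
have e0 : 0 <= eps * O * Om by rewrite !mulr_ge0 // ltW.
have k4 : 4 * k.+1%:R * (eps * O) * Om <= 12 * k.+1%:R ^+ 2 * (eps * O) * Om.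
  have -> : 4 * k.+1%:R * (eps * O) * Om = 4 * k.+1%:R * (eps * O * Om) by ring.
  have -> : 12 * k.+1%:R ^+ 2 * (eps * O) * Om = 12 * k.+1%:R ^+ 2 * (eps * O * Om) by ring.
  apply: ler_wpM2r => //.
  have : 1 <= k.+1%:R :> R by rewrite ler1n.
  by move: (k.+1%:R) => z; nra.
have kO : 0 <= k%:R * (eps * O) * Om by rewrite !mulr_ge0 // ltW.
move: h1 step k4 kO; rewrite /step_error; set S := (2 * (2 * k + 4) * _)%:R; lra.
Qed.

(** The error accumulated in the comparison of a level with the target: one step
    multiplies the previous error by at most [Lam] and adds the errors of
    [level_lower] and [level_upper]. *)
Fixpoint level_error (k : nat) : R :=
  if k is k'.+1 then Lam * level_error k' + 2 * step_error k' else 0.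

Hypothesis base : \sum_(M in level d 0) V 0 M >= target * #|level d 0|%:R.

Lemma Lam_ge0 : 0 <= Lam.
Proof. by have := le_trans rate_ge0 rate_le; rewrite pmulr_lge0 ?O0. Qed.

Lemma step_error_ge0 k : 0 <= step_error k.
Proof. by rewrite /step_error !addr_ge0 ?mulr_ge0 ?exprn_ge0. Qed.

Lemma level_error_ge0 k : 0 <= level_error k.
Proof.
elim: k => [//|k IH] /=; by rewrite addr_ge0 // mulr_ge0 ?Lam_ge0 ?step_error_ge0.
Qed.

(** Multiplying [level_upper] by the target and subtracting it from [level_lower],
    the rates cancel: the deficit of a level is controlled by that of the previous
    one. *)
Lemma level_compare k : (k <= K)%N ->
  target * #|level d k|%:R - level_error k * eps * Om <= \sum_(M in level d k) V k M.
Proof.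
elim: k => [_|k IH kK]; first by rewrite /= !mul0r subr0.
have {}IH := IH (ltnW kK); have OO := O0; have OM := Om0.
have lo := level_lower kK; have up := level_upper kK.
set a := \sum_(M in level d k) _ in IH lo; set a' := \sum_(M in level d k.+1) _ in lo *.
set b := #|level d k|%:R in IH up; set b' := #|level d k.+1|%:R in up *.
have /andP[g0 g1] := target01.
set G := step_error k * (eps * O) * Om in lo up.
have G0 : 0 <= G by rewrite /G !mulr_ge0 ?step_error_ge0 // ltW.
have e1 : rate * (target * b - level_error k * eps * Om) <= rate * a by rewrite ler_wpM2l.
have e2 : target * (4 * k.+1%:R * O * b') <= target * (rate * b + G) by rewrite ler_wpM2l.
have e3 : target * G <= G by rewrite ler_piMl.
have e4 : rate * (level_error k * eps * Om) <= Lam * O * (level_error k * eps * Om).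
  by rewrite ler_wpM2r // !mulr_ge0 // level_error_ge0.
have kk : 0 < 4 * k.+1%:R * O by rewrite !mulr_gt0.
rewrite -(ler_pM2l kk).
have e5 : Lam * O * (level_error k * eps * Om) + 2 * G <= 4 * k.+1%:R * O * (level_error k.+1 * eps * Om).
  have -> : Lam * O * (level_error k * eps * Om) + 2 * G = 1 * (O * (level_error k.+1 * eps * Om)).
    by rewrite /G /=; ring.
  rewrite -[X in _ <= X]mulrA; apply: ler_wpM2r.
    apply: mulr_ge0; first exact: ltW.
    by apply: mulr_ge0 => //; apply: mulr_ge0 => //; exact: level_error_ge0.
  have : 1 <= k.+1%:R :> R by rewrite ler1n.
  lra.
rewrite mulrBr; move: e1 e2 e3 e4 e5 lo; rewrite mulrBr !mulrDr; lra.
Qed.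

(** The levels are disjoint. *)
Lemma sum_levels (phi : {set {set H}} -> R) : (forall M, 0 <= phi M) ->
  \sum_(k < K.+1) \sum_(M in level d k) phi M <= \sum_(M in configurations d) phi M.
Proof.
move=> phi0; rewrite (eq_bigr (fun k : 'I_K.+1 =>
   \sum_(M in configurations d) if M \in level d k then phi M else 0)) => [|k _].
  rewrite exchange_big /=; apply: ler_sum => M _; rewrite -big_mkcond /=.
  have [iK|iK] := ltnP (items M) K.+1; last first.
    rewrite big1 ?phi0 // => k /levelP[_ _ E]; have := ltn_ord k.
    by rewrite -E ltnNge iK.
  rewrite (eq_bigl (fun k : 'I_K.+1 => (M \in level d k) && (k == Ordinal iK))) => [|k].
    apply: (@le_trans _ _ (\sum_(k < K.+1 | k == Ordinal iK) phi M)); last by rewrite big_pred1_eq.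
    rewrite big_mkcond [X in _ <= X]big_mkcond; apply: ler_sum => k _.
    by case: (M \in _) => //=; case: ifP.
  case: levelP => //= -[_ _ E]; apply/esym/eqP/val_inj => /=; by rewrite E.
rewrite big_mkcond [RHS]big_mkcond; apply: eq_bigr => M _.
by case: levelP => [[cM _ _]|_]; rewrite ?inE ?cM ?if_same.
Qed.

(** Markov's inequality for the number of bad edges, which is at least the number of
    items. *)
Lemma card_levels : Om <= \sum_(k < K.+1) #|level d k|%:R
  + #|[set M in configurations d | ~~ generic M]|%:R
  + \sum_(M in configurations d) #|badset M|%:R / K.+1%:R.
Proof.
have -> : \sum_(k < K.+1) #|level d k|%:R = \sum_(M in configurations d)
     \sum_(k < K.+1) (M \in level d k)%:R :> R.
  rewrite exchange_big /=; apply: eq_bigr => k _; rewrite -sum1_card natr_sum.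
  rewrite big_mkcond [RHS]big_mkcond; apply: eq_bigr => M _.
  by case: levelP => [[cM _ _]|_]; rewrite ?inE ?cM ?if_same.
have -> : #|[set M in configurations d | ~~ generic M]|%:R =
    \sum_(M in configurations d) (~~ generic M)%:R :> R.
  rewrite -sum1_card natr_sum big_mkcond [RHS]big_mkcond; apply: eq_bigr => M _.
  by rewrite inE; case: (M \in _); case: (generic M).
rewrite -!big_split /= -sum1_card natr_sum; apply: ler_sum => M; rewrite inE => cM.
have s0 : 0 <= \sum_(k < K.+1) (M \in level d k)%:R :> R by apply: sumr_ge0.
have b0 : 0 <= #|badset M|%:R / K.+1%:R :> R by rewrite divr_ge0.
have [gM|gM] := boolP (generic M); last first.
  by apply: (le_trans _ (lerD (lerD s0 (lexx _)) b0)); rewrite add0r addr0.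
rewrite /= ?mulr0n addr0; have [iK|iK] := ltnP (items M) K.+1.
  rewrite (bigD1 (Ordinal iK)) //=.
  have -> : M \in level d (items M) by apply/levelP.
  by rewrite -addrA lerDl addr_ge0 // sumr_ge0.
have : 1 <= #|badset M|%:R / K.+1%:R :> R.
  by rewrite ler_pdivlMr // mul1r ler_nat (leq_trans iK) // items_le_badset.
by move=> h; apply: le_trans h _; rewrite lerDr.
Qed.

Lemma value_lower_bound :
  target * (Om - #|[set M in configurations d | ~~ generic M]|%:R
     - \sum_(M in configurations d) #|badset M|%:R / K.+1%:R)
  - (\sum_(k < K.+1) level_error k) * eps * Om <= \sum_(M in configurations d) V K M.
Proof.
have /andP[g0 g1] := target01.
apply: le_trans (sum_levels (value_ge0 R A K)).
apply: (@le_trans _ _ (\sum_(k < K.+1) (target * #|level d k|%:R - level_error k * eps * Om))).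
  rewrite sumrB -mulr_sumr -!mulr_suml lerD2r ler_wpM2l //.
  rewrite !lerBlDr addrAC mulr_suml; exact: card_levels.
apply: ler_sum => k _; apply: le_trans (level_compare (ltn_ord k)) _.
apply: ler_sum => M /levelP[cM _ _].
have mono t : V k M <= V (k + t)%N M.
  by elim: t => [|t IH]; rewrite ?addn0 // addnS (le_trans IH) // value_mono.
have kK : (k <= K)%N := ltn_ord k.
by have := mono (K - k)%N; rewrite subnKC.
Qed.

End LevelInduction.

(** * The projection of a simple configuration is uniform *)

Section Fibres.
Variables (R : realType) (n : nat) (d : 'I_n -> nat).
Notation H := (half_edge d).
Implicit Types (M : {set {set H}}) (e f : {set H}) (p q r : H * H) (h : H).
Implicit Types (G : {set {set 'I_n}}).

Definition simple M : bool := configuration M && ~~ has_bad M.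

Lemma simple_ends_inj M e f : simple M -> e \in M -> f \in M -> ends e = ends f -> e = f.
Proof.
move=> /andP[cM nb] eM fM E; apply/eqP/negPn/negP => ef; case/negP: nb.
rewrite has_badE; apply/set0Pn; exists f; exact: (badset_parallel fM eM ef E).
Qed.

Lemma simple_nloop M e : simple M -> e \in M -> ~~ loop e.
Proof.
move=> /andP[cM nb] eM; apply: contraNN nb => le.
by rewrite has_badE; apply/set0Pn; exists e; apply: badset_loop.
Qed.

Lemma simple_oriented M p q : simple M -> p \in oriented M -> q \in oriented M ->
  tag p.1 = tag q.1 -> ends (edge p) = ends (edge q) -> p = q.
Proof.
move=> sM pM qM T E; have [pM1 qM1] : edge p \in M /\ edge q \in M by rewrite -!mem_oriented.
have /eqP/edge_eqP[//|Ef] := simple_ends_inj sM pM1 qM1 E.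
by have := simple_nloop sM qM1; rewrite loop_edge -T Ef eqxx.
Qed.

(** Without loops and parallel edges, the edges of the projection at [i] correspond
    to the half-edges at [i]. *)
Lemma project_graph M : simple M -> project M \in graphs d.
Proof.
move=> sM; have /andP[cM nb] := sM; rewrite inE; apply/andP; split.
  apply/forall_inP => x /imsetP[e eM ->]; have := simple_nloop sM eM.
  have [p pM Ep] := edge_orient cM eM; rewrite Ep loop_edge ends_edge cards2.
  by case: (_ == _).
apply/forallP => i; apply/eqP; rewrite /degree.
have -> : [set e in project M | i \in e] =
    [set ends (edge p) | p in [set p in oriented M | tag p.1 == i]].
  apply/setP => x; rewrite inE; apply/andP/imsetP.
    move=> [/imsetP[e eM ->]]; have [p pM Ep] := edge_orient cM eM; subst e.
    rewrite ends_tag in_edge /= => /orP[]/eqP E.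
      by exists p; rewrite ?ends_tag // inE pM E eqxx.
    exists (flip p); last by rewrite edge_flip ends_tag.
    by rewrite inE flip_oriented pM E eqxx.
  move=> [p]; rewrite inE => /andP[pM /eqP Ti] ->; split.
    by apply: imset_f; rewrite -mem_oriented.
  by rewrite ends_tag in_edge /= Ti eqxx.
rewrite card_in_imset; last first.
  move=> p q; rewrite !inE => /andP[pM /eqP Tp] /andP[qM /eqP Tq] E.
  rewrite -!mem_oriented in pM qM.
  by apply: (simple_oriented sM pM qM) => //; rewrite Tp Tq.
rewrite -(sum_tag d i) -(sum_oriented_fst (fun h => (tag h == i) : nat) cM).
rewrite -sum1_card big_mkcond [RHS]big_mkcond; apply: eq_bigr => p _.
by rewrite [p \in [set _ in _ | _]]inE mem_oriented; case: (_ \in M); case: (_ == i).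
Qed.

Definition tag_perms : {set {perm H}} := [set s : {perm H} | [forall h, tag (s h) == tag h]].

Lemma tag_permsP (s : {perm H}) : reflect (forall h, tag (s h) = tag h) (s \in tag_perms).
Proof. by rewrite inE; apply: forallPP => h; apply: eqP. Qed.

Lemma relabel_simple (s : {perm H}) M : s \in tag_perms -> simple M -> simple (relabel s M).
Proof.
move=> /tag_permsP sT /andP[cM nb]; rewrite /simple relabel_conf //.
by rewrite has_bad_relabel.
Qed.

(** In a simple configuration a half-edge is determined by its vertex and the ends of
    its edge, both of which the relabelling preserves. *)
Lemma relabel_free M (s t : {perm H}) : simple M -> s \in tag_perms -> t \in tag_perms ->
  relabel s M = relabel t M -> s = t.
Proof.
move=> sM sP tP E; have /andP[cM nb] := sM.
have [sT tT] := (tag_permsP _ sP, tag_permsP _ tP).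
apply/permP => h; have [p pM <-] := orient_at h cM.
have sM' := relabel_simple tP sM.
have h1 : pairm s p \in oriented (relabel t M) by rewrite -E oriented_relabel.
have h2 : pairm t p \in oriented (relabel t M) by rewrite oriented_relabel.
have := simple_oriented sM' h1 h2; rewrite !edge_pairm !ends_relabel //= sT tT.
by move=> /(_ erefl erefl) [].
Qed.

(** The relabelling sends a half-edge of [M] to the one in [M'] at the same vertex
    whose edge has the same ends. *)
Lemma relabel_transitive M M' : simple M -> simple M' -> project M = project M' ->
  exists2 s, s \in tag_perms & relabel s M = M'.
Proof.
move=> sM sM' E; have /andP[cM nb] := sM; have /andP[cM' nb'] := sM'.
have corr h : exists h', exists2 q, q \in oriented M' & q.1 = h' /\ tag h' = tag h /\
    exists2 p, p \in oriented M & p.1 = h /\ ends (edge q) = ends (edge p).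
  have [p pM ph] := orient_at h cM.
  have : ends (edge p) \in project M' by rewrite -E; apply: imset_f; rewrite -mem_oriented.
  move=> /imsetP[f fM' Ef]; have [q qM' [Eq /andP[/eqP T _]]] := ends_orient cM' fM' (esym Ef).
  exists q.1; exists q => //; split=> //; split; first by rewrite T ph.
  by exists p => //; split=> //; rewrite -Eq.
(* Injectivity: the half-edge is recovered from its vertex and the ends of its edge. *)
have [F FP] := choice corr.
have F_inj : injective F.
  move=> h1 h2 EF; have [q1 q1M [e1 [t1 [p1 p1M [ph1 E1]]]]] := FP h1.
  have [q2 q2M [e2 [t2 [p2 p2M [ph2 E2]]]]] := FP h2.
  have q12 : q1 = q2 by apply: (oriented_fst_inj cM') => //; rewrite e1 e2.
  rewrite -ph1 -ph2; congr fst; apply: (simple_oriented sM p1M p2M).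
    by rewrite ph1 ph2 -t1 -t2 EF.
  by rewrite -E1 -E2 q12.
pose s := perm F_inj.
have sP : s \in tag_perms.
  by apply/tag_permsP => h; rewrite permE; have [q _ [_ []]] := FP h.
exists s => //.
have sub e : e \in relabel s M -> e \in M'.
  move=> /relabelP[f fM ->]; have [p pM Ep] := edge_orient cM fM; subst f.
  rewrite -edge_pairm; have [q qM [e1 [t1 [r rM [rh Er]]]]] := FP p.1.
  have rp : r = p by apply: (oriented_fst_inj cM).
  have [q' q'M [e2 [t2 [r' r'M [r'h Er']]]]] := FP p.2.
  have r'p : r' = flip p by apply: (oriented_fst_inj cM) => //; rewrite flip_oriented.
  rewrite rp in Er; rewrite r'p edge_flip in Er'.
  suff Eq : q' = flip q.
    suff -> : pairm s p = q by rewrite -mem_oriented.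
    rewrite /pairm !permE -e1 -e2 Eq /=; by case: (q).
  have [q1M q'1M] : edge q \in M' /\ edge q' \in M' by rewrite -!mem_oriented.
  have /eqP/edge_eqP[Eq|//] : edge q' = edge q.
    by apply: (simple_ends_inj sM') => //; rewrite Er Er'.
  have := simple_nloop sM fM; rewrite loop_edge -t1 -t2 -e1 -e2 Eq eqxx.
  by [].
apply/setP => e; apply/idP/idP; first exact: sub.
move=> eM'; have [q qM' Eq] := edge_orient cM' eM'; subst e.
have [e2 cov tr] := configurationP _ (relabel_conf s cM).
have [f fR hf] := cov q.1; have [_ _ tr'] := configurationP _ cM'.
by rewrite (tr' (edge q) f q.1) // ?sub // in_edge eqxx.
Qed.

Lemma graph_edge G (e : {set 'I_n}) : G \in graphs d -> e \in G -> #|e| = 2%N.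
Proof. by rewrite inE => /andP[/forall_inP sG _] /sG/eqP. Qed.

(** Let the [a]-th half-edge at [i] stand for the [a]-th edge of the graph at [i], and
    match the half-edges that stand for the same edge. *)
Lemma exists_simple G : G \in graphs d -> exists2 M, simple M & project M = G.
Proof.
move=> GG; have := GG; rewrite inE => /andP[_ /forallP deg].
pose at_ (i : 'I_n) := [set e in G | i \in e].
have card_at i : #|at_ i| = d i by have /eqP := deg i.
(* The default of [nth] is never reached, there being [d i] edges at [i]. *)
pose phi (h : H) : {set 'I_n} := nth finset.set0 (enum (at_ (tag h))) (tagged h).
have phi_in h : phi h \in at_ (tag h).
  by rewrite -mem_enum mem_nth // -cardE card_at.
have phi_at i (e : {set 'I_n}) : e \in at_ i -> exists2 h, tag h = i & phi h = e.
  move=> ei; have lt : (index e (enum (at_ i)) < d i)%N.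
    by rewrite -(card_at i) cardE index_mem mem_enum.
  exists (Tagged (fun i => 'I_(d i)) (Ordinal lt)) => //.
  by rewrite /phi /= nth_index // mem_enum.
have phi_inj h h' : tag h = tag h' -> phi h = phi h' -> h = h'.
  case: h h' => i a [j b] /= ij; subst j; rewrite /phi /= => /eqP.
  rewrite nth_uniq -?cardE ?card_at ?enum_uniq // => /eqP ab.
  by congr existT; apply: val_inj.
pose cl (e : {set 'I_n}) := [set h : H | phi h == e].
have cl2 (e : {set 'I_n}) : e \in G ->
    exists p : H * H, [/\ cl e = edge p, tag p.1 != tag p.2 & e = edge (tag p.1, tag p.2)].
  move=> eG; have /eqP/cards2P[i [j [ij Ee]]] := graph_edge GG eG.
  have [h hi hp] : exists2 h, tag h = i & phi h = e.
    by apply: phi_at; rewrite inE eG Ee !inE eqxx.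
  have [k kj kp] : exists2 h, tag h = j & phi h = e.
    by apply: phi_at; rewrite inE eG Ee !inE eqxx orbT.
  exists (h, k); rewrite /= hi kj; split=> //.
  apply/setP => x; rewrite inE in_edge /=; apply/eqP/orP => [xe|[]/eqP -> //].
  have : tag x \in e by have := phi_in x; rewrite inE xe => /andP[].
  rewrite Ee !inE => /orP[]/eqP T; [left|right]; apply/eqP; apply: phi_inj; by rewrite ?T ?xe ?hp ?kp.
have cl_ends (e : {set 'I_n}) : e \in G -> ends (cl e) = e.
  by move=> /cl2[p [-> _ ->]]; rewrite ends_tag.
pose M := [set cl e | e in G].
have cM : configuration M.
  apply/configurationP; split.
  - move=> x /imsetP[e /cl2[p [-> tp _]] ->]; rewrite cards2.
    by have -> : p.1 != p.2 by apply: contraNneq tp => ->.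
  - move=> h; exists (cl (phi h)); last by rewrite inE.
    by apply: imset_f; have := phi_in h; rewrite inE => /andP[].
  - move=> x y h /imsetP[e eG ->] /imsetP[f fG ->].
    by rewrite !inE => /eqP -> /eqP ->.
exists M; last first.
  rewrite /project /M -imset_comp -[RHS]imset_id; apply: eq_in_imset => e eG /=.
  exact: cl_ends.
rewrite /simple cM has_badE negbK; apply/eqP/setP => x; rewrite finset.in_set0.
apply/negP => /badsetP[/imsetP[e eG ->]].
have [p [Ep tp _]] := cl2 e eG; case=> [|[y [/imsetP[f fG ->] fe]]].
  by rewrite Ep loop_edge (negPf tp).
by rewrite !cl_ends // => E; rewrite E eqxx in fe.
Qed.

(** The fibre is a single free orbit of [tag_perms], by [relabel_free] and
    [relabel_transitive]. *)
Lemma card_fibre G : G \in graphs d ->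
  #|[set M | simple M && (project M == G)]| = #|tag_perms|.
Proof.
move=> /exists_simple[M0 sM0 E0].
rewrite -(card_in_imset (f := fun s => relabel s M0)); last first.
  by move=> s t sP tP; apply: relabel_free.
apply: eq_card => M; rewrite inE; apply/andP/imsetP.
  move=> [sM /eqP E]; have [s sP Es] : exists2 s, s \in tag_perms & relabel s M0 = M.
    by apply: relabel_transitive; rewrite ?E0 ?E.
  by exists s.
move=> [s sP ->]; split; first exact: relabel_simple.
by rewrite project_relabel ?E0 //; apply/tag_permsP.
Qed.

Lemma sum_simple (F : {set {set 'I_n}} -> R) :
  \sum_(M | simple M) F (project M) = #|tag_perms|%:R * \sum_(G in graphs d) F G.
Proof.
rewrite (partition_big (@project n d) (mem (graphs d))) /=; last exact: project_graph.
rewrite mulr_sumr; apply: eq_bigr => G GG.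
rewrite (eq_bigr (fun=> F G)) => [|M /andP[_ /eqP -> //]].
rewrite sumr_const [RHS]mulr_natl; congr (_ *+ _); rewrite -(card_fibre GG).
by apply: eq_card => M; rewrite [RHS]inE.
Qed.

Lemma level0E M : (M \in level d 0) = simple M.
Proof.
rewrite /simple has_badE negbK; apply/levelP/andP => [[cM _ /eqP]|[cM /eqP B0]].
  by rewrite cards_eq0 imset_eq0.
split=> //; last by rewrite /items B0 imset0 cards0.
apply/genericP => e f eM fM fe E.
by have := badset_parallel eM fM fe E; rewrite B0 finset.in_set0.
Qed.

Lemma mass_uniform (S A : {set {set {set 'I_n}}}) :
  mass (uniform_law R S) A = #|S|%:R^-1 * #|A :&: S|%:R.
Proof.
rewrite /mass /uniform_law -big_mkcondr sumr_const [RHS]mulr_natr; congr (_ *+ _).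
by apply: eq_card => x; rewrite inE.
Qed.

Lemma value_level0 (A : {set {set {set 'I_n}}}) : graphic d ->
  mass (uniform_law R (graphs d)) A * #|level d 0|%:R <= \sum_(M in level d 0) value R A 0 M.
Proof.
move=> [G0 G0P].
have -> : \sum_(M in level d 0) value R A 0 M = #|tag_perms|%:R * #|A :&: graphs d|%:R.
  rewrite (eq_bigl _ _ level0E) (eq_bigr (fun M => (project M \in A)%:R)) => [|M /andP[_ nb]].
    rewrite (sum_simple (fun G => (G \in A)%:R)); congr (_ * _).
    rewrite -sum1_card natr_sum big_mkcond [RHS]big_mkcond; apply: eq_bigr => G _.
    by rewrite finset.in_setI andbC; case: (G \in graphs d); case: (G \in A).
  by rewrite value_stop.
have -> : #|level d 0|%:R = #|tag_perms|%:R * #|graphs d|%:R :> R.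
  rewrite -sum1_card natr_sum (eq_bigl _ _ level0E) (sum_simple (fun=> 1)).
  by rewrite sumr_const.
have g0 : #|graphs d|%:R != 0 :> R.
  by rewrite pnatr_eq0 -lt0n; apply/card_gt0P; exists G0.
by rewrite mass_uniform mulrCA mulrAC mulVf // mul1r.
Qed.

End Fibres.

(** * From one run to the switched law *)

Arguments value : simpl never.

Section Process.
Variables (R : realType) (n : nat) (d : 'I_n -> nat).
Notation H := (half_edge d).
Implicit Types (M : {set {set H}}) (p q : H * H) (phi : {set {set H}} -> R).
Variable rule : {set {set H}} -> H * H -> R.
Hypothesis rule_ok : selection_rule rule.

Lemma double_card M : configuration M -> #|{: H}| = (2 * #|M|)%N.
Proof.
move=> cM; apply/eqP; rewrite -(eqr_nat R) -(card_oriented cM) natrM -!sum1_card !natr_sum.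
by rewrite (sum_oriented_edge (fun=> 1)).
Qed.

Lemma rule_oriented M p : configuration M -> has_bad M -> rule M p != 0 ->
  (p \in oriented M) && (edge p \in badset M).
Proof.
move=> cM hb; have [_ _ /(_ p) rb] := rule_ok cM hb => /rb b.
by rewrite mem_oriented inE b andbT; case/andP: b.
Qed.

Lemma transition_avg phi M : configuration M -> has_bad M ->
  \sum_M' transition rule M M' * phi M' = \sum_p rule M p * avg phi M p.
Proof.
move=> cM hb; rewrite /transition hb.
under eq_bigr => M' _ do rewrite mulr_suml.
rewrite exchange_big /=; apply: eq_bigr => p _.
have [->|rp] := eqVneq (rule M p) 0; first by rewrite mul0r big1 // => M' _; rewrite !mul0r.
have /andP[pM _] := rule_oriented cM hb rp.
under eq_bigr => M' _ do rewrite -mulrA.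
rewrite -mulr_sumr; congr (_ * _).
have -> : \sum_M' (\sum_(f in M :\ edge p) (#|M|.-1)%:R^-1 *
     \sum_(q : H * H | [set q.1; q.2] == f) 2^-1 * (M' == switch M p q)%:R) * phi M' =
   \sum_(f in M :\ edge p) \sum_(q | edge q == f) (#|M|.-1)%:R^-1 * 2^-1 * phi (switch M p q).
  under eq_bigr => M' _ do rewrite mulr_suml.
  rewrite exchange_big /=; apply: eq_bigr => f _.
  under eq_bigr => M' _ do rewrite mulr_sumr mulr_suml.
  rewrite exchange_big /=; apply: eq_bigr => q _.
  rewrite (bigD1 (switch M p q)) //= eqxx big1 ?addr0 ?mulr1 // => M' /negPf ->.
  by rewrite !mulr0 mul0r.
have -> : avg phi M p = \sum_(q in partners M p) (#|M|.-1)%:R^-1 * 2^-1 * phi (switch M p q).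
  rewrite /avg mulr_sumr; apply: eq_bigr => q _; congr (_ * _).
  by rewrite -invfM -natrM (double_card cM); congr (_%:R^-1); lia.
rewrite [RHS](partition_big (@edge H) (mem (M :\ edge p))) /=; last first.
  by move=> q /partnersP[qM qp]; rewrite finset.in_setD1 qp -mem_oriented.
apply: eq_bigr => f; rewrite finset.in_setD1 => /andP[fp fM]; apply: eq_bigl => q.
case: eqP => [E|]; last by rewrite andbF.
by rewrite andbT; apply/esym/partnersP; rewrite mem_oriented E.
Qed.

Lemma transition_stop M M' : ~~ has_bad M -> transition rule M M' = (M' == M)%:R.
Proof. by rewrite /transition => /negPf ->. Qed.

Lemma transition_ge0 M M' : configuration M -> 0 <= transition rule M M'.
Proof.
move=> cM; rewrite /transition; case: ifP => // hb; have [r0 _ _] := rule_ok cM hb.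
apply: sumr_ge0 => p _; rewrite mulr_ge0 //; apply: sumr_ge0 => f _.
by rewrite mulr_ge0 ?invr_ge0 //; apply: sumr_ge0 => q _; rewrite mulr_ge0 ?invr_ge0.
Qed.

Lemma transition_conf M M' : configuration M -> ~~ configuration M' ->
  transition rule M M' = 0.
Proof.
move=> cM cM'; rewrite /transition; case: ifP => hb; last first.
  by case: eqP => // E; rewrite E cM in cM'.
rewrite big1 // => p _; have [->|rp] := eqVneq (rule M p) 0; first by rewrite mul0r.
have /andP[pM _] := rule_oriented cM hb rp.
rewrite big1 ?mulr0 // => f; rewrite finset.in_setD1 => /andP[fp fM].
rewrite big1 ?mulr0 // => q /eqP Eq; case: eqP => [E|]; last by rewrite mulr0.
case/negP: cM'; rewrite E; apply: switch_conf => //.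
  by rewrite mem_oriented -[edge q]/([set q.1; q.2]) Eq.
by rewrite -[edge q]/([set q.1; q.2]) Eq eq_sym.
Qed.

Lemma transition_sum M : configuration M -> \sum_M' transition rule M M' <= 1.
Proof.
move=> cM; have [hb|hb] := boolP (has_bad M); last first.
  rewrite (bigD1 M) //= transition_stop // eqxx big1 ?addr0 // => M' /negPf NM.
  by rewrite transition_stop // NM.
have := transition_avg (fun=> 1) cM hb; under eq_bigr do rewrite mulr1.
move=> ->; have [r0 r1 _] := rule_ok cM hb; rewrite -[X in _ <= X]r1; apply: ler_sum => p _.
have [->|rp] := eqVneq (rule M p) 0; first by rewrite mul0r.
have /andP[pM _] := rule_oriented cM hb rp.
rewrite ler_piMr //; have /andP[//] := avg01 cM pM (phi := fun=> 1 : R) (fun _ => ltac:(by rewrite ler01 lexx)).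
Qed.

Lemma transition_value A t M : configuration M ->
  value R A t.+1 M <= \sum_M' transition rule M M' * value R A t M'.
Proof.
move=> cM; have [hb|hb] := boolP (has_bad M); last first.
  rewrite (bigD1 M) //= transition_stop // eqxx mul1r !value_stop // lerDl.
  by apply: sumr_ge0 => M' _; rewrite mulr_ge0 ?value_ge0 ?transition_ge0.
rewrite transition_avg //; have [r0 r1 _] := rule_ok cM hb.
rewrite -[X in X <= _]mul1r -r1 mulr_suml; apply: ler_sum => p _.
have [->|rp] := eqVneq (rule M p) 0; first by rewrite !mul0r.
have /andP[pM pB] := rule_oriented cM hb rp.
by rewrite ler_wpM2l //; apply: value_step.
Qed.

Lemma run_law_conf t M : ~~ configuration M -> run_law rule t M = 0.
Proof.
elim: t M => [|t IH] M cM /=.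
  by rewrite /uniform_law inE (negPf cM).
rewrite big1 // => M0 _; have [cM0|cM0] := boolP (configuration M0).
  by rewrite transition_conf ?mulr0.
by rewrite IH ?mul0r.
Qed.

Lemma run_law_ge0 t M : 0 <= run_law rule t M.
Proof.
elim: t M => [|t IH] M /=; first by rewrite /uniform_law; case: ifP => //; rewrite invr_ge0.
apply: sumr_ge0 => M0 _; have [cM0|cM0] := boolP (configuration M0).
  by rewrite mulr_ge0 ?transition_ge0.
by rewrite run_law_conf ?mul0r.
Qed.

Lemma run_law_step t phi : \sum_M run_law rule t.+1 M * phi M =
  \sum_M run_law rule t M * \sum_M' transition rule M M' * phi M'.
Proof.
under [RHS]eq_bigr => M _ do rewrite mulr_sumr.
rewrite [RHS]exchange_big /=; apply: eq_bigr => M _; rewrite mulr_suml.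
by apply: eq_bigr => M0 _; rewrite mulrA.
Qed.

Lemma run_law_sum t : \sum_M run_law rule t M <= 1.
Proof.
elim: t => [|t IH].
  rewrite /= /uniform_law -big_mkcond sumr_const -[_ *+ _]mulr_natr.
  have [->|N0] := posnP #|configurations d|; first by rewrite mulr0.
  by rewrite mulVf // pnatr_eq0 -lt0n.
have := run_law_step t (fun=> 1); under eq_bigr do rewrite mulr1.
move=> ->; apply: le_trans IH; apply: ler_sum => M _.
have [cM|cM] := boolP (configuration M); last by rewrite run_law_conf ?mul0r.
rewrite ler_piMr ?run_law_ge0 //; under eq_bigr do rewrite mulr1.
exact: transition_sum.
Qed.

(** One step of the actual process does at least as well as the worst choice, so the
    expected value of the remaining [t + s] steps can only increase. *)
Lemma run_value A t s :
  \sum_M run_law rule 0 M * value R A (t + s) M <= \sum_M run_law rule t M * value R A s M.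
Proof.
elim: t s => [|t IH] s //; rewrite addSnnS; apply: le_trans (IH s.+1) _.
rewrite run_law_step; apply: ler_sum => M _.
have [cM|cM] := boolP (configuration M); last by rewrite run_law_conf ?mul0r.
by rewrite ler_wpM2l ?run_law_ge0 // transition_value.
Qed.

Definition stopped_at t (G : {set {set 'I_n}}) : R :=
  \sum_(M | ~~ has_bad M && (project M == G)) run_law rule t M.

Lemma run_law_absorb t M : ~~ has_bad M -> run_law rule t M <= run_law rule t.+1 M.
Proof.
move=> nb /=; rewrite (bigD1 M) //= transition_stop // eqxx mulr1 lerDl.
apply: sumr_ge0 => M0 _; have [cM0|cM0] := boolP (configuration M0).
  by rewrite mulr_ge0 ?transition_ge0 ?run_law_ge0.
by rewrite run_law_conf ?mul0r.
Qed.

Lemma stopped_at_sum t (P : pred {set {set 'I_n}}) :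
  \sum_(G | P G) stopped_at t G = \sum_(M | ~~ has_bad M && P (project M)) run_law rule t M.
Proof.
rewrite /stopped_at [RHS](partition_big (@project n d) P) /=; last by move=> M /andP[].
apply: eq_bigr => G PG; apply: eq_bigl => M.
by case: eqP => [->|_]; rewrite ?PG ?andbF ?andbT.
Qed.

Lemma stopped_at_le1 t (P : pred {set {set 'I_n}}) : \sum_(G | P G) stopped_at t G <= 1.
Proof.
rewrite stopped_at_sum; apply: le_trans (run_law_sum t).
rewrite big_mkcond; apply: ler_sum => M _; case: ifP => // _; exact: run_law_ge0.
Qed.

Lemma stopped_at_ge0 t G : 0 <= stopped_at t G.
Proof. by apply: sumr_ge0 => M _; apply: run_law_ge0. Qed.

(** Configurations without bad edges are absorbing. *)
Lemma stopped_at_mono G : {homo (fun t => stopped_at t G) : s t / (s <= t)%N >-> s <= t}.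
Proof.
apply: homo_leq => [//|r s t|t]; first exact: le_trans.
by apply: ler_sum => M /andP[nb _]; apply: run_law_absorb.
Qed.

Lemma stopped_at_cvg G : cvgn (fun t => stopped_at t G).
Proof.
apply: nondecreasing_is_cvgn; first exact: stopped_at_mono.
exists 1 => _ [t _ <-]; have := stopped_at_le1 t (pred1 G).
by rewrite big_pred1_eq.
Qed.

Lemma terminal_lawE G : terminal_law rule G = limn (fun t => stopped_at t G).
Proof. by []. Qed.

Lemma stopped_at_le t G : stopped_at t G <= terminal_law rule G.
Proof.
rewrite terminal_lawE; apply: (nondecreasing_cvgn_le (u_ := fun t => stopped_at t G)).
  exact: stopped_at_mono.
exact: stopped_at_cvg.
Qed.

Lemma cvg_sumn (I : Type) (r : seq I) (u : I -> nat -> R) (l : I -> R) :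
  (forall i, (u i @ \oo --> l i)%classic) ->
  ((fun t => \sum_(i <- r) u i t) @ \oo --> \sum_(i <- r) l i)%classic.
Proof.
move=> ul; elim: r => [|i r IH].
  rewrite big_nil; under eq_fun => t do rewrite big_nil; exact: cvg_cst.
rewrite big_cons; under eq_fun => t do rewrite big_cons; exact: cvgD.
Qed.

Lemma termination_le1 : termination_probability rule <= 1.
Proof.
have cv := cvg_sumn (r := index_enum _) (fun G => @stopped_at_cvg G).
rewrite /termination_probability.
have -> : \sum_G terminal_law rule G = limn (fun t => \sum_G stopped_at t G).
  by apply/esym/cvg_lim => //; exact: cv.
apply: limr_le; first by apply: cvgP; exact: cv.
by apply: nearW => t; apply: stopped_at_le1.
Qed.

Lemma terminal_ge0 G : 0 <= terminal_law rule G.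
Proof. exact: le_trans (stopped_at_ge0 0 G) (stopped_at_le 0 G). Qed.

Hypothesis d_graphic : graphic d.

Lemma configurations_gt0 : (0 < #|configurations d|)%N.
Proof.
have [G /exists_simple[M /andP[cM _] _]] := d_graphic.
by apply/card_gt0P; exists M; rewrite inE.
Qed.

(** A run may start at a simple configuration. *)
Lemma termination_gt0 : 0 < termination_probability rule.
Proof.
have [G GG] := d_graphic; have [M /andP[cM nb] E] := exists_simple GG.
apply: (@lt_le_trans _ _ (stopped_at 0 G)).
  rewrite /stopped_at (bigD1 M) /= ?nb ?E ?eqxx //; apply: ltr_wpDr.
    by apply: sumr_ge0 => M' _; exact: (run_law_ge0 0 M').
  by rewrite /uniform_law inE cM invr_gt0 ltr0n configurations_gt0.
apply: le_trans (stopped_at_le 0 G) _; rewrite /termination_probability (bigD1 G) //= lerDl.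
by apply: sumr_ge0 => G' _; apply: terminal_ge0.
Qed.

(** The restarts form a geometric series: the law is that of one run conditioned on
    its termination. *)
Lemma switched_lawE G :
  switched_law rule G = terminal_law rule G / termination_probability rule.
Proof.
have T0 := termination_gt0; have T1 := termination_le1.
set T := termination_probability rule in T0 T1 *.
apply/cvg_lim => //.
have z1 : `|1 - T| < 1 by rewrite ger0_norm ?subr_ge0 // ltrBlDr ltrDl.
have := @cvg_geometric_series R (terminal_law rule G) (1 - T) z1.
rewrite subKr => cv; apply: cvg_trans cv; apply: near_eq_cvg; apply: nearW => t.
by rewrite /series /=; apply: eq_bigr => r _; rewrite mulrC.
Qed.

Lemma switched_ge G : terminal_law rule G <= switched_law rule G.
Proof.
by rewrite switched_lawE ler_pdivlMr ?termination_gt0 // ler_piMr ?terminal_ge0 ?termination_le1.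
Qed.

Lemma switched_sum : \sum_G switched_law rule G = 1.
Proof.
under eq_bigr => G _ do rewrite switched_lawE.
by rewrite -mulr_suml mulfV // lt0r_neq0 // termination_gt0.
Qed.

Lemma switched_ge0 G : 0 <= switched_law rule G.
Proof. exact: le_trans (terminal_ge0 G) (switched_ge G). Qed.

Lemma mass_switched_ge t (A : {set {set {set 'I_n}}}) :
  #|configurations d|%:R^-1 * (\sum_(M in configurations d) value R A t M) <=
  mass (switched_law rule) A.
Proof.
apply: (@le_trans _ _ (\sum_(G in A) stopped_at t G)); last first.
  apply: ler_sum => G _; exact: le_trans (stopped_at_le t G) (switched_ge G).
rewrite stopped_at_sum; have := run_value A t 0; rewrite addn0 => le.
apply: (@le_trans _ _ (\sum_M run_law rule 0 M * value R A t M)).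
  rewrite mulr_sumr big_mkcond le_eqVlt; apply/orP; left; apply/eqP.
  by apply: eq_bigr => M _; rewrite /= /uniform_law; case: ifP => _; rewrite ?mul0r.
apply: le_trans le _; rewrite [X in _ <= X]big_mkcond; apply: ler_sum => M _.
have [hb|hb] := boolP (has_bad M); first by rewrite value0_bad // mulr0.
by rewrite value_stop //=; case: (_ \in A); rewrite ?mulr1 ?mulr0.
Qed.

End Process.

(** * Total variation distance and the maximal coupling *)

Section TotalVariation.
Variables (R : realType) (T : finType).
Implicit Types (mu nu : T -> R).

Definition law mu : Prop := (forall x, 0 <= mu x) /\ \sum_x mu x = 1.

Lemma mass_setC mu (A : {set T}) : law mu -> mass mu (~: A) = 1 - mass mu A.
Proof.
move=> [_ <-]; rewrite /mass [X in _ = X - _](bigID (mem A)) /= [RHS]addrC addKr.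
by apply: eq_bigl => x; rewrite finset.in_setC.
Qed.

(** For probability laws, a lower bound on the complement of [A] is an upper bound on
    [A]. *)
Lemma mass_diff_le mu nu eps : law mu -> law nu ->
  (forall A : {set T}, mass nu A - eps <= mass mu A) ->
  forall A : {set T}, `|mass mu A - mass nu A| <= eps.
Proof.
move=> lmu lnu le A; rewrite ler_norml; apply/andP; split; first by have := le A; lra.
by have := le (~: A); rewrite !mass_setC //; lra.
Qed.

Lemma mass01 mu (A : {set T}) : law mu -> 0 <= mass mu A <= 1.
Proof.
move=> [m0 m1]; rewrite sumr_ge0 //= -m1 /mass big_mkcond; apply: ler_sum => x _.
by case: ifP.
Qed.

Lemma dTV_bounded mu nu : law mu -> law nu ->
  has_ubound (range (fun A : {set T} => `|mass mu A - mass nu A|)).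
Proof.
move=> lmu lnu; exists 1 => _ [A _ <-].
have /andP[h1 h2] := mass01 A lmu; have /andP[h3 h4] := mass01 A lnu.
by rewrite ler_norml; apply/andP; split; lra.
Qed.

Lemma le_dTV mu nu (A : {set T}) : law mu -> law nu -> `|mass mu A - mass nu A| <= dTV mu nu.
Proof. by move=> lmu lnu; apply: ub_le_sup; [exact: dTV_bounded|exists A]. Qed.

Lemma dTV_le mu nu eps : (forall A : {set T}, `|mass mu A - mass nu A| <= eps) -> dTV mu nu <= eps.
Proof.
move=> le; apply: ge_sup; first by exists `|mass mu finset.set0 - mass nu finset.set0|; exists finset.set0.
by move=> _ [A _ <-].
Qed.

Lemma dTV_ge0 mu nu : law mu -> law nu -> 0 <= dTV mu nu.
Proof. by move=> lmu lnu; apply: le_trans (normr_ge0 _) (le_dTV finset.set0 lmu lnu). Qed.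

Definition overlap mu nu (x : T) : R := Num.min (mu x) (nu x).

(** The overlap of the two laws is put on the diagonal, the two excesses are made
    independent.  If the laws coincide, the division by 0 yields the correct second
    term, namely 0. *)
Definition maximal_coupling mu nu (p : T * T) : R :=
  (p.1 == p.2)%:R * overlap mu nu p.1 +
  (mu p.1 - overlap mu nu p.1) * (nu p.2 - overlap mu nu p.2) /
    (1 - \sum_x overlap mu nu x).

Lemma overlap_le mu nu x : overlap mu nu x <= mu x /\ overlap mu nu x <= nu x.
Proof. by split; rewrite /overlap ge_min lexx ?orbT. Qed.

Lemma overlap_sum mu nu : law mu -> 1 - \sum_x overlap mu nu x = \sum_x (mu x - overlap mu nu x).
Proof. by move=> [_ m1]; rewrite sumrB m1. Qed.

Lemma overlapC mu nu : overlap mu nu = overlap nu mu.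
Proof. by apply/funext => x; rewrite /overlap minC. Qed.

Lemma excess_div mu nu x : law mu ->
  (mu x - overlap mu nu x) * (1 - \sum_x overlap mu nu x) / (1 - \sum_x overlap mu nu x) =
  mu x - overlap mu nu x.
Proof.
move=> lmu; have [z|nz] := eqVneq (1 - \sum_x overlap mu nu x) 0; last by rewrite mulfK.
rewrite z mulr0 mul0r; move: z; rewrite overlap_sum // => /eqP.
rewrite psumr_eq0 => [/allP/(_ x)|y _]; last by rewrite subr_ge0 (overlap_le mu nu y).1.
by rewrite mem_index_enum => /(_ isT)/eqP ->.
Qed.

Lemma maximal_coupling_coupling mu nu : law mu -> law nu ->
  coupling mu nu (maximal_coupling mu nu).
Proof.
move=> lmu lnu; set o := overlap mu nu.
have d0 : 0 <= 1 - \sum_x o x.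
  by rewrite overlap_sum // sumr_ge0 // => x _; rewrite subr_ge0 (overlap_le mu nu x).1.
have sumnu : 1 - \sum_x o x = \sum_x (nu x - o x) by rewrite /o overlapC overlap_sum.
split.
- move=> p; rewrite addr_ge0 //.
    by rewrite mulr_ge0 // /overlap le_min lmu.1 lnu.1.
  by rewrite divr_ge0 // mulr_ge0 // subr_ge0 ?(overlap_le mu nu _).1 ?(overlap_le mu nu _).2.
- move=> x; rewrite big_split /= (bigD1 x) //= eqxx mul1r big1 ?addr0 => [|y xy]; last first.
    by rewrite eq_sym (negPf xy) mul0r.
  rewrite -mulr_suml -mulr_sumr -sumnu excess_div // /o addrC subrK //.
- move=> y; rewrite big_split /= (bigD1 y) //= eqxx mul1r big1 ?addr0 => [|x xy]; last first.
    by rewrite (negPf xy) mul0r.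
  rewrite -!mulr_suml -(overlap_sum nu lmu) [_ * (nu y - _)]mulrC (overlapC mu nu).
  by rewrite excess_div // addrC subrK.
Qed.

(** Off the diagonal the coupling has at most the mass of the excess of [mu] over
    [nu], which is the difference of the masses of the set where [nu < mu]. *)
Lemma maximal_coupling_neq mu nu : law mu -> law nu ->
  \sum_(p | p.1 != p.2) maximal_coupling mu nu p <= dTV mu nu.
Proof.
move=> lmu lnu; set o := overlap mu nu.
have d0 : 0 <= 1 - \sum_x o x.
  by rewrite overlap_sum // sumr_ge0 // => x _; rewrite subr_ge0 (overlap_le mu nu x).1.
have sumnu : 1 - \sum_x o x = \sum_x (nu x - o x) by rewrite /o overlapC overlap_sum.
apply: (@le_trans _ _ (1 - \sum_x o x)).
  apply: (@le_trans _ _ (\sum_p (mu p.1 - o p.1) * (nu p.2 - o p.2) / (1 - \sum_x o x))).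
    rewrite big_mkcond; apply: ler_sum => p _.
    have pos : 0 <= (mu p.1 - o p.1) * (nu p.2 - o p.2) / (1 - \sum_x o x).
      by rewrite divr_ge0 // mulr_ge0 // subr_ge0 ?(overlap_le mu nu _).1 ?(overlap_le mu nu _).2.
    case: ifP => // /negPf pp; by rewrite /maximal_coupling pp mul0r add0r.
  rewrite -mulr_suml -(pair_bigA _ (fun x y => (mu x - o x) * (nu y - o y))) /=.
  under eq_bigr => x _ do rewrite -mulr_sumr.
  rewrite -mulr_suml -sumnu -(overlap_sum _ lmu).
  have [->|nz] := eqVneq (1 - \sum_x o x) 0; first by rewrite mulr0 mul0r.
  by rewrite mulfK.
(* The set that realises the distance. *)
pose A := [set x | nu x < mu x].
apply: le_trans (le_dTV A lmu lnu); apply: le_trans (ler_norm _).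
rewrite overlap_sum // /mass -sumrB [X in _ <= X]big_mkcond; apply: ler_sum => x _.
rewrite inE /o /overlap; by case: ltP => h //; rewrite subrr.
Qed.

End TotalVariation.

(** * The quantitative bound and the limit *)

Section FiniteBound.
Variables (R : realType) (n : nat) (d : 'I_n -> nat).
Notation H := (half_edge d).
Local Notation N := (#|{: H}|).
Local Notation O := ((#|{: H}| - 2)%:R : R).
Variable rule : {set {set H}} -> H * H -> R.
Hypothesis rule_ok : selection_rule rule.
Hypothesis d_graphic : graphic d.
Variables (D K : nat) (C theta : R).
Hypothesis dD : forall i, (d i <= D)%N.
Hypothesis N6 : (6 < N)%N.
Hypothesis C1 : 1 <= C.
Hypothesis th0 : 0 < theta.
Hypothesis th1 : theta <= 1.
Hypothesis PC : (sum_sq d)%:R <= C * N%:R.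
Hypothesis Dth : D%:R ^+ 2 <= theta ^+ 2 * N%:R.

Lemma N_le_O : N%:R <= 2 * O.
Proof. rewrite -natrM ler_nat; lia. Qed.

Lemma theta2_le : theta ^+ 2 <= theta.
Proof. by rewrite expr2 ler_piMl // ltW. Qed.

Lemma D2_le : D%:R ^+ 2 <= theta * (2 * O).
Proof.
apply: le_trans Dth _; apply: ler_pM => //; first by rewrite exprn_ge0 // ltW.
  exact: theta2_le.
exact: N_le_O.
Qed.

(** A common constant for the four small quantities in the induction over the
    levels, relative to [theta * (N - 2)]: [(4 K + 12) D ^+ 2] bounds the conflicts,
    and [D ^+ 2 <= 2 theta (N - 2)]; the terms in [C] are twice the constants of
    [few_nongeneric] and [deviation_product], because [N <= 2 (N - 2)]. *)
Definition error_rate : R := (8 * K + 24)%:R + 24 * C ^+ 2 + 34 * C ^+ 4.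

Lemma law_uniform_graphs : law (uniform_law R (graphs d)).
Proof.
have [G0 G0P] := d_graphic; split.
  by move=> G; rewrite /uniform_law; case: ifP => //; rewrite invr_ge0.
rewrite /uniform_law -big_mkcond sumr_const -[_ *+ _]mulr_natr mulVf // pnatr_eq0 -lt0n.
by apply/card_gt0P; exists G0.
Qed.

Lemma law_switched : law (switched_law rule).
Proof. by split; [move=> G; apply: switched_ge0|apply: switched_sum]. Qed.

Lemma mass_switched_lower (A : {set {set {set 'I_n}}}) :
  mass (uniform_law R (graphs d)) A -
   (12 * C ^+ 2 * theta + 3 * C ^+ 2 / K.+1%:R
     + (\sum_(k < K.+1) level_error (8 * C ^+ 2) k) * (error_rate * theta))
  <= mass (switched_law rule) A.
Proof.
apply: le_trans (mass_switched_ge rule_ok d_graphic K A).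
have Om0 : 0 < #|configurations d|%:R :> R by rewrite ltr0n configurations_gt0.
set Om := #|configurations d|%:R in Om0 *.
rewrite [X in _ <= X]mulrC ler_pdivlMr //.
have C0 : 0 <= C by apply: le_trans C1.
have C20 : 0 <= C ^+ 2 by rewrite exprn_ge0.
have C40 : 0 <= C ^+ 4 by rewrite exprn_ge0.
have OO : 0 < O by rewrite ltr0n; lia.
have t0 := ltW th0; have t2 := theta2_le; have NO := N_le_O; have D2 := D2_le.
have tO : 0 <= theta * O by rewrite mulr_ge0 // ltW.
have k0 : 0 <= K%:R :> R by [].
set eps := error_rate * theta.
have eps0 : 0 <= eps by rewrite /eps /error_rate mulr_ge0 // !addr_ge0 // mulr_ge0.
have target01 := mass01 A law_uniform_graphs.
have D1 := D_gt0 dD N6.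
have epsO : eps * O = (8 * K%:R + 24 + 24 * C ^+ 2 + 34 * C ^+ 4) * (theta * O).
  by rewrite /eps /error_rate natrD natrM; ring.
have e1 : 0 <= C ^+ 2 * (theta * O) by rewrite mulr_ge0.
have e2 : 0 <= C ^+ 4 * (theta * O) by rewrite mulr_ge0.
have e3 : 0 <= K%:R * (theta * O) by rewrite mulr_ge0.
have small_conflict : (conflict_bound D K)%:R <= eps * O.
  apply: (@le_trans _ _ ((4 * K + 12)%:R * D%:R ^+ 2)).
    rewrite -natrX -natrM ler_nat /conflict_bound -mulnn.
    have : (D <= D * D)%N by rewrite leq_pmulr.
    have : (K <= K * (D * D))%N by rewrite leq_pmulr // muln_gt0 D1.
    by move: D1; clear; nia.
  apply: le_trans (ler_wpM2l _ D2) _ => //.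
  rewrite epsO natrD natrM; lra.
have small_const : 4 + 2 * (D * D)%:R <= eps * O.
  have d1 : 1 <= D%:R ^+ 2 :> R by rewrite -natrX ler1n expn_gt0 D1.
  rewrite mulnn natrX epsO; lra.
have small_nongeneric :
    N%:R * #|[set M in configurations d | ~~ generic M]|%:R <= eps * O * Om.
  apply: le_trans (ler_wpM2l _ (few_nongeneric dD N6 C1 th0 PC Dth)) _ => //.
  have -> : N%:R * (Om * (12 * C ^+ 2 * theta ^+ 2)) = 12 * C ^+ 2 * (theta ^+ 2 * N%:R) * Om by ring.
  rewrite ler_wpM2r ?(ltW Om0) //.
  have h : theta ^+ 2 * N%:R <= theta * (2 * O).
    by apply: ler_pM => //; rewrite exprn_ge0.
  apply: le_trans (ler_wpM2l _ h) _; first by rewrite mulr_ge0.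
  rewrite epsO; lra.
have small_deviation :
    \sum_(M in configurations d) `|(spare_product M)%:R - centre R d| <= eps * O * Om.
  apply: le_trans (deviation_product dD N6 C1 th0 PC Dth) _.
  have -> : Om * (17 * C ^+ 4 * theta * N%:R) = 17 * C ^+ 4 * (theta * N%:R) * Om by ring.
  rewrite ler_wpM2r ?(ltW Om0) //.
  have h : theta * N%:R <= theta * (2 * O) by rewrite ler_wpM2l.
  apply: le_trans (ler_wpM2l _ h) _; first by rewrite mulr_ge0.
  rewrite epsO; lra.
have rate_le := centre_le N6 C1 th0 PC Dth.
have rate_ge0 : 0 <= 2 * (spare_sum d)%:R + centre R d.
  by rewrite addr_ge0 ?mulr_ge0 // /centre divr_ge0 // exprn_ge0.
have N2 : (2 < N)%N by apply: leq_trans N6.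
have := value_lower_bound dD N2 small_conflict small_const small_nongeneric small_deviation
   rate_le rate_ge0 eps0 target01 (value_level0 R A d_graphic).
apply: le_trans.
have nong := few_nongeneric dD N6 C1 th0 PC Dth.
have badm := mean_badset N6 C1 th0 PC Dth.
have /andP[g0 g1] := target01; set g := mass (uniform_law R (graphs d)) A in g0 g1 *.
set ng := #|[set M in configurations d | ~~ generic M]|%:R in nong *.
rewrite -mulr_suml; set b := \sum_(M in configurations d) #|badset M|%:R in badm *.
set E := \sum_(k < K.+1) _.
have ng' : ng <= Om * (12 * C ^+ 2 * theta).
  by apply: le_trans nong _; rewrite ler_wpM2l ?(ltW Om0) // ler_wpM2l // mulr_ge0.
have b' : b / K.+1%:R <= Om * (3 * C ^+ 2 / K.+1%:R).
  by rewrite mulrA ler_wpM2r // invr_ge0.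
have ng0 : 0 <= ng by [].
have b0 : 0 <= b / K.+1%:R by rewrite divr_ge0 // sumr_ge0.
have gl : g * (ng + b / K.+1%:R) <= ng + b / K.+1%:R by rewrite ler_piMl // addr_ge0.
have -> : (g - (12 * C ^+ 2 * theta + 3 * C ^+ 2 / K.+1%:R + E * eps)) * Om =
   g * Om - (Om * (12 * C ^+ 2 * theta) + Om * (3 * C ^+ 2 / K.+1%:R)) - E * eps * Om by ring.
have OmE : #|configurations d|%:R = Om by [].
rewrite OmE lerD2r.
have -> : g * (Om - ng - b / K.+1%:R) = g * Om - g * (ng + b / K.+1%:R) by ring.
by rewrite lerD2l lerN2; apply: le_trans gl _; apply: lerD.
Qed.

End FiniteBound.

(** First [K] is chosen to make the levels above [K] negligible, then [theta] to
    absorb the errors of the finitely many levels that remain. *)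
Lemma uniform_lower_bound (R : realType) (C eps : R) : 1 <= C -> 0 < eps ->
  exists2 theta : R, 0 < theta &
  forall (n : nat) (d : 'I_n -> nat) (rule : {set {set half_edge d}} -> half_edge d * half_edge d -> R)
    (D : nat), selection_rule rule -> graphic d -> (forall i, (d i <= D)%N) ->
    (6 < #|{: half_edge d}|)%N -> (sum_sq d)%:R <= C * #|{: half_edge d}|%:R ->
    D%:R ^+ 2 <= theta ^+ 2 * #|{: half_edge d}|%:R ->
  forall A : {set {set {set 'I_n}}},
    mass (uniform_law R (graphs d)) A - eps <= mass (switched_law rule) A.
Proof.
move=> C1 eps0; have C0 : 0 < C by apply: lt_le_trans C1.
pose K := Num.truncn (6 * C ^+ 2 / eps).
have hK : 3 * C ^+ 2 / K.+1%:R <= eps / 2.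
  rewrite ler_pdivrMr //.
  have : 6 * C ^+ 2 / eps < K.+1%:R.
    by apply: truncnS_gt.
  by rewrite ltr_pdivrMr // => h; lra.
pose E : R := \sum_(k < K.+1) level_error (8 * C ^+ 2) k.
pose B : R := 12 * C ^+ 2 + E * error_rate K C + 1.
have E0 : 0 <= E.
  apply: sumr_ge0 => k _; elim: (k : nat) => [//|j IH] /=.
  apply: addr_ge0; apply: mulr_ge0 => //; last exact: step_error_ge0.
  by apply: mulr_ge0 => //; apply: exprn_ge0; exact: ltW.
have er0 : 0 <= error_rate K C by rewrite /error_rate !addr_ge0 // mulr_ge0 // exprn_ge0 // ltW.
have C20 : 0 <= C ^+ 2 by rewrite exprn_ge0 // ltW.
have Ee0 : 0 <= E * error_rate K C by rewrite mulr_ge0.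
have B0 : 0 < B by rewrite /B; lra.
pose theta := Num.min 1 (eps / (2 * B)).
have th0 : 0 < theta by rewrite lt_min ltr01 divr_gt0 // mulr_gt0.
have th1 : theta <= 1 by rewrite ge_min lexx.
have thB : B * theta <= eps / 2.
  have : theta <= eps / (2 * B) by rewrite ge_min lexx orbT.
  by rewrite ler_pdivlMr ?mulr_gt0 // => h; lra.
exists theta => // n d rule D rule_ok gr dD N6 PC Dth A.
apply: le_trans (mass_switched_lower rule_ok gr K dD N6 C1 th0 th1 PC Dth A).
rewrite lerD2l lerN2 -/E.
have -> : 12 * C ^+ 2 * theta + 3 * C ^+ 2 / K.+1%:R + E * (error_rate K C * theta) =
   3 * C ^+ 2 / K.+1%:R + (B * theta - theta) by rewrite /B; ring.
apply: le_trans (lerD hK (_ : _ <= eps / 2)) _; last by rewrite -splitr.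
by apply: le_trans thB; rewrite gerBl ltW.
Qed.

Local Open Scope classical_set_scope.
Local Open Scope ring_scope.

Theorem theorem2p1 (R : realType) (d : forall n : nat, 'I_n -> nat)
    (rule : forall n : nat, {set {set half_edge (d n)}} ->
              half_edge (d n) * half_edge (d n) -> R)
    (d_graphic : forall n, (0 < n)%N -> graphic (d n))
    (rule_ok : forall n, (0 < n)%N -> selection_rule (rule n))
    (sum_d : exists c C : R, [/\ 0 < c, 0 < C &
       \forall n \near \oo,
         c * n%:R <= (\sum_i d n i)%:R :> R /\ (\sum_i d n i)%:R <= C * n%:R])
    (sum_d2 : (fun n : nat => (\sum_i d n i ^ 2)%:R : R)
                =O_\oo (fun n : nat => n%:R : R))
    (max_d : (fun n : nat => (\max_i d n i)%:R : R)
                =o_\oo (fun n : nat => Num.sqrt n%:R : R)) :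
  ((fun n : nat => dTV (switched_law (rule n)) (uniform_law R (graphs (d n))))
     @ \oo --> (0 : R))
  /\
  (exists pi : forall n : nat, {set {set 'I_n}} * {set {set 'I_n}} -> R,
     (forall n, (0 < n)%N ->
        coupling (switched_law (rule n)) (uniform_law R (graphs (d n))) (pi n))
     /\ ((fun n : nat => \sum_(p | p.1 != p.2) pi n p) @ \oo --> (0 : R))).
Proof.
have lawS n : (0 < n)%N -> law (switched_law (rule n)).
  by move=> n0; apply: law_switched; [exact: rule_ok|exact: d_graphic].
have lawU n : (0 < n)%N -> law (uniform_law R (graphs (d n))).
  by move=> n0; apply: law_uniform_graphs; exact: d_graphic.
have [c [C [c0 C0 near_sum]]] := sum_d.
have [k k0 near_sq] := (eqO_exP _ _ _).1 sum_d2.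
have near_max := (eqoP _ _ _).1 max_d.
have tv0 : (fun n : nat => dTV (switched_law (rule n)) (uniform_law R (graphs (d n)))) @ \oo --> (0 : R).
  apply/cvgrPdist_le => eps eps0.
  (* Since [N >= c * n], the sum of the squared degrees is at most [k / c] times [N]. *)
  pose C' := Num.max 1 (k / c).
  have C'1 : 1 <= C' by rewrite le_max lexx.
  have [theta th0 bound] := uniform_lower_bound C'1 eps0.
  (* Maximal degree at most this times [sqrt n] makes its square at most
     [theta ^+ 2 * N]. *)
  have sc0 : 0 < theta * Num.sqrt c by rewrite mulr_gt0 // sqrtr_gt0.
  near=> n.
  have n0 : (0 < n)%N by near: n; exact: nbhs_infty_gt.
  have [sum_ge sum_le] : c * n%:R <= (\sum_i d n i)%:R :> R /\ (\sum_i d n i)%:R <= C * n%:R.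
    by near: n.
  have sq_le : `|(\sum_i d n i ^ 2)%:R : R| <= k * `|n%:R : R| by near: n.
  have max_le : `|(\max_i d n i)%:R : R| <= theta * Num.sqrt c * `|Num.sqrt n%:R : R|.
    by near: n; apply: near_max.
  (* This ensures [7 <= c * n <= N]. *)
  have nbig : 7 / c <= n%:R by near: n; exact: nbhs_infty_ger.
  rewrite sub0r normrN ger0_norm; last by apply: dTV_ge0; [exact: lawS|exact: lawU].
  apply: dTV_le; apply: mass_diff_le; [exact: lawS|exact: lawU|].
  have cardN := card_half_edge (d n).
  have cn : c * n%:R <= #|{: half_edge (d n)}|%:R :> R by rewrite cardN.
  apply: (bound n (d n) (rule n) (\max_i d n i)%N) => //.
  - exact: rule_ok.
  - exact: d_graphic.
  - by move=> i; apply: leq_bigmax.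
  - rewrite -(ler_nat R); apply: le_trans cn.
    by move: nbig; rewrite ler_pdivrMr // mulrC.
  - rewrite sum_sqE; move: sq_le; rewrite !ger0_norm // => sq_le; apply: le_trans sq_le _.
    apply: (@le_trans _ _ (k / c * (c * n%:R))); first by rewrite mulrA divfK // lt0r_neq0.
    apply: ler_pM; [| |by rewrite le_max lexx orbT|exact: cn].
      by apply: divr_ge0; exact: ltW.
    by apply: mulr_ge0 => //; exact: ltW.
  - move: max_le; rewrite !ger0_norm ?sqrtr_ge0 // => max_le.
    apply: (@le_trans _ _ ((theta * Num.sqrt c * Num.sqrt n%:R) ^+ 2)).
      by rewrite ler_pXn2r // nnegrE // mulr_ge0 ?sqrtr_ge0 // ltW.
    rewrite !exprMn sqr_sqrtr ?(ltW c0) // sqr_sqrtr // -[X in X <= _]mulrA.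
    by apply: ler_wpM2l; [apply: exprn_ge0; exact: ltW|exact: cn].
split=> //.
exists (fun n => maximal_coupling (switched_law (rule n)) (uniform_law R (graphs (d n)))).
split; first by move=> n n0; apply: maximal_coupling_coupling; [exact: lawS|exact: lawU].
apply: (squeeze_cvgr _ (cvg_cst 0) tv0); near=> n.
have n0 : (0 < n)%N by near: n; exact: nbhs_infty_gt.
rewrite maximal_coupling_neq ?andbT; [|exact: lawS|exact: lawU].
have [pos _ _] := maximal_coupling_coupling (lawS n n0) (lawU n n0).
by apply: sumr_ge0 => p _; apply: pos.
Unshelve. all: by end_near.
Qed.
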